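(* Let $F$ be a non-trivial finite group, let $b>a$ be positive integers and $p>0$. There exists an $(\mathrm{L}^p,\mathrm{L}^0)$ measure equivalence coupling from $F\wr\mathbb{Z}^b$ to $F\wr\mathbb{Z}^a$ if and only if $p<a/b$.
   Context: Wreath product: $F\wr G=\left(\bigoplus_{g\in G}F\right)\rtimes G$, where $\bigoplus_{g\in G}F$ is the group of finitely supported functions $G\to F$ and $G$ acts by $(g\cdot f)(g')=f(g^{-1}g')$. Measure equivalence coupling between countable groups $\Gamma,\Lambda$: a quadruple $(\Omega,X_\Gamma,X_\Lambda,\mu)$ where $(\Omega,\mu)$ is a standard Borel measure space with commuting, free, measure-preserving actions $\gamma\ast x$, $\lambda\ast x$ of $\Gamma$ and $\Lambda$, and $X_\Gamma$ (resp. $X_\Lambda$) is a Borel fundamental domain of finite measure for the $\Gamma$-action (resp. $\Lambda$-action). For $\gamma\in\Gamma$, $x\in X_\Lambda$, $\gamma\cdot x$ is the unique point of $(\Lambda\ast\gamma\ast x)\cap X_\Lambda$ and the cocycle $c_{\Lambda,\Gamma}\colon\Gamma\times X_\Lambda\to\Lambda$ is defined by $c_{\Lambda,\Gamma}(\gamma,x)\ast\gamma\ast x=\gamma\cdot x$. An $(\mathrm{L}^p,\mathrm{L}^0)$ measure equivalence coupling from $\Gamma$ to $\Lambda$ is one where, for every $\gamma\in\Gamma$, $x\mapsto|c_{\Lambda,\Gamma}(\gamma,x)|_{S_\Lambda}$ lies in $\mathrm{L}^p(X_\Lambda,\mu)$ ($|\cdot|_{S_\Lambda}$ the word length for a finite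 generating set of $\Lambda$); no requirement is made on the other cocycle. *)

(* Defs.v *)
From HB Require Import structures.
From mathcomp Require Import all_boot all_order all_algebra all_fingroup.
From mathcomp Require Import all_classical all_reals all_analysis.
Set Implicit Arguments. Unset Strict Implicit. Unset Printing Implicit Defensive.
Import Order.TTheory GRing.Theory Num.Theory.
Local Open Scope classical_set_scope.
Local Open Scope ring_scope.

Record grp := Grp {
  gcar :> Type;
  gmul : gcar -> gcar -> gcar;
  gone : gcar;
  ginv : gcar -> gcar }.

Definition eval_word (G : grp) (k : nat) (s : 'I_k -> G) (w : seq (bool * 'I_k)) : G :=
  foldr (fun e acc => gmul (if e.1 then ginv (s e.2) else s e.2) acc) (gone G) w.

Definition word_rep (G : grp) (k : nat) (s : 'I_k -> G) (g : G) (n : nat) : Prop :=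
  exists w : seq (bool * 'I_k), size w = n /\ eval_word s w = g.

Definition generates (G : grp) (k : nat) (s : 'I_k -> G) : Prop :=
  forall g : G, exists n, word_rep s g n.

Lemma word_rep_ex (G : grp) (k : nat) (s : 'I_k -> G) (g : G) :
  (exists n, word_rep s g n) -> exists n, `[< word_rep s g n >].
Proof. by case=> n h; exists n; apply/asboolP. Qed.

(* word length |g|_s : the least length of a word in s^{+-1} representing g
   (0, irrelevantly, if there is none). *)
Definition wordlen (G : grp) (k : nat) (s : 'I_k -> G) (g : G) : nat :=
  match pselect (exists n, word_rep s g n) with
  | left h => ex_minn (word_rep_ex h)
  | right _ => 0%N
  end.

Definition lamp (F : finGroupType) (n : nat) :=
  {f : 'rV[int]_n -> F | finite_set [set x | f x != 1%g]}.

Definition lamp_fun (F : finGroupType) (n : nat) (f : lamp F n) : 'rV[int]_n -> F :=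
  proj1_sig f.

Lemma lamp_one_fin (F : finGroupType) (n : nat) :
  finite_set [set x : 'rV[int]_n | (fun _ => 1%g : F) x != 1%g].
Proof.
apply: (sub_finite_set _ (finite_set0 _)) => x /=.
by rewrite eqxx.
Qed.

Lemma lamp_mul_fin (F : finGroupType) (n : nat) (f f' : lamp F n) (z : 'rV[int]_n) :
  finite_set [set x | (lamp_fun f x * lamp_fun f' (x - z))%g != 1%g].
Proof.
case: f f' => f hf [f' hf'] /=; rewrite /lamp_fun /=.
apply: (@sub_finite_set _ _
  ([set x | f x != 1%g] `|` [set y + z | y in [set x | f' x != 1%g]])).
  move=> x /= hx.
  case: (eqVneq (f x) 1%g) => [e|ne]; last by left.
  right; exists (x - z); last by rewrite subrK.
  by apply: contra hx => /eqP ->; rewrite e mulg1.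
by rewrite finite_setU; split => //; apply: finite_image.
Qed.

Lemma lamp_inv_fin (F : finGroupType) (n : nat) (f : lamp F n) (z : 'rV[int]_n) :
  finite_set [set x | ((lamp_fun f (x + z))^-1)%g != 1%g].
Proof.
case: f => f hf /=; rewrite /lamp_fun /=.
apply: (@sub_finite_set _ _ [set y - z | y in [set x | f x != 1%g]]).
  move=> x /= hx; exists (x + z); last by rewrite addrK.
  by apply: contra hx => /eqP ->; rewrite invg1.
exact: finite_image.
Qed.

Definition wreath_car (F : finGroupType) (n : nat) := (lamp F n * 'rV[int]_n)%type.

(* (f, z) (f', z') = (f . (z . f'), z + z'),  (z . f')(x) = f'(x - z) *)
Definition wreath_mul (F : finGroupType) (n : nat) (u v : wreath_car F n) : wreath_car F n :=
  (exist _ (fun x => (lamp_fun u.1 x * lamp_fun v.1 (x - u.2))%g)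
           (lamp_mul_fin u.1 v.1 u.2), u.2 + v.2).

Definition wreath_one (F : finGroupType) (n : nat) : wreath_car F n :=
  (exist _ (fun _ => 1%g) (lamp_one_fin F n), 0).

Definition wreath_inv (F : finGroupType) (n : nat) (u : wreath_car F n) : wreath_car F n :=
  (exist _ (fun x => ((lamp_fun u.1 (x + u.2))^-1)%g) (lamp_inv_fin u.1 u.2), - u.2).

Definition wreath (F : finGroupType) (n : nat) : grp :=
  @Grp (wreath_car F n) (@wreath_mul F n) (wreath_one F n) (@wreath_inv F n).

Definition standard_borel (R : realType) (d : measure_display) (T : measurableType d) : Prop :=
  exists f : T -> R, [/\ measurable_fun setT f, injective f &
    forall A : set T, measurable A -> measurable (f @` A)].

Definition mp_free_action (R : realType) (d : measure_display) (T : measurableType d)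
    (mu : {measure set T -> \bar R}) (G : grp) (act : G -> T -> T) : Prop :=
  [/\ forall x, act (gone G) x = x,
      forall g h x, act (gmul g h) x = act g (act h x),
      forall g, measurable_fun setT (act g),
      forall g (A : set T), measurable A -> mu (act g @^-1` A) = mu A
    & forall g x, act g x = x -> g = gone G].

Definition fund_domain (R : realType) (d : measure_display) (T : measurableType d)
    (mu : {measure set T -> \bar R}) (G : grp) (act : G -> T -> T) (X : set T) : Prop :=
  [/\ measurable X, (forall x, exists! g : G, X (act g x)) & (mu X < +oo)%E].

(* There is an (L^p, L^0) measure equivalence coupling from Gamma to Lambda,
   word lengths in Lambda being taken w.r.t. the finite generating family s.
   For gamma in Gamma, the cocycle c(gamma, .) : X_Lambda -> Lambda is the
   (unique, by freeness and the fundamental domain property) map c with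
   c(x) * gamma * x in X_Lambda for all x in X_Lambda; the requirement is that
   x |-> |c(gamma,x)|_s lies in L^p(X_Lambda, mu). *)
Definition LpL0_ME_coupling (R : realType) (Gam Lam : grp) (k : nat)
    (s : 'I_k -> Lam) (p : R) : Prop :=
  exists (d : measure_display) (Om : measurableType d) (mu : {measure set Om -> \bar R})
         (aG : Gam -> Om -> Om) (aL : Lam -> Om -> Om) (XG XL : set Om),
  [/\ standard_borel R Om,
      (0 < mu setT)%E,
      mp_free_action mu aG /\ mp_free_action mu aL,
      (forall g l x, aG g (aL l x) = aL l (aG g x)) &
      [/\ fund_domain mu aG XG,
      fund_domain mu aL XL &
      forall gam : Gam, exists c : Om -> Lam,
        [/\ forall x, XL x -> XL (aL (c x) (aG gam x)),
            measurable_fun XL (fun x => (wordlen s (c x))%:R : R) &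
            (\int[mu]_(x in XL) ((wordlen s (c x))%:R `^ p)%:E < +oo)%E]]].
Arguments LpL0_ME_coupling {R} Gam Lam {k} s p.

(* Main.v *)
Require Import Defs.
From HB Require Import structures.
From mathcomp Require Import all_boot all_order all_algebra all_fingroup.
From mathcomp Require Import all_classical all_reals all_analysis.
From mathcomp Require Import measurable_realfun.
From mathcomp Require Import zify ring lra.
Import Order.TTheory GRing.Theory Num.Theory.
Import numFieldNormedType.Exports.

(* Necessity. Translating a Folner set of the target by the cocycle yields, by
   mass transport, a finite set [B] in the source whose size exceeds that of
   the Folner set by a bounded factor only (a large part of the target domain
   is covered by finitely many translates of the source domain) and whose
   relative boundary is the mean of [min (1, |c| / n)], which is [o (n^-p)] by
   dominated convergence as [p < 1].  For the Folner sets of [F wr Z^a] of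
   width [n] this contradicts, for [p = a / b], the isoperimetric inequality
   [log |B| >= const * eps^-b] for sets of relative boundary [eps] in
   [F wr Z^b]: most configurations of [B] have a fibre of more than
   [const * eps^-b] cursor positions, and they span that many edges each in a
   hypercube.

   Sufficiency. Read the binary digits of a generic point of the unit interval
   once as [a] and once as [b] interlaced 2-adic integers.  Adding integers
   gives actions of [Z^a] and [Z^b] by piecewise translations with the same
   orbits, namely the points that differ in finitely many digits.  A carry of
   [Z^b] passes the first [a b t] digits with probability [O (2^(- a t))] and
   otherwise moves a point by at most [2^(b t)] in [Z^a], whence integrability
   for [p < a / b].  Transporting lamps along the common orbits extends the
   cocycle to the wreath products, bijectively at every point. *)

Set Implicit Arguments. Unset Strict Implicit. Unset Printing Implicit Defensive.

(** * Isoperimetry of lamplighters *)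

(** The exponent [a / b] itself must be excluded. There a boundary of order [n^-p] would not
    suffice, since both sides of the isoperimetric inequality would grow like [n ^ a]; the gain from
    order to little-o is what decides, so Markov's inequality is too weak. Larger exponents reduce
    to this one because word lengths are integers. In the other direction, a coupling asks for free
    actions and fundamental domains at every point, while adding integers breaks down at digit
    sequences with an infinite carry. The actions are therefore built on the conull set of points
    whose interlaced coordinates contain both digits infinitely often: it is stable under changing
    finitely many digits, and every carry on it stops. The space of the coupling is the product of
    this set with [F wr Z^a], and one slice of it is a fundamental domain for both groups. It is
    laid out on the real line, one unit interval per group element, so that both groups act by
    countably many translations and all measure theory reduces to Lebesgue measure. *)

Lemma size_filter_map_le (S T : eqType) (P : pred S) (f : S -> T) (s : seq S) (t : seq T) :
  uniq s -> {in [seq x <- s | P x] &, injective f} ->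
  (forall x, x \in s -> P x -> f x \in t) -> count P s <= size t.
Proof.
move=> us fi fP; rewrite -size_filter -(size_map f); apply: uniq_leq_size.
  by rewrite map_inj_in_uniq // filter_uniq.
by move=> _ /mapP[x + ->]; rewrite mem_filter => /andP[Px xs]; exact: fP.
Qed.

Section HypercubeEdges.
Variables (T Z E : eqType) (ev : T -> Z -> E) (flip : Z -> T -> T).
Hypothesis ev_sep : forall f g, f != g -> exists z, ev f z != ev g z.
Hypothesis flip_inj : forall z, injective (flip z).
Hypothesis flip_neq : forall z w f, w != z -> ev (flip z f) w = ev f w.
Hypothesis flip_eq : forall z f, ev (flip z f) z != ev f z.

(* Splitting [W] along a coordinate separates only edges in that direction, at
   most two per vertex of the smaller part; a vertex lies in the smaller part
   at most [log2 #|W|] times. *)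
Lemma hypercube_edge_bound (W : seq T) (Ed : seq (T * Z)) :
  uniq W -> uniq Ed ->
  (forall u, u \in Ed -> (u.1 \in W) && (flip u.2 u.1 \in W)) ->
  size Ed <= 2 * size W * trunc_log 2 (size W).
Proof.
have [n] := ubnP (size W); elim: n W Ed => // n IH W Ed; rewrite ltnS => sW uW uE hE.
case: (ltnP 1 (size W)) => W1; last first.
  case: Ed uE hE => [//|u Ed] _ /(_ u); rewrite mem_head => /(_ isT) /andP[].
  case: W W1 {sW uW} => [|f [|//]] //= _; rewrite !inE => /eqP -> /eqP e.
  by have := flip_eq u.2 f; rewrite e eqxx.
have [f1 [f2 [f1W f2W /ev_sep[z0 dz]]]] : exists f1 f2, [/\ f1 \in W, f2 \in W & f1 != f2].
  case: W W1 uW {sW hE} => [//|f1 [//|f2 W]] _ /= /andP[]; rewrite inE negb_or => /andP[h _] _.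
  by exists f1, f2; rewrite !inE !eqxx orbT.
pose P f := ev f z0 == ev f1 z0.
pose U := [seq f <- W | P f]; pose V := [seq f <- W | ~~ P f].
have uU : uniq U by rewrite filter_uniq.
have uV : uniq V by rewrite filter_uniq.
have sUV : size U + size V = size W by rewrite !size_filter count_predC.
have U0 : 0 < size U by rewrite size_filter -has_count; apply/hasP; exists f1 => //; rewrite /P.
have V0 : 0 < size V.
  by rewrite size_filter -has_count; apply/hasP; exists f2 => //; rewrite /P eq_sym.
pose c1 (u : T * Z) := P u.1; pose c2 (u : T * Z) := P (flip u.2 u.1).
have cross u : c1 u != c2 u -> u.2 = z0.
  rewrite /c1 /c2 /P => h; apply/eqP; apply: contraNT h => h.
  by rewrite flip_neq // eq_sym.
have hU : size [seq u <- Ed | c1 u && c2 u] <= 2 * size U * trunc_log 2 (size U).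
  apply: IH => //; [lia | by rewrite filter_uniq | move=> u].
  rewrite mem_filter => /andP[/andP[h1 h2] /hE /andP[h3 h4]].
  by rewrite !mem_filter h3 h4 !andbT; apply/andP.
have hV : size [seq u <- Ed | ~~ c1 u && ~~ c2 u] <= 2 * size V * trunc_log 2 (size V).
  apply: IH => //; [lia | by rewrite filter_uniq | move=> u].
  rewrite mem_filter => /andP[/andP[h1 h2] /hE /andP[h3 h4]].
  by rewrite !mem_filter h3 h4 !andbT; apply/andP.
(* A crossing edge has direction [z0], so its source determines it, and so does its target. As
   [flip z] need not be an involution, edges are directed, and the two ways of crossing are counted
   separately. *)
have i1 (Q : pred (T * Z)) : (forall u, Q u -> c1 u != c2 u) ->
    {in [seq u <- Ed | Q u] &, injective (fun u : T * Z => u.1)}.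
  move=> hQ [f z] [g w]; rewrite !mem_filter => /andP[/hQ/cross /= -> _] /andP[/hQ/cross /= -> _] /=.
  by move=> ->.
have i2 (Q : pred (T * Z)) : (forall u, Q u -> c1 u != c2 u) ->
    {in [seq u <- Ed | Q u] &, injective (fun u : T * Z => flip u.2 u.1)}.
  move=> hQ [f z] [g w]; rewrite !mem_filter => /andP[/hQ/cross /= -> _] /andP[/hQ/cross /= -> _] /=.
  by move=> /flip_inj ->.
have q1 u : c1 u && ~~ c2 u -> c1 u != c2 u by case: (c1 u) (c2 u) => [] [].
have q2 u : ~~ c1 u && c2 u -> c1 u != c2 u by case: (c1 u) (c2 u) => [] [].
have h12 : count (fun u => c1 u && ~~ c2 u) Ed <= minn (size U) (size V).
  rewrite leq_min; apply/andP; split.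
    apply: size_filter_map_le (i1 _ q1) _ => // u /hE /andP[a b] /andP[c d].
    by rewrite mem_filter a andbT.
  apply: size_filter_map_le (i2 _ q1) _ => // u /hE /andP[a b] /andP[c d].
  by rewrite mem_filter b andbT.
have h21 : count (fun u => ~~ c1 u && c2 u) Ed <= minn (size U) (size V).
  rewrite leq_min; apply/andP; split.
    apply: size_filter_map_le (i2 _ q2) _ => // u /hE /andP[a b] /andP[c d].
    by rewrite mem_filter b andbT.
  apply: size_filter_map_le (i1 _ q2) _ => // u /hE /andP[a b] /andP[c d].
  by rewrite mem_filter a andbT.
have hs : size Ed = count (fun u => c1 u && c2 u) Ed + count (fun u => ~~ c1 u && ~~ c2 u) Ed
   + count (fun u => c1 u && ~~ c2 u) Ed + count (fun u => ~~ c1 u && c2 u) Ed.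
  elim: (Ed) => //= u s ->; case: (c1 u) (c2 u) => [] [] /=; lia.
move: hU hV; rewrite ![size [seq u <- Ed | _]]size_filter => hU hV.
(* The smaller part gains a unit of [trunc_log], which pays for the at most
   [2 * minn (size U) (size V)] crossing edges. *)
have lg (X : seq T) : 0 < size X -> 2 * size X <= size W -> (trunc_log 2 (size X)).+1 <= trunc_log 2 (size W).
  by move=> X0 h; rewrite -trunc_logMp //; apply: leq_trunc_log.
have lg0 (X : seq T) : size X <= size W -> trunc_log 2 (size X) <= trunc_log 2 (size W) by exact: leq_trunc_log.
case: (leqP (size U) (size V)) => UV.
  have := lg U U0; have := lg0 V; nia.
have := lg V V0; have := lg0 U; nia.
Qed.

End HypercubeEdges.

Lemma count_leU (S : eqType) (P Q1 Q2 : pred S) (s : seq S) :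
  {in s, forall x, P x -> Q1 x || Q2 x} -> count P s <= count Q1 s + count Q2 s.
Proof.
move=> h; rewrite -count_predUI; apply: leq_trans (leq_addr _ _).
by rewrite -2!size_filter; apply: size_subseq; rewrite subseq_filter filter_subseq andbT;
  apply/allP => x; rewrite mem_filter => /andP[Px xs]; exact: h.
Qed.

Lemma sum_filter_fst (S T : eqType) (B : seq (S * T)) (P : pred S) (Q : pred (S * T)) :
  count (fun u => P u.1 && Q u) B =
  \sum_(f <- undup (map fst B) | P f) count (fun u => (u.1 == f) && Q u) B.
Proof.
transitivity (\sum_(u <- B | P u.1 && Q u) 1); first by rewrite sum1_count.
have -> : \sum_(f <- undup (map fst B) | P f) count (fun u => (u.1 == f) && Q u) B =
   \sum_(f <- undup (map fst B) | P f) \sum_(u <- B | (u.1 == f) && Q u) 1.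
  by apply: eq_bigr => f _; rewrite sum1_count.
rewrite (exchange_big_dep (fun u => P u.1 && Q u)) /=; last first.
  by move=> f u Pf /andP[/eqP -> ->]; rewrite Pf.
rewrite big_seq_cond [RHS]big_seq_cond; apply: eq_bigr => u /and3P[uB Pu Qu].
have fu : u.1 \in undup (map fst B) by rewrite mem_undup map_f.
rewrite big_mkcond (bigD1_seq u.1) ?undup_uniq //= eqxx Pu Qu big1_seq //= => f /andP[fu' _].
by rewrite [u.1 == f]eq_sym (negbTE fu') andbF.
Qed.

(** * Isoperimetry in lattices *)

Section TranslationBoundary.
Variables (V : zmodType) (S : seq V).
Hypothesis uS : uniq S.

Let bd (v : V) := count (fun x => (x + v)%R \notin S) S.

(** A point that [v + w] moves out of [S] is moved out by [v], or is moved by [v] to a point of [S]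
    that [w] moves out; translation by [v] is injective. *)
Lemma boundaryD v w : bd (v + w)%R <= bd v + bd w.
Proof.
apply: (@leq_trans (bd v + count (fun x => ((x + v)%R \in S) && ((x + (v + w))%R \notin S)) S)).
  by apply: count_leU => x _ ->; rewrite andbT orNb.
rewrite leq_add2l -size_filter [leqRHS]/bd -[leqRHS]size_filter size_filter.
apply: (@size_filter_map_le _ _ _ (fun x => x + v)%R) => //.
  by move=> x y _ _; apply: addIr.
by move=> x xS /andP[h1 h2]; rewrite mem_filter h1 -addrA h2.
Qed.

Lemma boundaryMn v n : bd (v *+ n)%R <= n * bd v.
Proof.
elim: n => [|n IH].
  rewrite mulr0n /bd (eq_in_count (a2 := pred0)) ?count_pred0 // => x xS.
  by rewrite addr0 xS.
by rewrite mulrS mulSn; apply: leq_trans (boundaryD _ _) _; rewrite leq_add2l.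
Qed.

Lemma boundary_sum (b : nat) (e : 'I_b -> V) (q : 'I_b -> nat) :
  bd (\sum_i e i *+ q i)%R <= \sum_i q i * bd (e i).
Proof.
elim/big_rec2 : _ => [|i v n _ h].
  by rewrite /bd (eq_in_count (a2 := pred0)) ?count_pred0 // => x xS; rewrite addr0 xS.
by apply: leq_trans (boundaryD _ _) _; apply: leq_add => //; exact: boundaryMn.
Qed.

(* A translate of [S] by a typical vector of a box with at least [2 #|S|]
   elements misses half of [S]. *)
Lemma lattice_isoperimetry (b m : nat) (e : 'I_b -> V) : 0 < m ->
  injective (fun q : {ffun 'I_b -> 'I_m} => \sum_i e i *+ q i)%R ->
  2 * size S <= m ^ b -> size S <= 2 * m * \sum_i bd (e i).
Proof.
move=> m0 inje hS; pose Q : finType := {ffun 'I_b -> 'I_m}.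
pose pt (q : Q) := (\sum_i e i *+ q i)%R.
have cQ : #|Q| = m ^ b by rewrite card_ffun !card_ord.
have h1 : \sum_(q : Q) bd (pt q) <= m ^ b * (m * \sum_i bd (e i)).
  rewrite -cQ -sum_nat_const; apply: leq_sum => q _.
  apply: leq_trans (boundary_sum _ _) _; rewrite big_distrr /=.
  by apply: leq_sum => i _; rewrite leq_mul2r ltnW ?orbT.
(* For each [x] in [S], the [m ^ b] points [x + pt q] are distinct and at most [size S] of them,
   hence at most half, lie in [S]. *)
have h2 : size S * (m ^ b - size S) <= \sum_(q : Q) bd (pt q).
  have -> : \sum_(q : Q) bd (pt q) = \sum_(x <- S) \sum_(q : Q | (x + pt q)%R \notin S) 1.
    rewrite (exchange_big_dep xpredT) //=; apply: eq_bigr => q _.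
    by rewrite sum1_count.
  rewrite mulnC -sum1_size big_distrr /=; apply: leq_sum => x _.
  rewrite muln1 sum1_card -cQ leq_subLR.
  rewrite -(cardC (fun q : Q => (x + pt q)%R \in S)) leq_add2r.
  rewrite cardE -[X in X <= _](size_map (fun q : Q => x + pt q)%R).
  rewrite sum1_size; apply: uniq_leq_size.
    by rewrite map_inj_uniq ?enum_uniq // => q r /addrI /inje.
  by move=> _ /mapP[q + ->]; rewrite mem_enum.
have m1 : 0 < m ^ b by rewrite expn_gt0 m0.
rewrite -(leq_pmul2l m1); apply: leq_trans (_ : 2 * (size S * (m ^ b - size S)) <= _); nia.
Qed.

End TranslationBoundary.

Section Lamplighter.
Variables (T E : eqType) (V : zmodType) (ev : T -> V -> E) (flip : V -> T -> T).
Hypothesis ev_sep : forall f g, f != g -> exists z, ev f z != ev g z.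
Hypothesis flip_inj : forall z, injective (flip z).
Hypothesis flip_neq : forall z w f, w != z -> ev (flip z f) w = ev f w.
Hypothesis flip_eq : forall z f, ev (flip z f) z != ev f z.
Variables (b m : nat) (e : 'I_b -> V).
Hypothesis m0 : 0 < m.
Hypothesis b0 : 0 < b.
Hypothesis inje : injective (fun q : {ffun 'I_b -> 'I_m} => \sum_i e i *+ q i)%R.

(* Most of an almost invariant set [B] lies over lamp configurations whose
   fibre has more than [m ^ b / 2] cursor positions; each of these positions
   is, up to a small proportion, an edge of a hypercube. *)
Lemma lamplighter_isoperimetry (B : seq (T * V)) :
  uniq B -> 0 < size B ->
  (forall i, count (fun u => (u.1, (u.2 + e i)%R) \notin B) B * (8 * b * m) <= size B) ->
  count (fun u => (flip u.2 u.1, u.2) \notin B) B * 8 <= size B ->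
  exists L, 2 ^ L <= size B /\ 3 * m ^ b <= 32 * L.
Proof.
move=> uB B0 hmove hflip.
pose fib f := [seq u.2 | u : T * V <- B & u.1 == f].
have sfib f : size (fib f) = count (fun u => u.1 == f) B by rewrite size_map size_filter.
have ufib f : uniq (fib f).
  rewrite map_inj_in_uniq ?filter_uniq // => -[x z] [y w]; rewrite !mem_filter /=.
  by move=> /andP[/eqP -> _] /andP[/eqP -> _] ->.
have mfib f z : (z \in fib f) = ((f, z) \in B).
  apply/mapP/idP => [[[g w]]|h]; last by exists (f, z) => //; rewrite mem_filter eqxx.
  by rewrite mem_filter /= => /andP[/eqP -> h] ->.
pose small f := 2 * size (fib f) <= m ^ b.
pose bdi i := count (fun u => (u.1, (u.2 + e i)%R) \notin B) B.
have fibbd f v : count (fun x => (x + v)%R \notin fib f) (fib f) =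
    count (fun u => (u.1 == f) && ((u.1, (u.2 + v)%R) \notin B)) B.
  rewrite count_map count_filter; apply: eq_count => u /=; rewrite mfib andbC.
  by case: eqP => //= ->.
(* A small fibre is at most [2 * m] times its boundary. Each of the [b] directions has total
   boundary at most [size B / (8 * b * m)], which leaves a quarter of [B]. *)
have hsmall : 4 * count (fun u => small u.1) B <= size B.
  have h : count (fun u => small u.1) B <= 2 * m * \sum_i bdi i.
    rewrite (eq_count (a2 := fun u => small u.1 && true)) => [|u]; last by rewrite andbT.
    rewrite sum_filter_fst; apply: leq_trans (_ : \sum_(f <- undup (map fst B) | small f)
       2 * m * \sum_i count (fun u => (u.1 == f) && ((u.1, (u.2 + e i)%R) \notin B)) B <= _).
      apply: leq_sum => f sf.
      rewrite (eq_count (a2 := fun u => u.1 == f)) => [|u]; last by rewrite andbT.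
      rewrite -sfib; apply: leq_trans (lattice_isoperimetry (ufib f) m0 inje sf) _.
      by under eq_bigr do rewrite fibbd.
    rewrite -big_distrr /= leq_mul2l; apply/orP; right.
    rewrite exchange_big /=; apply: leq_sum => i _.
    rewrite -(sum_filter_fst B small (fun u => (u.1, (u.2 + e i)%R) \notin B)).
    by apply: sub_count => u /andP[].
  have h2 : (\sum_i bdi i) * (8 * b * m) <= b * size B.
    rewrite big_distrl /=; apply: leq_trans (_ : \sum_(i < b) size B <= _).
      by apply: leq_sum => i _; exact: hmove.
    by rewrite sum_nat_const card_ord.
  have h3 : (\sum_i bdi i) * (8 * m) <= size B.
    by rewrite -(leq_pmul2l b0); move: h2; set x := (\sum_i bdi i); lia.
  lia.
pose W := [seq f <- undup (map fst B) | ~~ small f].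
have uW : uniq W by rewrite filter_uniq ?undup_uniq.
pose good (u : T * V) := [&& ~~ small u.1, (flip u.2 u.1, u.2) \in B & ~~ small (flip u.2 u.1)].
(* An element of [B] fails to be good if its own fibre is small, if its flip leaves [B], or if its
   flip lies in a small fibre; flipping injects the last kind into the first. *)
have hgood : size B <= count good B + 2 * count (fun u => small u.1) B +
    count (fun u => (flip u.2 u.1, u.2) \notin B) B.
  have h : count (fun u => ((flip u.2 u.1, u.2) \in B) && small (flip u.2 u.1)) B
      <= count (fun u => small u.1) B.
    rewrite -[leqRHS]size_filter.
    apply: (@size_filter_map_le _ _ _ (fun u : T * V => (flip u.2 u.1, u.2))) => //.
      by move=> [f z] [g w] _ _ [+ zw]; rewrite /= zw => /flip_inj ->.
    by move=> u _ /andP[h1 h2]; rewrite mem_filter /= h2 h1.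
  rewrite -(count_predC (fun u => (flip u.2 u.1, u.2) \notin B) B) addnC leq_add2r.
  rewrite mul2n -addnn addnA; apply: leq_trans (leq_add (leqnn _) h).
  apply: (@leq_trans (count (fun u => good u || small u.1) B +
      count (fun u => ((flip u.2 u.1, u.2) \in B) && small (flip u.2 u.1)) B)).
    apply: count_leU => u _ /=; rewrite negbK /good => ->.
    by case: (small u.1); case: (small _).
  by rewrite leq_add2r; apply: count_leU.
have hE : count good B <= 2 * size W * trunc_log 2 (size W).
  rewrite -size_filter; apply: (hypercube_edge_bound ev_sep flip_inj flip_neq flip_eq) => //.
    by rewrite filter_uniq.
  move=> u; rewrite mem_filter => /andP[/and3P[s1 s2 s3] uB'].
  rewrite !mem_filter s1 s3 !mem_undup (map_f fst uB') /=.
  exact: (map_f fst s2).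
have hW : size W * m ^ b <= 2 * size B.
  have : \sum_(f <- undup (map fst B) | ~~ small f) size (fib f) <= size B.
    under eq_bigr do rewrite sfib.
    have := @sum_filter_fst _ _ B (fun f => ~~ small f) predT.
    under eq_bigr do under eq_count do rewrite andbT.
    by move=> <-; exact: count_size.
  rewrite -big_filter -/W => h; apply: leq_trans (leq_mul (leqnn 2) h).
  rewrite -sum1_size big_distrl big_distrr /= [leqLHS]big_seq [leqRHS]big_seq.
  apply: leq_sum => f; rewrite mem_filter => /andP[sf _].
  by rewrite mul1n ltnW // ltnNge.
exists (trunc_log 2 (size W)).
have W0 : 0 < size W by rewrite lt0n; apply/eqP => W0; move: hE; rewrite W0; lia.
split.
  apply: leq_trans (trunc_logP _ W0) _ => //.
  apply: leq_trans (_ : size (map fst B) <= _); last by rewrite size_map.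
  by apply: uniq_leq_size uW _ => f; rewrite mem_filter mem_undup => /andP[].
(* At least [1 - 2/4 - 1/8 = 3/8] of [B] is good, hence [6 * size B <= 16 * count good B], which
   [hE] bounds by [32 * size W * trunc_log 2 (size W)]; and [3 * size W * m ^ b <= 6 * size B] by
   [hW]. *)
rewrite -(leq_pmul2l W0).
apply: leq_trans (_ : 6 * size B <= _); first lia.
set c := count good B in hE hgood; lia.
Qed.

End Lamplighter.

Local Open Scope classical_set_scope.
Local Open Scope ring_scope.

(** * Groups, word length and wreath products *)

(** A [grp] carries operations without axioms, so the axioms form a separate hypothesis. *)
Definition group_laws (G : grp) : Prop :=
  [/\ associative (@gmul G), left_id (gone G) (@gmul G) &
      left_inverse (gone G) (@ginv G) (@gmul G)].

Section GroupLaws.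
Variable G : grp.
Hypothesis GL : group_laws G.

Lemma gmulA : associative (@gmul G). Proof. by case: GL. Qed.
Lemma gmul1g : left_id (gone G) (@gmul G). Proof. by case: GL. Qed.
Lemma gmulVg : left_inverse (gone G) (@ginv G) (@gmul G). Proof. by case: GL. Qed.

Lemma gmulgV : right_inverse (gone G) (@ginv G) (@gmul G).
Proof.
move=> x; rewrite -[LHS]gmul1g -(gmulVg (ginv x)) -gmulA (gmulA (ginv x) x).
by rewrite gmulVg gmul1g.
Qed.

Lemma gmulg1 : right_id (gone G) (@gmul G).
Proof. by move=> x; rewrite -(gmulVg x) gmulA gmulgV gmul1g. Qed.

Lemma gmulKg (x y : G) : gmul (ginv x) (gmul x y) = y.
Proof. by rewrite gmulA gmulVg gmul1g. Qed.

Lemma gmulgK (x y : G) : gmul (gmul y x) (ginv x) = y.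
Proof. by rewrite -gmulA gmulgV gmulg1. Qed.

Lemma gmulgKV (x y : G) : gmul (gmul y (ginv x)) x = y.
Proof. by rewrite -gmulA gmulVg gmulg1. Qed.

Lemma gmulgI (x : G) : injective (gmul x).
Proof. by move=> y z /(congr1 (gmul (ginv x))); rewrite !gmulKg. Qed.

Lemma gmulIg (x : G) : injective (fun y => gmul y x).
Proof. by move=> y z /(congr1 (fun y => gmul y (ginv x))); rewrite /= !gmulgK. Qed.

Lemma ginvK : involutive (@ginv G).
Proof. by move=> x; apply: (@gmulgI (ginv x)); rewrite gmulgV gmulVg. Qed.

Lemma ginv_unique (x y : G) : gmul x y = gone G -> x = ginv y.
Proof. by move=> h; apply: (@gmulIg y); rewrite h gmulVg. Qed.

Lemma ginvM (x y : G) : ginv (gmul x y) = gmul (ginv y) (ginv x).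
Proof. by apply/esym/ginv_unique; rewrite gmulA gmulgKV gmulVg. Qed.

Variables (k : nat) (s : 'I_k -> G).
Hypothesis gen : generates s.

Lemma eval_word_cat w1 w2 : eval_word s (w1 ++ w2) = gmul (eval_word s w1) (eval_word s w2).
Proof.
elim: w1 => [|u w IH]; first by rewrite /eval_word /= gmul1g.
by rewrite /= [LHS]/= -/(eval_word s _) IH gmulA.
Qed.

Lemma wordlenP (g : G) : exists2 w, size w = wordlen s g & eval_word s w = g.
Proof.
rewrite /wordlen; case: pselect => [h|]; last by case; exact: gen.
by case: ex_minnP => n /asboolP[w [<- <-]] _; exists w.
Qed.

Lemma wordlen_min w : (wordlen s (eval_word s w) <= size w)%N.
Proof.
rewrite /wordlen; case: pselect => // h; case: ex_minnP => n _; apply.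
by apply/asboolP; exists w.
Qed.

Lemma wordlenM (g h : G) : (wordlen s (gmul g h) <= wordlen s g + wordlen s h)%N.
Proof.
have [w1 <- <-] := wordlenP g; have [w2 <- <-] := wordlenP h.
by rewrite -eval_word_cat -size_cat wordlen_min.
Qed.

Lemma wordlen1 : wordlen s (gone G) = 0%N.
Proof. by apply/eqP; rewrite -leqn0; apply: (wordlen_min [::]). Qed.

End GroupLaws.

Section Wreath.
Variables (F : finGroupType) (n : nat).
Implicit Types (f : lamp F n) (u v : wreath_car F n) (x z : 'rV[int]_n).

Lemma lamp_eq f f' : lamp_fun f =1 lamp_fun f' -> f = f'.
Proof.
case: f f' => [f hf] [f' hf'] /= /funext; rewrite /lamp_fun /= => e.
by case: _ / e hf' => hf'; congr exist; apply: Prop_irrelevance.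
Qed.

Lemma wreath_eq u v : lamp_fun u.1 =1 lamp_fun v.1 -> u.2 = v.2 -> u = v.
Proof. by case: u v => [f z] [f' z'] /= /lamp_eq -> ->. Qed.

Lemma wreath_laws : group_laws (wreath F n).
Proof.
split=> /=.
- move=> u v w; apply: wreath_eq => [x|] /=; last by rewrite addrA.
  by rewrite /lamp_fun /= mulgA opprD addrA.
- by move=> u; apply: wreath_eq => [x|] /=; rewrite ?add0r // /lamp_fun /= mul1g subr0.
- move=> u; apply: wreath_eq => [x|] /=; last by rewrite addNr.
  by rewrite /lamp_fun /= opprK mulVg.
Qed.

Lemma lamp_single_fin (v : 'rV[int]_n) (h : F) :
  finite_set [set x : 'rV[int]_n | (if x == v then h else 1%g) != 1%g].
Proof.
by apply: sub_finite_set (finite_set1 v) => x /=; case: (eqVneq x v) => [->|]; rewrite ?eqxx.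
Qed.

Definition lamp_single (v : 'rV[int]_n) (h : F) : lamp F n :=
  exist _ (fun x => if x == v then h else 1%g) (lamp_single_fin v h).

Definition lamp_at (h : F) : wreath F n := (lamp_single 0 h, 0).
Definition move_by z : wreath F n := ((wreath_one F n).1, z).

Definition unitv (i : 'I_n) : 'rV[int]_n := delta_mx 0 i.

Lemma unitv_comb (q : 'I_n -> nat) j : (\sum_i unitv i *+ q i) 0 j = (q j)%:Z.
Proof.
rewrite summxE (bigD1 j) //= big1 => [|i ij]; rewrite mulmxnE mxE eqxx /=.
  by rewrite eqxx addr0 pmulrn; lia.
by rewrite eq_sym (negbTE ij) mul0rn.
Qed.

(** Left multiplication by a translation shifts the lamps along with the cursor. The coordinates
    [Phi] record the lamps relative to the cursor: there [move_by] changes the second component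
    only, and [lamp_at h], which acts at the origin, changes only the lamp at [- z]. *)
Lemma wreath_isoperimetry (h : F) (m : nat) (B : seq {classic wreath F n}) :
  h != 1%g -> (0 < m)%N -> (0 < n)%N -> uniq B -> (0 < size B)%N ->
  (forall i, count (fun u => (gmul (move_by (unitv i)) u : {classic _}) \notin B) B
     * (8 * n * m) <= size B)%N ->
  (count (fun u => (gmul (lamp_at h) u : {classic _}) \notin B) B * 8 <= size B)%N ->
  exists L, (2 ^ L <= size B /\ 3 * m ^ n <= 32 * L)%N.
Proof.
move=> h1 m0 n0 uB B0 hm hl.
pose T : eqType := ('rV[int]_n -> F)%type.
pose flip (z : 'rV[int]_n) (f : T) : T := fun x => if x == - z then (h * f x)%g else f x.
pose ev (f : T) (z : 'rV[int]_n) := f (- z).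
pose Phi (u : {classic wreath F n}) : T * 'rV[int]_n := (fun x => lamp_fun u.1 (x + u.2), u.2).
have Phi_inj : injective Phi.
  move=> u v [e1 e2]; apply: wreath_eq => // x.
  by move/(congr1 (@^~ (x - u.2))): e1; rewrite /= subrK e2 subrK.
have mPhi u : (Phi u \in map Phi B) = (u \in B) by rewrite mem_map.
rewrite -(size_map Phi) in B0 hm hl *.
apply: (@lamplighter_isoperimetry T F _ ev flip _ _ _ _ n m unitv) => //.
- move=> f g fg; apply/not_existsP => e; move/eqP: fg; apply; apply/funext => x.
  by have /negP/negPn/eqP := e (- x); rewrite /ev opprK.
- move=> z f g e; apply/funext => x; move/(congr1 (@^~ x)): e; rewrite /flip.
  by case: eqP => // _ /mulgI.
- by move=> z w f wz; rewrite /ev /flip eqr_opp (negbTE wz).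
- move=> z f; rewrite /ev /flip eqxx -[X in _ != X]mul1g.
  by apply: contra h1 => /eqP/mulIg ->.
- move=> q r e; apply/ffunP => j; apply/val_inj.
  by move/matrixP: e => /(_ 0 j); rewrite !unitv_comb => -[].
- by rewrite map_inj_uniq.
- move=> i; apply: leq_trans (hm i); rewrite leq_mul2r count_map; apply/orP; right.
  apply: sub_count => u; rewrite [X in X -> _]/=.
  have -> : ((Phi u).1, (Phi u).2 + unitv i) = Phi (gmul (move_by (unitv i)) u); last by rewrite mPhi.
  congr pair; last by rewrite addrC.
  by apply/funext => x; rewrite /lamp_fun /= mul1g [unitv i + _]addrC addrA addrK.
apply: leq_trans hl; rewrite leq_mul2r count_map; apply: sub_count => u; rewrite [X in X -> _]/=.
have -> : (flip (Phi u).2 (Phi u).1, (Phi u).2) = Phi (gmul (lamp_at h) u); last by rewrite mPhi.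
congr pair; last by rewrite /= add0r.
apply/funext => x; rewrite /flip /lamp_fun /= add0r subr0 addr_eq0.
by case: eqP => // _; rewrite mul1g.
Qed.

Lemma lamp_support_ex (f : lamp F n) :
  exists s : seq 'rV[int]_n, forall x, lamp_fun f x != 1%g -> x \in s.
Proof.
have [s hs] := (finite_seqP _).1 (proj2_sig f); exists s => x hx.
by have : [set` s] x by rewrite -hs.
Qed.

Definition lamp_supp (f : lamp F n) : seq 'rV[int]_n := sval (cid (lamp_support_ex f)).

Lemma lamp_suppP (f : lamp F n) x : lamp_fun f x != 1%g -> x \in lamp_supp f.
Proof. exact: (svalP (cid (lamp_support_ex f))). Qed.

End Wreath.

(** * Folner sets of wreath products *)

Lemma count_has_le (S L : eqType) (P : L -> pred S) (l : seq L) (s : seq S) :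
  (count (fun u => has (fun v => P v u) l) s <= \sum_(v <- l) count (P v) s)%N.
Proof.
elim: l => [|v l IH]; first by rewrite big_nil count_pred0.
by rewrite big_cons; apply: leq_trans (leq_add (leqnn _) IH); apply: count_leU => u _ /=.
Qed.

Lemma card_count (T : finType) (P : pred T) : #|P| = count P (enum {: T}).
Proof. by rewrite cardE {1}/enum_mem size_filter -enumT. Qed.

Section WreathFolner.
Variables (F : finGroupType) (a N : nat).

Notation Q := {ffun 'I_a -> 'I_N}.
Definition box_pt (q : Q) : 'rV[int]_a := \row_j (q j)%:Z.
Definition in_box (v : 'rV[int]_a) : bool := [forall j, (0 <= v 0 j) && (v 0 j < N%:Z)].

Lemma in_boxP v : reflect (exists q, v = box_pt q) (in_box v).
Proof.
apply: (iffP forallP) => [h|[q ->] j]; last by rewrite mxE; have := ltn_ord (q j); lia.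
have hj j : (`|v 0%R j| < N)%N by have := h j; lia.
exists [ffun j => Ordinal (hj j)]; apply/rowP => j; rewrite mxE ffunE /=.
by have := h j; lia.
Qed.

Lemma box_pt_inj : injective box_pt.
Proof.
move=> q r /rowP e; apply/ffunP => j; apply/val_inj.
by have := e j; rewrite !mxE => -[].
Qed.

(** The usual Folner set, with lamps and cursor in the box, is almost invariant on the right.
    Boundaries here are taken on the left, so its inverses are used: cursor [- q], lamps in the box
    translated by [- q]. *)
Definition folner_lamp (u : Q * {ffun Q -> F}) (x : 'rV[int]_a) : F :=
  if [pick q | box_pt q == x + box_pt u.1] is Some q then u.2 q else 1%g.

Lemma folner_lamp_box u x : folner_lamp u x != 1%g -> in_box (x + box_pt u.1).
Proof.
rewrite /folner_lamp; case: pickP => [q /eqP e _|_]; last by rewrite eqxx.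
by apply/in_boxP; exists q.
Qed.

Lemma folner_lampE u q : folner_lamp u (box_pt q - box_pt u.1) = u.2 q.
Proof.
rewrite /folner_lamp; case: pickP => [r|/(_ q)]; rewrite subrK ?eqxx //.
by move/eqP/box_pt_inj ->.
Qed.

Lemma folner_lamp_fin u : finite_set [set x | folner_lamp u x != 1%g].
Proof.
apply: (@sub_finite_set _ _ [set box_pt q - box_pt u.1 | q in [set: Q]]) => [x /=|]; last first.
  by apply: finite_image; exact: finite_finset.
by move/folner_lamp_box/in_boxP => [q e]; exists q => //; rewrite -e addrK.
Qed.

Definition folner_elt u : {classic wreath F a} :=
  ((exist _ (folner_lamp u) (folner_lamp_fin u) : lamp F a), - box_pt u.1).

Lemma folner_elt_inj : injective folner_elt.
Proof.
move=> [q f] [r g] e.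
have er : q = r by apply: box_pt_inj; apply: oppr_inj; exact: (congr1 snd e).
rewrite -er in e *; congr pair; apply/ffunP => t.
have := congr1 (fun w : wreath F a => lamp_fun w.1 (box_pt t - box_pt q)) e.
by rewrite /lamp_fun /= !folner_lampE.
Qed.

Definition folner_seq := [seq folner_elt u | u <- enum {: Q * {ffun Q -> F}}].

Lemma folner_seq_uniq : uniq folner_seq.
Proof. by rewrite map_inj_uniq ?enum_uniq //; exact: folner_elt_inj. Qed.

Lemma size_folner_seq : size folner_seq = (N ^ a * #|F| ^ (N ^ a))%N.
Proof. by rewrite size_map -cardE card_prod !card_ffun !card_ord. Qed.

Lemma mem_folner_seq (l : wreath F a) q : l.2 = - box_pt q ->
  (forall x, lamp_fun l.1 x != 1%g -> in_box (x + box_pt q)) ->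
  (l : {classic _}) \in folner_seq.
Proof.
move=> l2 l1; apply/mapP; exists (q, [ffun r => lamp_fun l.1 (box_pt r - box_pt q)]).
  by rewrite mem_enum inE.
apply: wreath_eq => // x; transitivity (folner_lamp (q, [ffun r => lamp_fun l.1 (box_pt r - box_pt q)]) x) => //.
rewrite /folner_lamp /=.
case: pickP => [r /eqP e|h]; first by rewrite ffunE e addrK.
apply/eqP; apply/negPn/negP => /l1/in_boxP[r e].
by have := h r; rewrite e eqxx.
Qed.

Lemma card_coord_out (v : int) :
  (#|[pred i : 'I_N | ~~ ((0 <= i%:Z + v) && (i%:Z + v < N%:Z))%R]| <= `|v|)%N.
Proof.
rewrite cardE -(size_map val).
apply: (@leq_trans (size (iota (if (0 <= v)%R then N - `|v| else 0)%N `|v|))); last by rewrite size_iota.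
apply: uniq_leq_size; first by rewrite map_inj_uniq ?enum_uniq //; exact: val_inj.
move=> _ /mapP[i + ->]; rewrite mem_enum inE mem_iota /=; have := ltn_ord i.
by case: ifP; lia.
Qed.

(** Overwriting coordinate [j] embeds (points with a given [j]-th coordinate) x ['I_N] into the box.
    Keeping the factor [N] on the left avoids the exponent [a - 1]. *)
Lemma card_coord_pred (j : 'I_a) (P : pred 'I_N) :
  (#|[pred q : Q | P (q j)]| * N <= #|P| * N ^ a)%N.
Proof.
have h i : (#|[pred q : Q | q j == i]| * N <= N ^ a)%N.
  have -> : (N ^ a = #|{: Q}|)%N by rewrite card_ffun !card_ord.
  rewrite -[X in (_ * X <= _)%N]card_ord -cardX.
  rewrite -(@card_in_image _ _ (fun u : Q * 'I_N => [ffun t => if t == j then u.2 else u.1 t])).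
    exact: max_card.
  move=> [q x] [r y]; rewrite !inE !andbT /= => /eqP qi /eqP ri /ffunP e; congr pair.
    apply/ffunP => t; have := e t; rewrite !ffunE.
    by case: eqP => // ->; rewrite qi ri.
  by have := e j; rewrite !ffunE eqxx.
rewrite -sum1_card (partition_big (fun q : Q => q j) P) //= big_distrl /=.
rewrite -sum_nat_const; apply: leq_sum => i Pi.
apply: leq_trans (h i); rewrite leq_mul2r sum1_card; apply/orP; right.
by apply: subset_leq_card; apply/fintype.subsetP => q; rewrite !inE => /andP[].
Qed.

Lemma card_box_out (v : 'rV[int]_a) :
  (#|[pred q : Q | ~~ in_box (box_pt q + v)%R]| * N <= (\sum_j `|v 0%R j|) * N ^ a)%N.
Proof.
pose P j : pred 'I_N := [pred i : 'I_N | ~~ ((0 <= i%:Z + v 0 j) && (i%:Z + v 0 j < N%:Z))%R].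
apply: (@leq_trans (\sum_j #|[pred q : Q | P j (q j)]| * N)%N).
  rewrite -big_distrl /= leq_mul2r; apply/orP; right.
  apply: (@leq_trans (\sum_(j <- enum 'I_a) count (fun q : Q => P j (q j)) (enum {: Q}))%N).
    apply: leq_trans (count_has_le _ _ _); rewrite card_count.
    apply: sub_count => q /=; rewrite negb_forall => /existsP[j h].
    by apply/hasP; exists j; [rewrite mem_enum|move: h; rewrite !mxE].
  rewrite big_enum /=; apply: leq_sum => j _.
  by rewrite card_count.
rewrite big_distrl /=; apply: leq_sum => j _.
apply: leq_trans (card_coord_pred j (P j)) _; rewrite leq_mul2r.
by rewrite card_coord_out orbT.
Qed.

End WreathFolner.

(** Multiplying by [g] can leave the set only if the box point, shifted by one of the finitely many
    vectors in [L], leaves the box: [- g.2] accounts for the cursor, the others for the lamps of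
    [g]. The list [L], hence the constant, does not depend on [N]. *)
Lemma wreath_folner (F : finGroupType) (a : nat) (g : wreath F a) :
  exists C, forall N,
    (count (fun l => (gmul g l : {classic _}) \notin folner_seq F a N) (folner_seq F a N) * N
      <= C * size (folner_seq F a N))%N.
Proof.
pose L := - g.2 :: [seq x - g.2 | x <- lamp_supp g.1].
exists (\sum_(v <- L) \sum_j `|v 0%R j|)%N => N.
rewrite {2}/folner_seq count_map.
apply: leq_trans (_ : (count (fun u => has (fun v => ~~ in_box N (box_pt u.1 + v)) L)
  (enum {: {ffun 'I_a -> 'I_N} * {ffun {ffun 'I_a -> 'I_N} -> F}}) * N <= _)%N).
  rewrite leq_mul2r; apply/orP; right; apply: sub_count => u; apply: contraR.
  move=> /hasPn h.
  have /negPn/in_boxP[q eq] := h _ (mem_head _ _).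
  apply: (@mem_folner_seq _ _ _ _ q); first by rewrite /= -eq opprB addrC.
  move=> x; rewrite -eq.
  have -> : lamp_fun (gmul g (folner_elt u)).1 x
    = (lamp_fun g.1 x * folner_lamp u (x - g.2))%g by [].
  rewrite addrA; case: (eqVneq (lamp_fun g.1 x) 1%g) => [->|ne _].
    by rewrite mul1g => /folner_lamp_box; rewrite addrAC.
  rewrite addrAC addrC; apply/negPn; apply: h; rewrite inE; apply/orP; right.
  by apply/map_f; exact: lamp_suppP.
rewrite size_folner_seq.
apply: leq_trans (leq_mul (count_has_le _ _ _) (leqnn _)) _.
rewrite !big_distrl /=; apply: leq_sum => v _.
rewrite [leqRHS]mulnA.
apply: leq_trans (_ : (#|[pred q : {ffun 'I_a -> 'I_N} | ~~ in_box N (box_pt q + v)%R]| * #|F| ^ (N ^ a) * N <= _)%N).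
  rewrite leq_mul2r; apply/orP; right.
  have -> : (#|F| ^ (N ^ a) = #|{: {ffun {ffun 'I_a -> 'I_N} -> F}}|)%N by rewrite !card_ffun !card_ord.
  by rewrite -cardX card_count; apply: sub_count => u /=; rewrite !inE andbT.
by rewrite mulnAC leq_mul2r card_box_out orbT.
Qed.

(** * Mass transport *)

Section CountSeries.
Variable R : realType.
Implicit Types P Q : pred nat.
Local Notation tot P := (\sum_(n <oo) (P n)%:R%:E : \bar R)%E.

Lemma partial_count P M :
  (\sum_(0 <= n < M) (P n)%:R%:E = (count P (iota 0 M))%:R%:E :> \bar R)%E.
Proof.
rewrite -[M in LHS]subn0 sumEFin; congr EFin; rewrite /index_iota !subn0.
by elim: (iota 0 M) => [|x s IH]; rewrite ?big_nil // big_cons IH /= natrD.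
Qed.

Lemma count_series_le P k : (forall M, count P (iota 0 M) <= k)%N -> (tot P <= k%:R%:E)%E.
Proof.
move=> h; apply: lime_le.
  by apply: is_cvg_nneseries => n _ _; rewrite lee_fin.
by apply: nearW => M; rewrite partial_count lee_fin ler_nat.
Qed.

Lemma count_series_ge P M : ((count P (iota 0 M))%:R%:E <= tot P)%E.
Proof. by rewrite -partial_count; apply: nneseries_lim_ge => n _ _; rewrite lee_fin. Qed.

(** A series of zeros and ones with a finite sum has finitely many ones. This turns the
    extended-real counts of mass transport back into lists; one list serves all predicates below
    [P]. *)
Lemma finite_count_series P : (tot P < +oo)%E -> exists s, [/\ uniq s, P =i s &
  forall Q, (forall n, Q n -> P n) -> tot Q = (count Q s)%:R%:E].
Proof.
move=> h.
have [M hM] : exists M, forall n, P n -> (n < M)%N.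
  apply/not_existsP => hM; have hk k : exists M, (k <= count P (iota 0 M))%N.
    elim: k => [|k [M kM]]; first by exists 0%N.
    have /existsNP[n /not_implyP[Pn /negP]] := hM M; rewrite -leqNgt => Mn.
    exists n.+1; rewrite -(subnKC (leqW Mn)) iotaD count_cat -addn1 leq_add //.
    rewrite -has_count; apply/hasP; exists n => //; rewrite mem_iota; lia.
  suff e : (tot P = +oo)%E by rewrite e ltxx in h.
  apply/eqyP => r _.
  have [M kM] := hk (Num.truncn `|r|).+1.
  apply: le_trans (count_series_ge P M); rewrite lee_fin.
  apply: le_trans (ler_norm r) _; apply: le_trans (ltW (truncnS_gt _)) _.
  by rewrite ler_nat.
exists [seq n <- iota 0 M | P n]; split=> [|n|Q QP].
- by rewrite filter_uniq ?iota_uniq.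
- rewrite mem_filter mem_iota; apply/idP/andP => [Pn|[]//]; by rewrite add0n hM.
- apply/eqP; rewrite eq_le; apply/andP; split.
    apply: count_series_le => N; rewrite -!size_filter; apply: uniq_leq_size.
      by rewrite filter_uniq ?iota_uniq.
    move=> n; rewrite !mem_filter !mem_iota => /andP[Qn _].
    by rewrite Qn (QP _ Qn) /= add0n hM // QP.
  apply: le_trans (count_series_ge Q M); rewrite lee_fin ler_nat count_filter.
  by apply: sub_count => n /andP[].
Qed.

End CountSeries.

Section ElementaryMeasure.
Context (R : realType) (d : measure_display) (T : measurableType d).
Variable mu : {measure set T -> \bar R}.

Lemma measure_seqU_le (I : Type) (s : seq I) (B : I -> set T) :
  (forall i, measurable (B i)) ->
  (mu (\big[setU/set0]_(i <- s) B i) <= \sum_(i <- s) mu (B i))%E.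
Proof.
move=> mB; elim: s => [|i s IH]; first by rewrite !big_nil measure0.
rewrite !big_cons; apply: le_trans (leeD2l _ IH).
by apply: measureU2 => //; apply: bigsetU_measurable.
Qed.

Lemma measure_seqU (I : eqType) (s : seq I) (B : I -> set T) : uniq s ->
  (forall i, measurable (B i)) -> (forall i j, i != j -> B i `&` B j = set0) ->
  mu (\big[setU/set0]_(i <- s) B i) = (\sum_(i <- s) mu (B i))%E.
Proof.
move=> + mB tB; elim: s => [|i s IH] /=; first by rewrite !big_nil measure0.
move=> /andP[is_ us]; rewrite !big_cons -IH // measureU //.
  exact: bigsetU_measurable.
elim: s is_ {us IH} => [|j s IH]; first by rewrite big_nil setI0.
rewrite inE negb_or => /andP[ij /IH e].
by rewrite big_cons setIUr e tB // setU0.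
Qed.

End ElementaryMeasure.

Section FundamentalDomain.
Context (R : realType) (d : measure_display) (Om : measurableType d).
Variables (mu : {measure set Om -> \bar R}) (G : grp) (act : G -> Om -> Om) (X : set Om).
Hypothesis GL : group_laws G.
Hypothesis fA : mp_free_action mu act.
Hypothesis dX : fund_domain mu act X.

Lemma act1 x : act (gone G) x = x. Proof. by case: fA => h _ _ _ _; exact: h. Qed.
Lemma actM g h x : act (gmul g h) x = act g (act h x). Proof. by case: fA => _ k _ _ _; exact: k. Qed.
Lemma act_meas g (A : set Om) : measurable A -> measurable (act g @^-1` A).
Proof. by case: fA => _ _ h _ _ mA; rewrite -[_ @^-1` _]setTI; exact: h. Qed.
Lemma act_mu g (A : set Om) : measurable A -> mu (act g @^-1` A) = mu A.
Proof. by case: fA => _ _ _ h _; exact: h. Qed.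
Lemma actK g : cancel (act g) (act (ginv g)).
Proof. by move=> x; rewrite -actM gmulVg // act1. Qed.
Lemma actKV g : cancel (act (ginv g)) (act g).
Proof. by move=> x; rewrite -actM gmulgV // act1. Qed.
Lemma fdom_meas : measurable X. Proof. by case: dX. Qed.
Lemma fdom_fin : (mu X < +oo)%E. Proof. by case: dX => _ _ h. Qed.
Lemma fdom_uniq g h x : X (act g x) -> X (act h x) -> g = h.
Proof. by case: dX => _ /(_ x)[k [_ u]] _ /u <- /u. Qed.
Lemma fdom_ex x : exists g, X (act g x).
Proof. by case: dX => _ /(_ x)[k [h _]] _; exists k. Qed.

Variable e : nat -> G.
Hypothesis eS : forall g, exists n, e n = g.

(** Otherwise the countably many translates of [X], which cover the space, would all be null. *)
Lemma fdom_pos : (0 < mu setT)%E -> (0 < mu X)%E.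
Proof.
rewrite !lt0e => /andP[h _]; rewrite measure_ge0 andbT; apply: contra h => /eqP X0.
rewrite eq_le measure_ge0 andbT.
have -> : setT = \bigcup_n (act (e n) @^-1` X).
  rewrite eqEsubset; split=> // x _; have [g gx] := fdom_ex x; have [n en] := eS g.
  by exists n => //=; rewrite en.
have mF n : measurable (act (e n) @^-1` X) by apply: act_meas; exact: fdom_meas.
apply: le_trans (measure_sigma_subadditive mu mF _ (@subset_refl _ _)) _.
  exact: bigcup_measurable.
by rewrite eseries0 // => n _ _; rewrite act_mu //; exact: fdom_meas.
Qed.

Hypothesis eI : injective e.

Definition visits (T : set Om) (x : Om) : \bar R :=
  (\sum_(n <oo) (act (e n) x \in T)%:R%:E)%E.

Lemma visits_ge0 T x : (0 <= visits T x)%E.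
Proof. by apply: nneseries_ge0 => n _ _; rewrite lee_fin. Qed.

Lemma indic_act_meas (T D : set Om) n : measurable T ->
  measurable_fun D (EFin \o (fun x => (act (e n) x \in T)%:R : R)).
Proof.
move=> mT; apply/measurable_EFinP.
have -> : (fun x => (act (e n) x \in T)%:R : R) = \1_(act (e n) @^-1` T) :> (Om -> R).
  by apply/funext => x; rewrite indicE; congr (_ : bool)%:R; apply/idP/idP; rewrite !inE.
by apply: measurable_indic; apply: act_meas.
Qed.

Lemma visits_meas (T D : set Om) : measurable T -> measurable_fun D (visits T).
Proof.
move=> mT; apply: ge0_emeasurable_sum => [n x _ _|n _]; first by rewrite lee_fin.
exact: indic_act_meas.
Qed.

(** Cut [T] along the translates of [X]. The piece [Fn n] is carried into [X] by [ginv (e n)], so by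
    invariance its measure is the integral over [X] of the [n]-th term of [visits]. *)
Lemma mass_transport T : measurable T -> (\int[mu]_(x in X) visits T x = mu T)%E.
Proof.
move=> mT; have mX := fdom_meas.
have mP n : measurable (act (e n) @^-1` T) by apply: act_meas.
rewrite integral_nneseries //; last by move=> n; exact: indic_act_meas.
pose Fn n := T `&` (act (ginv (e n)) @^-1` X).
have mF n : measurable (Fn n) by apply: measurableI => //; exact: act_meas.
have eT : T = \bigcup_n Fn n.
  rewrite eqEsubset; split=> [x Tx|x [n _] []//].
  have [g gx] := fdom_ex x; have [n en] := eS (ginv g).
  by exists n => //; split=> //=; rewrite en ginvK.
rewrite [in RHS]eT measure_semi_bigcup //; last 2 first.
- apply/trivIsetP => i j _ _ ij; rewrite -subset0 => x [[_ xi] [_ xj]].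
  have := fdom_uniq xi xj => /(congr1 (@ginv G)); rewrite !ginvK // => /eI.
  by move/eqP: ij.
- exact: bigcup_measurable.
apply: eq_eseriesr => n _; rewrite -[RHS](@act_mu (e n)) //.
have -> : act (e n) @^-1` Fn n = (act (e n) @^-1` T) `&` X.
  by rewrite /Fn preimage_setI; congr (_ `&` _); rewrite eqEsubset; split=> x; rewrite /= actK.
rewrite -(integral_indic mu mX) //.
Qed.

End FundamentalDomain.

(** * Transfer of Folner sets *)

Section WordBoundary.
Variables (G : grp) (k : nat) (s : 'I_k -> G).
Hypothesis GL : group_laws G.
Hypothesis gen : generates s.

Definition left_boundary (A : seq {classic G}) (g : G) : nat :=
  count (fun l : {classic G} => (gmul g l : {classic G}) \notin A) A.

Lemma left_boundary_le A g : (left_boundary A g <= size A)%N. Proof. exact: count_size. Qed.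

Lemma left_boundary1 A : left_boundary A (gone G) = 0%N.
Proof.
apply/eqP; rewrite eqn0Ngt -has_count; apply/negP => /hasP[l lA].
by rewrite gmul1g // lA.
Qed.

Lemma left_boundaryM A g h : uniq A -> (left_boundary A (gmul g h) <= left_boundary A h + left_boundary A g)%N.
Proof.
move=> uA; apply: (@leq_trans (left_boundary A h +
  count (fun l : {classic G} => ((gmul h l : {classic G}) \in A) && ((gmul (gmul g h) l : {classic G}) \notin A)) A)).
  by apply: count_leU => l _ ->; rewrite andbT orNb.
rewrite leq_add2l [leqRHS]/left_boundary -[leqRHS]size_filter.
apply: (@size_filter_map_le _ _ _ (fun l : {classic G} => gmul h l : {classic G})) => //.
  by move=> x y _ _; apply: gmulgI.
by move=> x xA /andP[h1 h2]; rewrite mem_filter h1 gmulA // h2.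
Qed.

Lemma left_boundary_word A D g : uniq A ->
  (forall i, (left_boundary A (s i) <= D)%N /\ (left_boundary A (ginv (s i)) <= D)%N) ->
  (left_boundary A g <= wordlen s g * D)%N.
Proof.
move=> uA hD; have [w <- <-] := wordlenP gen g.
elim: w => [|[b i] w IH]; first by rewrite /= left_boundary1.
rewrite /= mulSn addnC; apply: leq_trans (left_boundaryM _ _ uA) _.
by apply: leq_add => //; case: b => /=; case: (hD i).
Qed.

End WordBoundary.

Section Transfer.
Context (R : realType) (d : measure_display) (Om : measurableType d).
Variables (mu : {measure set Om -> \bar R}) (Gam Lam : grp).
Variables (aG : Gam -> Om -> Om) (aL : Lam -> Om -> Om) (XG XL : set Om).
Hypothesis GLg : group_laws Gam.
Hypothesis GLl : group_laws Lam.
Hypothesis fG : mp_free_action mu aG.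
Hypothesis fL : mp_free_action mu aL.
Hypothesis comm : forall g l x, aG g (aL l x) = aL l (aG g x).
Hypothesis dG : fund_domain mu aG XG.
Hypothesis dL : fund_domain mu aL XL.
Variable e : nat -> Gam.
Hypothesis eI : injective e.
Hypothesis eS : forall g, exists n, e n = g.
Hypothesis XL0 : (0 < mu XL)%E.

Let mXL : measurable XL. Proof. exact: fdom_meas dL. Qed.
Let mXG : measurable XG. Proof. exact: fdom_meas dG. Qed.

(** Subsets of [Lam] become subsets of the space: the preimages of [XL] under the various [aL l] are
    disjoint copies of [XL]. *)
Definition spread (A : seq {classic Lam}) (Y : set Om) : set Om :=
  \big[setU/set0]_(l <- A) (aL l @^-1` Y).

Lemma spreadP A Y x : spread A Y x <-> exists2 l, l \in A & Y (aL l x).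
Proof.
rewrite /spread; elim: A => [|l A IH]; first by rewrite big_nil; split=> // -[].
rewrite big_cons; split=> [[h|/IH[l' l'A h]]|[l']].
- by exists l; rewrite ?mem_head.
- by exists l' => //; rewrite inE l'A orbT.
- by rewrite inE => /orP[/eqP ->|l'A h]; [left|right; apply/IH; exists l'].
Qed.

Lemma spread_meas A Y : measurable Y -> measurable (spread A Y).
Proof. by move=> mY; apply: bigsetU_measurable => l _; apply: (act_meas fL). Qed.

Lemma spread_mu_le A Y : measurable Y ->
  (mu (spread A Y) <= (size A)%:R%:E * mu Y)%E.
Proof.
move=> mY; apply: le_trans (measure_seqU_le _ _ _) _.
  by move=> l; apply: (act_meas fL).
under eq_bigr do rewrite (act_mu fL _ mY).
elim: A => [|l A IH]; first by rewrite big_nil mul0e.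
by rewrite big_cons /= -natr1 EFinD ge0_muleDl // mul1e addeC leeD2r.
Qed.

Lemma spread_mu A Y : uniq A -> measurable Y -> Y `<=` XL ->
  mu (spread A Y) = ((size A)%:R%:E * mu Y)%E.
Proof.
move=> uA mY YX; rewrite measure_seqU //.
- under eq_bigr do rewrite (act_mu fL _ mY).
  elim: A {uA} => [|l A IH]; first by rewrite big_nil mul0e.
  by rewrite big_cons /= -natr1 EFinD ge0_muleDl // mul1e addeC IH.
- by move=> l; apply: (act_meas fL).
- move=> l l' /eqP ne; rewrite -subset0 => x [/= /YX h /YX h'].
  by apply: ne; exact: (fdom_uniq dL h h').
Qed.

Section Boundary.
Variables (g : Gam) (c : Om -> Lam).
Hypothesis hc : forall x, XL x -> XL (aL (c x) (aG g x)).

Definition outer (A : seq {classic Lam}) : set Om :=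
  spread A XL `\` (aG g @^-1` spread A XL).

Lemma outer_meas A : measurable (outer A).
Proof.
apply: measurableD; first exact: spread_meas.
by apply: (act_meas fG); exact: spread_meas.
Qed.

Let exits A (l : Lam) := XL `\` [set x | spread A XL (aL (ginv l) (aG g x))].

Lemma exits_meas A l : measurable (exits A l).
Proof.
apply: measurableD => //.
have -> : [set x | spread A XL (aL (ginv l) (aG g x))] =
   aG g @^-1` (aL (ginv l) @^-1` spread A XL) by [].
by apply: (act_meas fG); apply: (act_meas fL); exact: spread_meas.
Qed.

(** Only [gmul (c x) l] carries the point [aL (ginv l) (aG g x)] into [XL]. *)
Lemma exitsE A l x : XL x ->
  (x \in exits A l) = ((gmul (c x) l : {classic Lam}) \notin A).
Proof.
move=> Xx; apply/idP/idP; rewrite !inE => h.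
  apply/negP => cA; apply: h.2; apply/spreadP; exists (gmul (c x) l) => //.
  by rewrite -(actM fL) gmulgK //; exact: hc.
split=> //= /spreadP[l' l'A]; rewrite -(actM fL) => h'.
move/negP: h; apply; suff -> : gmul (c x) l = l' by [].
by rewrite (fdom_uniq dL (hc Xx) h') gmulgKV.
Qed.

Lemma left_boundary_sum_exits A x : XL x ->
  (\sum_(l <- A) (\1_(exits A l) x)%:E = (left_boundary A (c x))%:R%:E :> \bar R)%E.
Proof.
move=> Xx; rewrite sumEFin; congr EFin; rewrite /left_boundary -sum1_count natr_sum [in RHS]big_mkcond /=.
by apply: eq_bigr => l _; rewrite indicE exitsE //; case: (_ \notin _).
Qed.

Lemma exits_indic_meas A l : measurable_fun XL (fun x => (\1_(exits A l) x)%:E : \bar R).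
Proof. by apply/measurable_EFinP; apply: measurable_indic; exact: exits_meas. Qed.

Lemma left_boundary_meas A : measurable_fun XL (fun x => (left_boundary A (c x))%:R%:E : \bar R).
Proof.
apply: (eq_measurable_fun (fun x => \sum_(l <- A) (\1_(exits A l) x)%:E)%E).
  by move=> x /set_mem Xx; exact: left_boundary_sum_exits.
by apply: emeasurable_sum => l _; exact: exits_indic_meas.
Qed.

(** Translating the part [B l] back by [l] puts it inside [XL], where, the actions commuting, it
    becomes [exits A l]. Summed over [l], these indicators count the boundary of [A] under [c x]. *)
Lemma outer_mu A : (mu (outer A) <= \int[mu]_(x in XL) (left_boundary A (c x))%:R%:E)%E.
Proof.
pose B l := (aL l @^-1` XL) `\` (aG g @^-1` spread A XL).
have mB l : measurable (B l).
  apply: measurableD; first exact: (act_meas fL).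
  by apply: (act_meas fG); exact: spread_meas.
have -> : outer A = \big[setU/set0]_(l <- A) B l.
  by rewrite /outer /spread setDE big_distrl.
apply: le_trans (measure_seqU_le _ _ mB) _.
have muB l : mu (B l) = (\int[mu]_(x in XL) (\1_(exits A l) x)%:E)%E.
  rewrite integral_indic //; last exact: exits_meas.
  rewrite (_ : exits A l `&` XL = exits A l); last by apply/setIidPl => x [].
  rewrite -(act_mu fL (ginv l) (mB l)); congr (mu _).
  rewrite eqEsubset; split=> x; rewrite /B /exits /= (actKV GLl fL) comm; exact.
rewrite (eq_bigr _ (fun l _ => muB l)) -ge0_integral_sum //; last first.
  by move=> l; exact: exits_indic_meas.
rewrite le_eqVlt; apply/orP; left; apply/eqP; apply: eq_integral => x /set_mem.
exact: left_boundary_sum_exits.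
Qed.

End Boundary.

(** The points of [XL] that one of the first [K] elements of [Gam] carries into [XG] increase to
    [XL] with [K]. Any proportion above one half that leaves room for the boundary term would do in
    place of [3 / 4]. *)
Lemma good_part : exists K (Y : set Om), [/\ measurable Y, Y `<=` XL,
  ((3 / 4)%:E * mu XL <= mu Y)%E &
  forall x, Y x -> exists2 k, (k < K)%N & XG (aG (e k) x)].
Proof.
pose D n := aG (e n) @^-1` XG.
have mD n : measurable (D n) by apply: (act_meas fG).
pose Y K := XL `&` \big[setU/set0]_(n < K) D n.
have mY K : measurable (Y K).
  by apply: measurableI => //; apply: bigsetU_measurable => n _; exact: mD.
have YP K x : Y K x <-> XL x /\ exists2 k, (k < K)%N & XG (aG (e k) x).
  rewrite /Y -bigcup_mkord; split=> -[Xx].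
    by move=> [k /= kK h]; split => //; exists k.
  by move=> [k kK h]; split => //; exists k.
have UY : \bigcup_K Y K = XL.
  rewrite eqEsubset; split=> [x [K _ [] //]|x Xx].
  have [g gx] := fdom_ex dG x; have [n en] := eS g.
  by exists n.+1 => //; apply/YP; split=> //; exists n => //; rewrite en.
have ndY : nondecreasing_seq Y.
  move=> K L KL; apply/subsetPset => x /YP[Xx [k kK h]].
  by apply/YP; split=> //; exists k => //; exact: leq_trans kK KL.
have cY := nondecreasing_cvg_mu (mu := mu) mY (bigcup_measurable (fun K _ => mY K)) ndY.
rewrite UY in cY.
suff [K hK] : exists K, ((3 / 4)%:E * mu XL <= mu (Y K))%E.
  by exists K, (Y K); split => // x /YP[].
apply/not_existsP => h.
have : (mu XL <= (3 / 4)%:E * mu XL)%E.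
  rewrite -{1}(cvg_lim _ cY) //; apply: lime_le; first by apply/cvg_ex; exists (mu XL).
  by apply: nearW => K; apply: ltW; rewrite ltNge; apply/negP; exact: h.
have fin : mu XL \is a fin_num.
  by rewrite ge0_fin_numE //; exact: (fdom_fin dL).
rewrite -(fineK fin) -EFinM lee_fin => h1.
have : 0 < fine (mu XL) by apply: fine_gt0; rewrite XL0 /=; exact: (fdom_fin dL).
by lra.
Qed.

(** A visit [n] is determined by the pair [(l, k)]: only one element of [Gam] carries [aL l x] into
    [XG], and it is [gmul (e k) (e n)]. The function [pt] recovers [n]. *)
Lemma spread_visits_le K (Y : set Om) (A : seq {classic Lam}) x :
  (forall y, Y y -> exists2 k, (k < K)%N & XG (aG (e k) y)) ->
  (visits R aG e (spread A Y) x <= (size A * K)%:R%:E)%E.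
Proof.
move=> hY; apply: count_series_le => M; rewrite -size_filter.
pose pt (l : {classic Lam}) k := xget 0%N [set n | XG (aG (e k) (aL l (aG (e n) x)))].
have <- : size [seq pt l k | l <- A, k <- iota 0 K] = (size A * K)%N.
  by rewrite size_allpairs size_iota.
apply: uniq_leq_size; first by rewrite filter_uniq ?iota_uniq.
move=> n; rewrite mem_filter => /andP[/set_mem/spreadP[l lA /hY[k kK h]] _].
apply/allpairsP; exists (l, k); split=> //=; first by rewrite mem_iota.
rewrite /pt; case: xgetP => [m _ /= h'|/(_ n)//].
move: h h'; rewrite -!comm -!(actM fG) => h h'.
by have := fdom_uniq dG h h' => /(gmulgI GLg)/eI.
Qed.

(* Mass transport turns measures of sets into expected numbers of visits of a
   [Gam]-orbit; comparing the expectations on the two sides produces an orbit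
   whose trace on [spread A XL] is almost invariant and not too large. *)
Theorem folner_transfer : exists K, forall (gs : seq {classic Gam})
    (c : Gam -> Om -> Lam) (A : seq {classic Lam}) (eps : R),
  (forall g x, XL x -> XL (aL (c g x) (aG g x))) ->
  uniq A -> (0 < size A)%N -> 0 < eps ->
  (\sum_(g <- gs) \int[mu]_(x in XL) (left_boundary A (c g x))%:R%:E
    <= (eps * (size A)%:R / 4)%:E * mu XL)%E ->
  exists B : seq {classic Gam}, [/\ uniq B, (0 < size B)%N,
    (size B <= K * size A)%N &
    forall g, g \in gs -> (left_boundary B g)%:R <= eps * (size B)%:R].
Proof.
have [K [Y [mY YX muY hK]]] := good_part.
(* The factor 2: on the chosen orbit [T2] is visited no more often than [T1], which is visited at
   most [K * size A] times. *)
exists (2 * K)%N => gs c A eps hc uA A0 eps0 hint.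
have fin : mu XL \is a fin_num.
  by rewrite ge0_fin_numE //; exact: (fdom_fin dL).
have m0 : 0 < fine (mu XL) by apply: fine_gt0; rewrite XL0 /=; exact: (fdom_fin dL).
set m := fine (mu XL) in m0.
have mE : mu XL = m%:E by rewrite fineK.
pose T1 := spread A Y; pose T2 := spread A (XL `\` Y).
have mXY : measurable (XL `\` Y) by exact: measurableD.
have mT1 : measurable T1 by exact: spread_meas.
have mT2 : measurable T2 by exact: spread_meas.
have mTg g : measurable (outer g A) by exact: outer_meas.
pose v T x : \bar R := visits R aG e T x.
have v0 T x : (0 <= v T x)%E by exact: visits_ge0.
have mv T : measurable T -> measurable_fun XG (v T) by move=> mT; exact: (visits_meas fG).
(* Otherwise, integrating over [XG], [mu T1] would be at most [mu T2] plus the boundary term. In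
   units of [size A * mu XL], the first is at least [3/4] and each of the other two at most
   [1/4]. *)
have [x [Xx hx]] : exists x, XG x /\
    (v T2 x + eps^-1%:E * \sum_(g <- gs) v (outer g A) x < v T1 x)%E.
  apply/not_existsP => H.
  have H' x : XG x -> (v T1 x <= v T2 x + eps^-1%:E * \sum_(g <- gs) v (outer g A) x)%E.
    by move=> Xx; rewrite leNgt; apply/negP => h; apply: (H x).
  have ms : measurable_fun XG (fun x => \sum_(g <- gs) v (outer g A) x)%E.
    by apply: emeasurable_sum => g _; exact: mv.
  have s0 x : (0 <= \sum_(g <- gs) v (outer g A) x)%E by apply: sume_ge0.
  have epsV : 0 <= eps^-1 by rewrite invr_ge0 ltW.
  have : (mu T1 <= mu T2 + eps^-1%:E * \sum_(g <- gs) mu (outer g A))%E.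
    rewrite -(mass_transport GLg fG dG eS eI mT1) -(mass_transport GLg fG dG eS eI mT2).
    under eq_bigr do rewrite -(mass_transport GLg fG dG eS eI (mTg _)).
    rewrite -ge0_integral_sum //; last by move=> g; exact: mv.
    rewrite -ge0_integralZl_EFin // -ge0_integralD //; last 3 first.
    - exact: mv.
    - by move=> x _; apply: mule_ge0; rewrite ?lee_fin.
    - exact: measurable_funeM.
    apply: ge0_le_integral => //; first exact: mv.
    by apply: emeasurable_funD; [exact: mv|exact: measurable_funeM].
  apply/negP; rewrite -ltNge.
  have h3 : (eps^-1%:E * \sum_(g <- gs) mu (outer g A) <= ((size A)%:R / 4 * m)%:E)%E.
    apply: (@le_trans _ _ (eps^-1%:E * ((eps * (size A)%:R / 4)%:E * mu XL))%E).
      apply: lee_wpmul2l; first by rewrite lee_fin.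
      apply: le_trans hint; apply: lee_sum => g _; exact: (outer_mu (hc g)).
    by rewrite mE -!EFinM lee_fin !mulrA mulVf ?gt_eqF // mul1r.
  have muY2 : (mu (XL `\` Y) <= (m / 4)%:E)%E.
    have finY : mu Y \is a fin_num.
      by rewrite ge0_fin_numE // (le_lt_trans (le_measure _ _ _ YX)) ?inE //; exact: (fdom_fin dL).
    have -> : mu (XL `\` Y) = (mu XL - mu Y)%E.
      rewrite measureD //; last exact: (fdom_fin dL).
      by rewrite (_ : XL `&` Y = Y) //; apply/setIidPr.
    by move: muY; rewrite mE -(fineK finY) -EFinM -EFinB !lee_fin; lra.
  have h1 : (((size A)%:R * (3 / 4 * m))%:E <= mu T1)%E.
    rewrite /T1 spread_mu // EFinM lee_pmul2l ?lte_fin ?ltr0n //.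
    by move: muY; rewrite mE.
  have h2 : (mu T2 <= ((size A)%:R * (m / 4))%:E)%E.
    by apply: le_trans (spread_mu_le _ mXY) _; rewrite EFinM lee_pmul2l ?lte_fin ?ltr0n.
  apply: lt_le_trans h1; apply: le_lt_trans (leeD h2 h3) _.
  have A0' : 0 < (size A)%:R :> R by rewrite ltr0n.
  rewrite -EFinD lte_fin; nra.
have vK : (v T1 x <= (size A * K)%:R%:E)%E by exact: spread_visits_le.
have s0 : (0 <= eps^-1%:E * \sum_(g <- gs) v (outer g A) x)%E.
  by apply: mule_ge0; [rewrite lee_fin invr_ge0 ltW|apply: sume_ge0].
have v21 : (v T2 x <= v T1 x)%E by apply: ltW; apply: le_lt_trans hx; rewrite leeDl.
pose E := spread A XL.
have EP y : y \in E -> (y \in T1) || (y \in T2).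
  move=> /set_mem/spreadP[l lA h]; have [hY|hY] := pselect (Y (aL l y)).
    by apply/orP; left; apply/mem_set/spreadP; exists l.
  by apply/orP; right; apply/mem_set/spreadP; exists l.
have T1E y : y \in T1 -> y \in E.
  by move=> /set_mem/spreadP[l lA /YX h]; apply/mem_set/spreadP; exists l.
have T2E y : y \in T2 -> y \in E.
  by move=> /set_mem/spreadP[l lA [h _]]; apply/mem_set/spreadP; exists l.
have vE : (v E x <= v T1 x + v T2 x)%E.
  rewrite -nneseriesD; try by move=> *; rewrite lee_fin.
  apply: lee_nneseries => [n _ _|n _]; first by rewrite lee_fin.
  rewrite -EFinD lee_fin; have := @EP (aG (e n) x).
  case: (_ \in E) => [/(_ isT)|_]; last by rewrite addr_ge0.
  by case/orP => ->; rewrite ?lerDl ?lerDr.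
have finE : (v E x < +oo)%E.
  apply: le_lt_trans vE _; apply: lte_add_pinfty; last apply: le_lt_trans v21 _;
  by apply: le_lt_trans vK _; rewrite ltry.
have [s [us sP sQ]] := finite_count_series finE.
have c1 : v T1 x = (count (fun n => aG (e n) x \in T1) s)%:R%:E by apply: sQ => n; exact: T1E.
have c2 : v T2 x = (count (fun n => aG (e n) x \in T2) s)%:R%:E by apply: sQ => n; exact: T2E.
have cg g : v (outer g A) x = (count (fun n => aG (e n) x \in outer g A) s)%:R%:E.
  by apply: sQ => n /set_mem[h _]; exact/mem_set.
pose B : seq {classic Gam} := map e s.
have mB n : (e n : {classic Gam}) \in B = (aG (e n) x \in E).
  by rewrite mem_map // -sP.
have BP (h : {classic Gam}) : (h \in B) = (aG h x \in E).
  by have [n <-] := eS h; exact: mB.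
have lB g : left_boundary B g = count (fun n => aG (e n) x \in outer g A) s.
  rewrite /left_boundary count_map; apply: eq_in_count => n ns /=; rewrite BP (actM fG).
  have nE : aG (e n) x \in E by have := sP n; rewrite ns.
  apply/idP/idP => [/negP h|/set_mem[_ h]].
    by apply/mem_set; split; [exact: set_mem|move=> /= h'; apply: h; exact/mem_set].
  by apply/negP => /set_mem.
exists B.
have sB : size B = size s by rewrite size_map.
move: vK v21; rewrite c1 c2 !lee_fin !ler_nat => vK v21.
have sle : (size s <= count (fun n => aG (e n) x \in T1) s + count (fun n => aG (e n) x \in T2) s)%N.
  rewrite -[size s]count_predT; apply: count_leU => n ns _.
  by apply: EP; have := sP n; rewrite ns.
have hg g : g \in gs -> (left_boundary B g)%:R * eps^-1 < (count (fun n => aG (e n) x \in T1) s)%:R.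
  move=> gi; rewrite -lte_fin -c1; apply: le_lt_trans hx.
  apply: (@le_trans _ _ (eps^-1%:E * \sum_(g <- gs) v (outer g A) x)%E); last by rewrite leeDr.
  rewrite EFinM muleC; apply: lee_wpmul2l; first by rewrite lee_fin invr_ge0 ltW.
  rewrite lB -cg (big_rem g) //= leeDl //.
  by apply: sume_ge0.
have s1 : (0 < count (fun n => aG (e n) x \in T1) s)%N.
  rewrite -(ltr_nat R) -lte_fin -c1; apply: le_lt_trans hx.
  by apply: adde_ge0.
have cs := count_size (fun n => aG (e n) x \in T1) s.
split.
- by rewrite map_inj_uniq.
- by rewrite sB; apply: leq_trans cs.
- rewrite sB -mulnA mul2n -addnn [(K * _)%N]mulnC; apply: leq_trans sle _.
  exact: leq_add vK (leq_trans v21 vK).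
- move=> g /hg /ltW; rewrite ler_pdivrMr // sB mulrC => h.
  by apply: le_trans h _; rewrite ler_pM2l // ler_nat.
Qed.

End Transfer.

(** * Necessity *)

Lemma wreath_countable (F : finGroupType) (n : nat) : countable [set: wreath F n].
Proof.
pose code (u : wreath F n) := ([seq (x, lamp_fun u.1 x) | x <- lamp_supp u.1], u.2).
apply/countable_injP; exists (pickle \o code) => u v _ _ /= /(pcan_inj pickleK)[e e2].
apply: wreath_eq => // x.
have hs (w : lamp F n) (t : 'rV[int]_n * F) :
    t \in [seq (x, lamp_fun w x) | x <- lamp_supp w] -> lamp_fun w t.1 = t.2.
  by move=> /mapP[y _ ->].
case: (eqVneq (lamp_fun u.1 x) 1%g) => [hu|hu]; last first.
  apply/esym/(hs v.1 (x, lamp_fun u.1 x)); rewrite -e.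
  by apply: (map_f (fun x => (x, lamp_fun u.1 x))); exact: lamp_suppP.
case: (eqVneq (lamp_fun v.1 x) 1%g) => [->//|hv].
apply/(hs u.1 (x, lamp_fun v.1 x)); rewrite e.
by apply: (map_f (fun x => (x, lamp_fun v.1 x))); exact: lamp_suppP.
Qed.

Lemma wreath_enum (F : finGroupType) (n : nat) : (0 < n)%N ->
  exists e : nat -> wreath F n, injective e /\ forall g, exists k, e k = g.
Proof.
case: n => // n _.
have inf : ~ finite_set [set: wreath F n.+1].
  move=> /(finite_image (fun u : wreath F n.+1 => `|u.2 ord0 ord0|%N)) h.
  apply: infinite_nat; apply: sub_finite_set h => k _.
  by exists (move_by F (const_mx k%:Z)) => //=; rewrite mxE.
have [f [_ fi fs]] := card_set_bijP (eq_card_nat (@wreath_countable F n.+1) inf).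
have /choice[e he] : forall k, exists g, f g = k.
  by move=> k; have [g _ <-] := fs k I; exists g.
exists e; split=> [k l /(congr1 f)|g]; first by rewrite !he.
by exists (f g); apply: fi; rewrite ?inE ?he.
Qed.

(** * Truncated moments of the cocycle *)

Section Truncation.
Context (R : realType).

(** Write [y = z ^ b]. If [t <= z] the left side is at most [t ^ a <= z ^ a]; otherwise
    [(z / t) ^ b <= (z / t) ^ a] gives [z ^ a] again. Finally [z ^ a] is the power [a / b] of [y],
    at most its power [p] as [y] is not strictly between 0 and 1. *)
Lemma power_truncation (a b t : nat) (p y : R) : (0 < a)%N -> (a <= b)%N ->
  a%:R / b%:R <= p -> (y = 0) \/ 1 <= y ->
  t%:R ^+ a * Num.min 1 (y / t%:R ^+ b) <= y `^ p.
Proof.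
move=> a0 ab hp [->|y1].
  rewrite mul0r minEle ler10 mulr0; exact: powR_ge0.
have b0 : (0 < b)%N by apply: leq_trans ab.
pose z := y `^ b%:R^-1.
have z0 : 0 <= z by exact: powR_ge0.
have zb : z ^+ b = y.
  rewrite -powR_mulrn // /z -powRrM mulVf ?pnatr_eq0 -?lt0n //.
  by rewrite powRr1 // (le_trans _ y1).
have za : z ^+ a <= y `^ p.
  by rewrite -powR_mulrn // /z -powRrM mulrC; apply: ler_powR.
apply: le_trans za; rewrite -zb.
have [->|t0] := posnP t; first by rewrite expr0n (gtn_eqF a0) mul0r exprn_ge0.
have tp : 0 < t%:R :> R by rewrite ltr0n.
case: (lerP t%:R z) => tz.
  apply: (@le_trans _ _ (t%:R ^+ a * 1)); first by rewrite ler_pM2l ?exprn_gt0 // ge_min lexx.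
  by rewrite mulr1; apply: lerXn2r; rewrite ?nnegrE.
apply: (@le_trans _ _ (t%:R ^+ a * (z / t%:R) ^+ b)).
  by rewrite ler_pM2l ?exprn_gt0 // ge_min expr_div_n lexx orbT.
have -> : z ^+ a = t%:R ^+ a * (z / t%:R) ^+ a.
  by rewrite expr_div_n mulrC divfK // expf_neq0 // gt_eqF.
rewrite ler_pM2l ?exprn_gt0 //; apply: ler_wiXn2l => //; first by rewrite divr_ge0 // ltW.
by rewrite ler_pdivrMr // mul1r ltW.
Qed.

Lemma truncation_cvg (a b : nat) (y : R) : (0 < a)%N -> (a < b)%N -> 0 <= y ->
  (fun t : nat => t%:R ^+ a * Num.min 1 (y / t%:R ^+ b)) @ \oo --> (0 : R).
Proof.
move=> a0 ab y0.
apply: (@squeeze_cvgr _ _ _ _ (fun=> 0) (fun t : nat => y * t%:R^-1)).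
- near=> t.
  have t0 : 0 < t%:R :> R by rewrite ltr0n; near: t; exact: nbhs_infty_gt.
  rewrite mulr_ge0 ?exprn_ge0 //=; last by rewrite le_min ler01 divr_ge0 // exprn_ge0.
  apply: (@le_trans _ _ (t%:R ^+ a * (y / t%:R ^+ b))).
    by rewrite ler_pM2l ?exprn_gt0 // ge_min lexx orbT.
  rewrite mulrCA ler_wpM2l // -(subnK ab) addnS -addSn exprD.
  rewrite invfM mulrCA divff ?expf_neq0 ?gt_eqF // mulr1 lef_pV2 ?posrE ?exprn_gt0 //.
  by rewrite exprS ler_peMr // exprn_ege1 // ler1n -(ltr0n R).
- exact: cvg_cst.
- rewrite -(mulr0 y); apply: cvgMr; apply/gtr0_cvgV0; last exact: cvgr_idn.
  by near=> t; rewrite ltr0n; near: t; exact: nbhs_infty_gt.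
Unshelve. all: by end_near.
Qed.

End Truncation.

Section TruncatedIntegral.
Context (R : realType) (d : measure_display) (T : measurableType d).
Variables (mu : {measure set T -> \bar R}) (D : set T) (L : T -> nat).
Hypothesis mD : measurable D.
Hypothesis mL : measurable_fun D (fun x => (L x)%:R : R).

(** Widths are [n = t ^ b], so that the critical power [n^(a/b)] is the integer [t ^ a]. [C] is the
    Folner constant of the generators. *)
Definition trunc_mean (a b C t : nat) (x : T) : R :=
  t%:R ^+ a * Num.min 1 ((C * L x)%:R / t%:R ^+ b).

Lemma trunc_mean_ge0 a b C t x : 0 <= trunc_mean a b C t x.
Proof. by rewrite mulr_ge0 ?exprn_ge0 // le_min ler01 divr_ge0 // exprn_ge0. Qed.

Lemma trunc_mean_meas a b C t : measurable_fun D (trunc_mean a b C t).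
Proof.
apply: measurable_funM; first exact: measurable_cst.
apply: measurable_minr; first exact: measurable_cst.
apply: measurable_funM; last exact: measurable_cst.
under [X in measurable_fun _ X]eq_fun do rewrite natrM.
by apply: measurable_funM => //; exact: measurable_cst.
Qed.

Lemma trunc_mean_cvg (a b C : nat) (p : R) : (0 < a)%N -> (a < b)%N ->
  a%:R / b%:R <= p ->
  (\int[mu]_(x in D) ((L x)%:R `^ p)%:E < +oo)%E ->
  (fun t => \int[mu]_(x in D) (trunc_mean a b C t x)%:E)%E @ \oo --> 0%E.
Proof.
move=> a0 ab hp hint.
have mp : measurable_fun D (fun x => (L x)%:R `^ p : R).
  exact: (measurableT_comp (measurable_powR p) mL).
have mEp : measurable_fun D (fun x => ((L x)%:R `^ p)%:E : \bar R) by exact/measurable_EFinP.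
pose g (x : T) := (C%:R `^ p * (L x)%:R `^ p)%:E : \bar R.
have ig : mu.-integrable D g.
  apply/integrableP; split.
    by apply/measurable_EFinP; apply: measurable_funM => //; exact: measurable_cst.
  have -> : (\int[mu]_(x in D) `|g x| = \int[mu]_(x in D) ((C%:R `^ p)%:E * ((L x)%:R `^ p)%:E))%E.
    by apply: eq_integral => x _; rewrite gee0_abs /g ?EFinM // lee_fin mulr_ge0 ?powR_ge0.
  rewrite ge0_integralZl_EFin ?powR_ge0 //; try (by move=> x _; rewrite lee_fin powR_ge0).
  by rewrite lte_mul_pinfty ?lee_fin ?powR_ge0.
have := @dominated_convergence _ _ _ mu D mD (fun t x => (trunc_mean a b C t x)%:E)
  (cst 0%E) g _ _ _ ig _.
case.
- by move=> n; apply/measurable_EFinP; exact: trunc_mean_meas.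
- exact: measurable_cst.
- apply: aeW => x _; apply: cvg_EFin; first by near=> t.
  exact: truncation_cvg.
- apply: aeW => x n _; rewrite gee0_abs ?lee_fin ?trunc_mean_ge0 // /g.
  rewrite -powRM //; rewrite -natrM; apply: power_truncation => //; first exact: ltnW.
  by case: (C * L x)%N => [|m]; [left|right; rewrite ler1n].
- by move=> _ _; rewrite integral0.
Unshelve. all: by end_near.
Qed.

End TruncatedIntegral.

Lemma eventually_all (I : eqType) (s : seq I) (P : I -> nat -> Prop) :
  (forall i, i \in s -> \forall n \near \oo, P i n) ->
  \forall n \near \oo, forall i, i \in s -> P i n.
Proof.
elim: s => [|i s IH] h; first by near=> n.
have h1 := h i (mem_head _ _).
have h2 := IH (fun j js => h j (mem_behead (s := i :: s) js)).
near=> n => j; rewrite inE => /orP[/eqP ->|js].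
  by near: n.
by move: j js; near: n.
Unshelve. all: by end_near.
Qed.

Section OnlyIf.
Context (R : realType) (F : finGroupType) (a b k : nat) (p : R) (s : 'I_k -> wreath F a).
Hypothesis F1 : (1 < #|F|)%N.
Hypothesis a0 : (0 < a)%N.
Hypothesis ab : (a < b)%N.
Hypothesis gen : generates s.

Let b0 : (0 < b)%N. Proof. exact: leq_trans ab. Qed.

Lemma folner_generators : exists C, forall N i,
  (left_boundary (folner_seq F a N) (s i) * N <= C * size (folner_seq F a N))%N /\
  (left_boundary (folner_seq F a N) (ginv (s i)) * N <= C * size (folner_seq F a N))%N.
Proof.
have /choice[C hC] := @wreath_folner F a.
exists (\sum_i (C (s i) + C (ginv (s i))))%N => N i.
have le i0 : (C (s i0) + C (ginv (s i0)) <= \sum_i (C (s i) + C (ginv (s i))))%N.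
  by rewrite (bigD1 i0) //= leq_addr.
split; [apply: leq_trans (hC (s i) N) _ | apply: leq_trans (hC (ginv (s i)) N) _];
  by rewrite leq_mul2r (leq_trans _ (le i)) ?orbT // ?leq_addr ?leq_addl.
Qed.

Lemma coupling_exponent_lt : LpL0_ME_coupling (wreath F b) (wreath F a) s p -> p < a%:R / b%:R.
Proof.
move=> [d [Om [mu [aG [aL [XG [XL [_ mu0 [fG fL] comm [dG dL /choice[c hc]]]]]]]]]].
rewrite ltNge; apply/negP => hp.
have [eG [eGI eGS]] := wreath_enum F b0.
have [eL [eLI eLS]] := wreath_enum F a0.
have GLg := wreath_laws F b; have GLl := wreath_laws F a.
have XL0 : (0 < mu XL)%E by exact: (fdom_pos fL dL eLS mu0).
have fin : mu XL \is a fin_num by rewrite ge0_fin_numE //; exact: (fdom_fin dL).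
have m0 : 0 < fine (mu XL) by apply: fine_gt0; rewrite XL0 /=; exact: (fdom_fin dL).
set m := fine (mu XL) in m0.
have mE : mu XL = m%:E by rewrite fineK.
have mXL := fdom_meas dL.
have [K hK] := folner_transfer GLg GLl fG fL comm dG dL eGI eGS XL0.
have [C hC] := folner_generators.
have [h h1] : exists h : F, h != 1%g.
  have /card_gt1P[x [y [_ _ xy]]] := F1.
  by case: (eqVneq x 1%g) => [x1|x1]; [exists y; rewrite eq_sym -x1|exists x].
pose gs : seq {classic wreath F b} := (lamp_at b h : {classic _}) :: [seq move_by F (unitv i) : {classic _} | i <- enum 'I_b].
(* With [n = t ^ (a * b)], isoperimetry will give [3 * M0 * n <= 32 * L] and the size of [B] will
   give [L <= (2 + #|F|) * n]; the contradiction is [3 * 11 > 32]. *)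
pose M0 := (11 * (2 + #|F|))%N.
(* Chosen so that the [b.+1] integrals, each at most [size A / t ^ a * delta], add up to
   [eps * size A / 4 * m] for the [eps] below. *)
pose delta : R := m / (32 * b * M0 * b.+1)%:R.
have M00 : (0 < M0)%N by [].
have den0 : (0 < 32 * b * M0 * b.+1)%N by rewrite muln_gt0 andbT muln_gt0 M00 andbT muln_gt0 b0.
have delta0 : 0 < delta by rewrite divr_gt0 // ltr0n.
have cvg g : \forall t \near \oo,
   (\int[mu]_(x in XL) (trunc_mean R (fun x => wordlen s (c g x)) a b C t x)%:E < delta%:E)%E.
  have [_ mc ic] := hc g.
  have := @trunc_mean_cvg _ _ _ mu XL _ mXL mc a b C p a0 ab hp ic.
  by move=> /(_ (fun u => (u < delta%:E)%E)); apply; apply: open_ereal_lt'; rewrite lte_fin.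
have hall := eventually_all (s := gs) (fun g _ => cvg g).
have [t tK tall] : exists2 t, (K < t)%N & forall g, g \in gs ->
    (\int[mu]_(x in XL) (trunc_mean R (fun x => wordlen s (c g x)) a b C t x)%:E < delta%:E)%E.
  near \oo => t; exists t; first by near: t; exact: nbhs_infty_gt.
  by near: t.
have t0 : (0 < t)%N by apply: leq_trans tK.
(* The boundary allowed in the source is of order [1 / M], and [M ^ b] is a multiple of [N ^ a], the
   order of the logarithm of [size A]: the two sides balance up to the constant [M0]. *)
pose N := (t ^ b)%N; pose A := folner_seq F a N; pose M := (M0 * t ^ a)%N.
have N0 : (0 < N)%N by rewrite expn_gt0 t0.
have M1 : (0 < M)%N by rewrite muln_gt0 M00 expn_gt0 t0.
have sA : size A = (N ^ a * #|F| ^ (N ^ a))%N by rewrite size_folner_seq.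
have A0 : (0 < size A)%N by rewrite sA muln_gt0; apply/andP; split; rewrite expn_gt0 ?N0 ?(ltnW F1).
have uA : uniq A by exact: folner_seq_uniq.
have ta0 : 0 < t%:R ^+ a :> R by rewrite exprn_gt0 // ltr0n.
have tb0 : 0 < t%:R ^+ b :> R by rewrite exprn_gt0 // ltr0n.
pose eps : R := (8 * b * M)%:R^-1.
have bM0 : (0 < 8 * b * M)%N by rewrite muln_gt0 M1 andbT muln_gt0 b0.
have eps0 : 0 < eps by rewrite invr_gt0 ltr0n.
(* The trivial bound by [size A] accounts for the truncation at 1; the other bound charges a
   proportion [C / N] of [A] to each letter of a word. *)
have lbdA w : (left_boundary A w)%:R <= (size A)%:R / t%:R ^+ a *
    (t%:R ^+ a * Num.min 1 ((C * wordlen s w)%:R / t%:R ^+ b)) :> R.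
  have bd : (left_boundary A w * N <= C * wordlen s w * size A)%N.
    pose D := (C * size A %/ N)%N.
    have hD i : (left_boundary A (s i) <= D)%N /\ (left_boundary A (ginv (s i)) <= D)%N.
      by rewrite !leq_divRL //; exact: hC.
    apply: leq_trans (leq_mul (left_boundary_word GLl gen w uA hD) (leqnn N)) _.
    by rewrite -mulnA -[leqRHS]mulnA [leqRHS]mulnCA leq_mul2l leq_trunc_div orbT.
  rewrite mulrA divfK ?gt_eqF // minEle; case: ifP => _.
    by rewrite mulr1 ler_nat left_boundary_le.
  rewrite mulrA ler_pdivlMr // -natrX -!natrM ler_nat.
  by apply: leq_trans bd _; rewrite mulnC.
have intA g : g \in gs -> (\int[mu]_(x in XL) (left_boundary A (c g x))%:R%:E <=
    ((size A)%:R / t%:R ^+ a * delta)%:E)%E.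
  move=> gi; have [hc1 mc _] := hc g.
  have sa0 : 0 <= (size A)%:R / t%:R ^+ a :> R by rewrite divr_ge0 // ltW.
  apply: (@le_trans _ _ (((size A)%:R / t%:R ^+ a)%:E *
     \int[mu]_(x in XL) (trunc_mean R (fun x => wordlen s (c g x)) a b C t x)%:E)%E).
    rewrite -ge0_integralZl_EFin //; first last.
    - by apply/measurable_EFinP; exact: trunc_mean_meas.
    - by move=> x _; rewrite lee_fin trunc_mean_ge0.
    apply: ge0_le_integral => //.
    - exact: (left_boundary_meas GLl fG fL dL hc1).
    - by apply: measurable_funeM; apply/measurable_EFinP; exact: trunc_mean_meas.
    - by move=> x _; rewrite lee_fin; exact: lbdA.
  rewrite [leRHS]EFinM; apply: lee_wpmul2l; first by rewrite lee_fin.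
  exact/ltW/tall.
have [B [uB B0 BK Bgs]] : exists B : seq {classic wreath F b}, [/\ uniq B, (0 < size B)%N,
    (size B <= K * size A)%N & forall g, g \in gs -> (left_boundary B g)%:R <= eps * (size B)%:R].
  apply: (hK gs c) => //; first by move=> g x; case: (hc g) => h' _ _; exact: h'.
  apply: (@le_trans _ _ (\sum_(g <- gs) ((size A)%:R / t%:R ^+ a * delta)%:E)%E).
    by rewrite big_seq [leRHS]big_seq; apply: lee_sum => g; exact: intA.
  have sgs : size gs = b.+1 by rewrite /= size_map size_enum_ord.
  rewrite mE -EFinM sumEFin big_const_seq iter_addr_0 count_predT sgs lee_fin le_eqVlt.
  apply/orP; left; apply/eqP; rewrite /eps /delta /M !natrM natrX.
  have u0 : (2 + #|F|)%:R != 0 :> R by rewrite pnatr_eq0.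
  have v0 : b%:R != 0 :> R by rewrite pnatr_eq0 -lt0n.
  have w0 : b.+1%:R != 0 :> R by rewrite pnatr_eq0.
  have ta1 : t%:R ^+ a != 0 :> R by rewrite gt_eqF.
  rewrite -[LHS]mulr_natr.
  move: ((2 + #|F|)%:R : R) (b.+1%:R : R) (b%:R : R) (t%:R ^+ a : R) u0 w0 v0 ta1 => u w v x u0 w0 v0 x0.
  by field; rewrite u0 v0 w0 x0.
have Bnat g : g \in gs -> (left_boundary B g * (8 * b * M) <= size B)%N.
  move=> /Bgs; rewrite /eps mulrC ler_pdivlMr ?ltr0n // -natrM ler_nat.
  exact.
have [L [L1 L2]] : exists L, (2 ^ L <= size B /\ 3 * M ^ b <= 32 * L)%N.
  apply: (wreath_isoperimetry h1 M1 b0 uB B0) => [i|].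
    apply: (Bnat (move_by F (unitv i))).
    by rewrite inE; apply/orP; right; apply: map_f; rewrite mem_enum.
  apply: leq_trans (Bnat (lamp_at b h) (mem_head _ _)).
  by rewrite leq_mul2l -mulnA leq_pmulr ?orbT // muln_gt0 b0.
pose n := (t ^ (a * b))%N.
have NE : (N ^ a = n)%N by rewrite /N /n -expnM mulnC.
have ME : (M ^ b = M0 ^ b * n)%N by rewrite /M /n expnMn -expnM.
have n0 : (0 < n)%N by rewrite expn_gt0 t0.
have tn : (t <= n)%N by rewrite -{1}[t]expn1 leq_pexp2l // muln_gt0 a0.
have Kn : (K <= 2 ^ n)%N.
  by apply: leq_trans (ltnW tK) _; apply: leq_trans tn _; exact/ltnW/ltn_expl.
have Ln : (L <= n + (n + #|F| * n))%N.
  rewrite -(leq_exp2l (m := 2)) // !expnD; apply: leq_trans L1 _; apply: leq_trans BK _.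
  rewrite sA NE; apply: leq_mul => //; apply: leq_mul; first exact/ltnW/ltn_expl.
  by rewrite expnM leq_exp2r // ltnW // ltn_expl.
have MM : (M0 <= M0 ^ b)%N by rewrite -{1}[M0]expn1 leq_pexp2l.
have : (3 * (M0 * n) <= 32 * (n + (n + #|F| * n)))%N.
  apply: leq_trans (_ : 32 * L <= _)%N; last by rewrite leq_mul2l.
  by apply: leq_trans L2; rewrite ME leq_mul2l leq_mul2r MM !orbT.
suff aux (q r : nat) : (0 < r)%N -> (3 * (11 * (2 + q) * r) <= 32 * (r + (r + q * r)))%N -> False.
  exact: aux n0.
clear => r0; nia.
Unshelve. all: by end_near.
Qed.

End OnlyIf.

(** * Binary digits *)

Section Translation.
Variable R : realType.

Lemma shift_meas (t : R) (A : set R) : measurable A -> measurable [set x | A (x + t)].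
Proof.
move=> mA; rewrite -[X in measurable X]setTI.
have : measurable_fun setT (fun x : R => x + t).
  by apply: measurable_funD; [exact: measurable_id|exact: measurable_cst].
by apply.
Qed.

Definition shift_by (t : R) : measurableTypeR R -> measurableTypeR R := fun x => x + t.

Lemma measurable_shift_by t : measurable_fun setT (shift_by t).
Proof. by apply: measurable_funD; [exact: measurable_id|exact: measurable_cst]. Qed.

HB.instance Definition _ t :=
  isMeasurableFun.Build _ _ _ _ (shift_by t) (measurable_shift_by t).

Lemma lebesgue_measure_shift (t : R) (A : set R) : measurable A ->
  lebesgue_measure [set x | A (x + t)] = lebesgue_measure A.
Proof.
move=> mA.
change (pushforward lebesgue_measure (shift_by t) A = lebesgue_measure A).
apply/esym/lebesgue_measure_unique => //= _ [[a b]] _ <-.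
rewrite /pushforward.
have -> : shift_by t @^-1` [set` `]a, b]] = [set` `]a - t, b - t]].
  by apply/seteqP; split=> x; rewrite /= !in_itv /= ltrBlDr lerBrDr.
rewrite !lebesgue_measure_itv /= !lte_fin ltrD2r -!EFinD.
by case: ifP => // _; congr EFin; lra.
Qed.

End Translation.

Section Digits.
Variable R : realType.
Implicit Types x y : R.

(** On [unit_itv] this is the integer formed by the first [n] binary digits; [digit k] is then the
    digit of weight [2^-(k+1)] in the expansion that does not end in ones. *)
Definition prefix n x : nat := Num.truncn (2 ^+ n * x).
Definition digit k x : bool := odd (prefix k.+1 x).
Definition unit_itv x := 0 <= x < 1.

Lemma prefixP n x m : 0 <= x ->
  (prefix n x == m) = (m%:R <= 2 ^+ n * x < m.+1%:R).
Proof. by move=> x0; rewrite truncn_eq // mulr_ge0 // exprn_ge0. Qed.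

Lemma prefix_itv n x : 0 <= x -> (prefix n x)%:R <= 2 ^+ n * x < (prefix n x).+1%:R.
Proof. by move=> x0; rewrite -prefixP. Qed.

Lemma prefixD n m x : 0 <= x -> prefix n x = (prefix (n + m) x %/ 2 ^ m)%N.
Proof.
move=> x0; apply/eqP; rewrite prefixP //.
have /andP[h1 h2] := prefix_itv (n + m) x0.
set N := prefix _ _ in h1 h2 *.
have p0 : 0 < 2 ^+ m :> R by rewrite exprn_gt0.
rewrite -(ler_pM2l p0) -(ltr_pM2l p0) mulrA -exprD [(m + n)%N]addnC -natrX -!natrM.
apply/andP; split.
  by apply: le_trans h1; rewrite ler_nat mulnC leq_trunc_div.
by apply: lt_le_trans h2 _; rewrite ler_nat mulnC ltn_ceil // expn_gt0.
Qed.

Lemma prefix_lt n x : 0 <= x -> (prefix n x < 2 ^ n)%N = (x < 1).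
Proof.
move=> x0; rewrite truncn_lt_nat ?mulr_ge0 ?exprn_ge0 // natrX.
by rewrite -[X in _ < X]mulr1 ltr_pM2l // exprn_gt0.
Qed.

Lemma prefixS n x : 0 <= x -> prefix n.+1 x = (digit n x + (prefix n x).*2)%N.
Proof.
by move=> x0; rewrite (prefixD n 1 x0) addn1 expn1 divn2 odd_double_half.
Qed.

Lemma prefix_shift n m k x : 0 <= x ->
  prefix (n + m) (x + k%:R / 2 ^+ n) = (prefix (n + m) x + k * 2 ^ m)%N.
Proof.
move=> x0; rewrite /prefix mulrDr.
have -> : 2 ^+ (n + m) * (k%:R / 2 ^+ n) = (k * 2 ^ m)%:R :> R.
  by rewrite natrM natrX exprD mulrC mulrA divfK ?expf_neq0.
rewrite addrC truncnD ?natr_nat // ?nnegrE ?mulr_ge0 ?exprn_ge0 //.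
by rewrite natrK addnC.
Qed.

Definition flip_digit i x : R := x + (if digit i x then - 1 else 1) / 2 ^+ i.+1.

(** No carry occurs, the digit [i] being 0: a prefix of length [i.+1 + m] grows by [2 ^ m], which is
    even unless [m = 0], and shorter prefixes do not change. *)
Lemma digit_add i x : unit_itv x -> ~~ digit i x ->
  unit_itv (x + 1 / 2 ^+ i.+1) /\ forall j, digit j (x + 1 / 2 ^+ i.+1) = digit j x (+) (j == i).
Proof.
move=> /andP[x0 x1] dx; set y := x + _.
have y0 : 0 <= y by rewrite addr_ge0 // divr_ge0 // exprn_ge0.
have py m : prefix (i.+1 + m) y = (prefix (i.+1 + m) x + 2 ^ m)%N.
  by rewrite /y (prefix_shift _ _ 1) // mul1n.
split.
  rewrite /unit_itv y0 /= -(prefix_lt i.+1) //; have := py 0%N; rewrite addn0 => ->.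
  have := x1; rewrite -(prefix_lt i.+1 x0); move: dx; rewrite /digit expnS; lia.
move=> j; rewrite /digit; case: (ltngtP j i) => ji.
- have e : i.+1 = (j.+1 + (i - j).-1.+1)%N by lia.
  rewrite (prefixD j.+1 (i - j).-1.+1 y0) (prefixD j.+1 (i - j).-1.+1 x0) -e addbF.
  have := py 0%N; rewrite addn0 => ->; rewrite expnS !divnMA.
  by move: dx; rewrite /digit => dx; congr (odd (_ %/ _)); lia.
- have -> : j.+1 = (i.+1 + (j - i).-1.+1)%N by lia.
  by rewrite py oddD oddX orbF.
- by have := py 0%N; rewrite addn0 ji => ->; rewrite oddD.
Qed.

Lemma digit_flip i x : unit_itv x ->
  unit_itv (flip_digit i x) /\ forall j, digit j (flip_digit i x) = digit j x (+) (j == i).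
Proof.
move=> ux; rewrite /flip_digit; case: ifP => dx; last by apply: digit_add => //; rewrite dx.
have /andP[x0 x1] := ux.
set y := x + _; have xE : x = y + 1 / 2 ^+ i.+1 by rewrite /y mulNr subrK.
have h0 : 0 < 1 / 2 ^+ i.+1 :> R by rewrite divr_gt0 ?exprn_gt0.
have y0 : 0 <= y.
  rewrite /y mulNr subr_ge0 ler_pdivrMr ?exprn_gt0 // mulrC.
  have /andP[+ _] := prefix_itv i.+1 x0; apply: le_trans; rewrite ler1n.
  by move: dx; rewrite /digit; case: (prefix _ _).
have uy : unit_itv y by rewrite /unit_itv y0 /=; apply: lt_trans x1; rewrite [ltRHS]xE ltrDl.
have dy : ~~ digit i y.
  move: dx; rewrite /digit {1}xE; have := prefix_shift i.+1 0 1 y0.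
  by rewrite addn0 => ->; rewrite oddD /= addbT.
split=> // j; have [_ /(_ j)] := digit_add uy dy; rewrite -xE => ->.
by rewrite -addbA addbb addbF.
Qed.

(** The point is found by flipping wrong digits one at a time. The explicit correction depends only
    on finitely many digits, which is what later makes the actions piecewise translations. *)
Lemma digits_realize n x (d : nat -> bool) : unit_itv x ->
  (forall k, (n <= k)%N -> d k = digit k x) ->
  let y := x + \sum_(k < n) ((d k)%:R - (digit k x)%:R) / 2 ^+ k.+1 in
  unit_itv y /\ forall k, digit k y = d k.
Proof.
elim: n x => [|n IH] x ux hd /=.
  by rewrite big_ord0 addr0; split=> // k; rewrite hd.
pose x1 := x + ((d n)%:R - (digit n x)%:R) / 2 ^+ n.+1.
have [u1 d1] : unit_itv x1 /\ forall k, digit k x1 = if k == n then d n else digit k x.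
  case: (eqVneq (d n) (digit n x)) => e.
    by rewrite /x1 e subrr mul0r addr0; split=> // k; case: eqP => // ->.
  have -> : x1 = flip_digit n x.
    rewrite /x1 /flip_digit; move: e; case: (d n) (digit n x) => [] [] //= _.
      by rewrite subr0.
    by rewrite sub0r.
  have [u1 h] := digit_flip n ux; split=> // k; rewrite h.
  by case: eqP => [->|_]; [move: e; case: (d n) (digit n x) => [] []|rewrite addbF].
have [] := IH x1 u1 _.
  move=> k nk; rewrite d1; case: eqP => [->//|ne]; apply: hd; lia.
rewrite big_ord_recr /= [_ + ((d n)%:R - _) / _]addrC addrA -/x1.
by under eq_bigr => k _ do rewrite d1 ltn_eqF //.
Qed.

Lemma prefix0 x : unit_itv x -> prefix 0 x = 0%N.
Proof. by move=> /andP[x0 x1]; have := prefix_lt 0 x0; rewrite x1; case: (prefix _ _). Qed.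

Lemma digit_prefix n x y : unit_itv x -> unit_itv y ->
  (forall k, (k < n)%N -> digit k x = digit k y) <-> prefix n x = prefix n y.
Proof.
move=> ux uy; have [/andP[x0 _] /andP[y0 _]] := (ux, uy).
elim: n => [|n IH]; first by rewrite !prefix0.
split=> [h|].
  by rewrite !prefixS // h // (IH.1 (fun k kn => h k (ltnW kn))).
rewrite !prefixS // => e.
have e1 : digit n x = digit n y by move/(congr1 odd): e; rewrite !oddD !odd_double !addbF !oddb.
have e2 : prefix n x = prefix n y by move: e; rewrite e1; lia.
by move=> k; rewrite ltnS leq_eqVlt => /orP[/eqP ->//|]; apply: IH.2.
Qed.

Lemma digit_inj x y : unit_itv x -> unit_itv y -> (forall k, digit k x = digit k y) -> x = y.
Proof.
wlog xy : x y / x < y.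
  by move=> H ux uy h; case: (ltgtP x y) => // xy; [exact: H|apply/esym; exact: H].
move=> ux uy h; exfalso; have [/andP[x0 _] /andP[y0 _]] := (ux, uy).
have d0 : 0 < y - x by rewrite subr_gt0.
pose n := (Num.truncn (y - x)^-1).+1.
have hn : 1 <= (y - x) * 2 ^+ n.
  rewrite -ler_pdivrMl // mulr1; apply: le_trans (ltW (truncnS_gt _)) _.
  by rewrite -natrX ler_nat -/n ltnW // ltn_expl.
have e : prefix n x = prefix n y by apply/digit_prefix.
have /andP[h1 _] := prefix_itv n x0; have /andP[_ h2] := prefix_itv n y0.
by move: h1 h2; rewrite e -natr1; nra.
Qed.

Lemma measurable_prefix n (P : nat -> Prop) :
  measurable [set x : R | unit_itv x /\ P (prefix n x)].
Proof.
have -> : [set x : R | unit_itv x /\ P (prefix n x)] =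
    \bigcup_(m in [set m | P m]) ([set` `[0, 1[] `&` [set` `[m%:R / 2 ^+ n, m.+1%:R / 2 ^+ n[]).
  have p0 : 0 < 2 ^+ n :> R by rewrite exprn_gt0.
  apply/seteqP; split=> x.
    move=> [ux Px]; exists (prefix n x) => //; split; first by rewrite /= in_itv.
    rewrite /= in_itv /= ler_pdivrMr // ltr_pdivlMr // [x * _]mulrC.
    by apply: prefix_itv; case/andP: ux.
  move=> [m Pm []] /=; rewrite !in_itv /= => ux; split=> //.
  suff /eqP -> : prefix n x == m by [].
  rewrite prefixP; last by case/andP: ux.
  by rewrite ![2 ^+ n * _]mulrC -ler_pdivrMr // -ltr_pdivlMr.
by apply: bigcup_measurable => m _; apply: measurableI; exact: measurable_itv.
Qed.

(** Constant patterns are the relevant ones: a carry or a borrow runs through a block of equal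
    digits. *)
Definition cylinder (l : seq nat) (v : bool) : set R :=
  [set x | unit_itv x /\ forall i, i \in l -> digit i x = v].

Lemma cylinder_cons i l v : cylinder (i :: l) v =
  cylinder l v `&` [set x | unit_itv x /\ odd (prefix i.+1 x) = v].
Proof.
apply/seteqP; split=> x.
  move=> [ux h]; split; split=> //; last by apply: h; rewrite mem_head.
  by move=> j jl; apply: h; rewrite inE jl orbT.
by move=> [[ux h] [_ h']]; split=> // j; rewrite inE => /orP[/eqP ->//|]; exact: h.
Qed.

Lemma measurable_cylinder l v : measurable (cylinder l v).
Proof.
elim: l => [|i l IH]; last by rewrite cylinder_cons; apply: measurableI => //; exact: (@measurable_prefix i.+1 (fun m => odd m = v)).
have := @measurable_prefix 0 (fun=> True); congr (measurable _).
by apply/seteqP; split=> x [].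
Qed.

(* Flipping the digit [i] is a translation between the two halves of a cylinder. *)
Lemma cylinder_measure l v : uniq l ->
  lebesgue_measure (cylinder l v) = ((2 ^+ size l)^-1)%:E.
Proof.
elim: l => [_|i l IH /= /andP[il ul]].
  rewrite expr0 invr1 (_ : cylinder [::] v = [set` `[0, 1[]).
    by rewrite lebesgue_measure_itv /= lte_fin ltr01 oppr0 adde0.
  by apply/seteqP; split=> x /=; rewrite in_itv /=; [case|move=> ux; split].
pose h : R := (if v then 1 else -1) / 2 ^+ i.+1.
pose A := cylinder (i :: l) v.
have mA : measurable A by exact: measurable_cylinder.
have hB : cylinder l v = A `|` [set x | A (x + h)].
  apply/seteqP; split=> [x [ux hx]|x [[ux hx]|[uy hy]]].
  - case: (eqVneq (digit i x) v) => e.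
      by left; split=> // j; rewrite inE => /orP[/eqP ->//|]; exact: hx.
    right; have [u1 d1] := digit_flip i ux; change (A (x + h)).
    have ev : digit i x = ~~ v.
      by move: e; clear; case: (digit i x); case: v.
    have -> : x + h = flip_digit i x by rewrite /flip_digit /h ev if_neg.
    split=> // j; rewrite d1 inE; case: (eqVneq j i) => [-> _|ji /= jl].
      by rewrite ev addbT negbK.
    by rewrite addbF hx.
  - by split=> // j jl; apply: hx; rewrite inE jl orbT.
  - have dy : digit i (x + h) = v by apply: hy; rewrite mem_head.
    have [u1 d1] := digit_flip i uy.
    have xE : flip_digit i (x + h) = x.
      by rewrite /flip_digit dy /h; case: (v); rewrite -addrA -mulrDl ?subrr ?addNr mul0r addr0.
    rewrite xE in u1 d1; split=> // j jl; rewrite d1 hy ?inE ?jl ?orbT //.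
    by case: eqP => [ji|]; [rewrite -ji jl in il|rewrite addbF].
have mA' : measurable [set x | A (x + h)] by exact: shift_meas.
have dA : A `&` [set x | A (x + h)] = set0.
  rewrite -subset0 => x [[ux hx] [uy hy]].
  have dy : digit i (x + h) = v by apply: hy; rewrite mem_head.
  have [_ /(_ i)] := digit_flip i uy.
  have -> : flip_digit i (x + h) = x.
    by rewrite /flip_digit dy /h; case: (v); rewrite -addrA -mulrDl ?subrr ?addNr mul0r addr0.
  by rewrite eqxx dy (hx i) ?mem_head // => /eqP; case: (v).
have e : (lebesgue_measure A + lebesgue_measure A = ((2 ^+ size l)^-1)%:E)%E.
  rewrite -[X in (_ + X)%E](lebesgue_measure_shift h mA) -(IH ul) hB.
  by apply/esym; exact: measureU.
rewrite -/A.
have fA : lebesgue_measure A \is a fin_num.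
  rewrite ge0_fin_numE //; apply: le_lt_trans (_ : lebesgue_measure A + lebesgue_measure A < _)%E.
    by rewrite leeDl.
  by rewrite e ltry.
move: e; rewrite -(fineK fA) -EFinD => -[e]; congr EFin.
rewrite exprS invfM; lra.
Qed.

End Digits.
Arguments prefix {R} n x.
Arguments digit {R} k x.
Arguments cylinder {R} l v.
Arguments unit_itv {R} x.

(** * Interlaced 2-adic coordinates *)

Section Binary.
Implicit Types c d : nat -> bool.

Definition binval I c : nat := (\sum_(i < I) c i * 2 ^ i)%N.

Lemma binvalS I c : binval I.+1 c = (binval I c + c I * 2 ^ I)%N.
Proof. by rewrite /binval big_ord_recr. Qed.

Lemma binval_lt I c : (binval I c < 2 ^ I)%N.
Proof.
elim: I => [|I IH]; first by rewrite /binval big_ord0.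
by rewrite binvalS expnS; case: (c I); lia.
Qed.

Lemma binval_inj I c d : binval I c = binval I d -> forall i, (i < I)%N -> c i = d i.
Proof.
elim: I => // I IH; rewrite !binvalS => e.
have e1 : c I = d I.
  by move: e (binval_lt I c) (binval_lt I d); case: (c I); case: (d I) => //=; lia.
have e2 : binval I c = binval I d by move: e; rewrite e1; lia.
by move=> i; rewrite ltnS leq_eqVlt => /orP[/eqP -> //|]; apply: IH.
Qed.

Lemma eq_binval I c d : (forall i, (i < I)%N -> c i = d i) -> binval I c = binval I d.
Proof. by move=> h; apply: eq_bigr => i _; rewrite h. Qed.

Lemma binval_bits I n : (n < 2 ^ I)%N -> binval I (fun i => odd (n %/ 2 ^ i)) = n.
Proof.
elim: I n => [|I IH] n h; first by rewrite /binval big_ord0; case: n h.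
rewrite /binval big_ord_recl /= expn0 muln1 divn1.
have e : (\sum_(i < I) odd (n %/ 2 ^ bump 0 i) * 2 ^ bump 0 i = 2 * binval I (fun i => odd (n./2 %/ 2 ^ i)))%N.
  rewrite /binval big_distrr /=; apply: eq_bigr => i _.
  by rewrite /bump /= add1n expnS divnMA divn2 mulnCA.
rewrite e IH; first by rewrite mul2n odd_double_half.
by rewrite expnS in h; lia.
Qed.

Lemma binval_ge I c i : (i < I)%N -> c i -> (2 ^ i <= binval I c)%N.
Proof.
move=> iI ci; rewrite /binval (bigD1 (Ordinal iI)) //= ci mul1n leq_addr //.
Qed.

Lemma binval_compl I c : (binval I c + binval I (fun i => ~~ c i) + 1 = 2 ^ I)%N.
Proof.
elim: I => [|I IH]; first by rewrite /binval !big_ord0.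
by rewrite !binvalS expnS -IH; case: (c I) => /=; lia.
Qed.

Lemma binval_diff_ge I J c d : (I <= J)%N -> (forall i, (I <= i)%N -> c i = d i) ->
  (binval J c)%:Z - (binval J d)%:Z = (binval I c)%:Z - (binval I d)%:Z.
Proof.
move=> IJ h; rewrite -(subnKC IJ); elim: (J - I)%N => [|m IH]; first by rewrite addn0.
by rewrite addnS !binvalS h ?leq_addr // -IH; lia.
Qed.

End Binary.

Section Torsor.
Implicit Types d : nat -> bool.
Variable q : nat.
Hypothesis q0 : (0 < q)%N.
Implicit Types z : 'rV[int]_q.

(* A digit sequence [d] is read as a [q]-tuple of 2-adic integers, the [j]-th
   of which has the digits [d (q * i + j)]; [offset z I d d'] says that [d] and
   [d'] agree from place [q * I] on, and that their difference is [z]. *)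
Definition strand (j : nat) d : nat -> bool := fun i => d (q * i + j)%N.

Definition offset z I d d' : Prop :=
  (forall k, (q * I <= k)%N -> d k = d' k) /\
  forall j : 'I_q, (binval I (strand j d'))%:Z - (binval I (strand j d))%:Z = z 0 j.

(** No carry or borrow leaves the first [I] places of any strand when [z] is added. *)
Definition fits z I d : Prop := forall j : 'I_q,
  0 <= (binval I (strand j d))%:Z + z 0 j < (2 ^ I)%:Z.

Lemma strand_tail I d d' : (forall k, (q * I <= k)%N -> d k = d' k) ->
  forall j i, (I <= i)%N -> strand j d i = strand j d' i.
Proof.
by move=> h j i Ii; apply: h; apply: leq_trans (leq_addr _ _); rewrite leq_mul2l Ii orbT.
Qed.

Lemma offset_le z I J d d' : (I <= J)%N -> offset z I d d' -> offset z J d d'.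
Proof.
move=> IJ [h hz]; split=> [k Jk|j].
  by apply: h; apply: leq_trans Jk; rewrite leq_mul2l IJ orbT.
rewrite -hz; apply: binval_diff_ge => // i Ii; apply/esym; exact: strand_tail Ii.
Qed.

Lemma offsetD z z' I d d' d'' : offset z I d d' -> offset z' I d' d'' ->
  offset (z + z') I d d''.
Proof.
move=> [h hz] [h' hz']; split=> [k kI|j]; first by rewrite h // h'.
by rewrite mxE -hz -hz'; lia.
Qed.

Lemma offset_ex I d d' : (forall k, (q * I <= k)%N -> d k = d' k) -> exists z, offset z I d d'.
Proof.
move=> h; exists (\row_j ((binval I (strand j d'))%:Z - (binval I (strand j d))%:Z)).
by split=> // j; rewrite mxE.
Qed.

Lemma offset_uniq z z' I d d' : offset z I d d' -> offset z' I d d' -> z = z'.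
Proof. by move=> [_ h] [_ h']; apply/rowP => j; rewrite -h -h'. Qed.

Lemma strand_div d k : d k = strand (k %% q) d (k %/ q).
Proof. by rewrite /strand mulnC -divn_eq. Qed.

(** Addition acts on the first [q * I] digits by themselves: without carries across place [I], they
    determine those of the sum. *)
Lemma offset_prefix z I d d' e e' : offset z I d d' -> offset z I e e' ->
  (forall k, (k < q * I)%N -> d k = e k) -> forall k, (k < q * I)%N -> d' k = e' k.
Proof.
move=> [_ hd] [_ he] h k kI; rewrite (strand_div d') (strand_div e').
have jq : (k %% q < q)%N by rewrite ltn_mod.
have iI : (k %/ q < I)%N by rewrite ltn_divLR // mulnC.
apply: binval_inj iI.
have := hd (Ordinal jq); have := he (Ordinal jq) => /=.
rewrite (@eq_binval I (strand (k %% q) d) (strand (k %% q) e)); first by move=> <-; lia.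
move=> i iI; apply: h.
apply: (@leq_trans (q * i + q)%N); first by rewrite ltn_add2l.
by rewrite -mulnSr leq_mul2l iI orbT.
Qed.

Lemma offset_inj z I d d' d'' : offset z I d d' -> offset z I d d'' -> d' =1 d''.
Proof.
move=> h h' k; case: (ltnP k (q * I)) => kI; first exact: (offset_prefix h h').
by case: h h' => [h1 _] [h2 _]; rewrite -h1 // -h2.
Qed.

Lemma fits_offset z I d : fits z I d -> exists d', offset z I d d'.
Proof.
move=> h; pose v j : nat := if insub j is Some j' then `|((binval I (strand j d))%:Z + z 0 j')%R|%N else 0%N.
exists (fun k => if (k < q * I)%N then odd (v (k %% q)%N %/ 2 ^ (k %/ q)) else d k); split.
  by move=> k kI; rewrite ltnNge kI.
move=> j; have hj := h j.
have vj : (v j)%:Z = (binval I (strand j d))%:Z + z 0 j.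
  by rewrite /v valK gez0_abs //; case/andP: hj.
have lj : (v j < 2 ^ I)%N by rewrite -ltz_nat vj; case/andP: hj.
rewrite (_ : binval I (strand j _) = v j); first by rewrite vj; lia.
rewrite -[RHS](binval_bits lj); apply: eq_binval => i iI; rewrite /strand.
have jq := ltn_ord j.
have -> : (q * i + j < q * I)%N.
  apply: (@leq_trans (q * i + q)%N); first by rewrite ltn_add2l.
  by rewrite -mulnSr leq_mul2l iI orbT.
by rewrite mulnC modnMDl divnMDl // modn_small // (divn_small jq) addn0.
Qed.

(** A one at a place from [r] on absorbs the borrow of subtracting up to [2 ^ r]; a zero there,
    through [binval_compl], absorbs the carry of adding as much. *)
Lemma fits_digits z I r d :
  (forall j : 'I_q, (`|z 0%R j| <= 2 ^ r)%N) ->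
  (forall (j : 'I_q) v, exists2 i, (r <= i < I)%N & strand j d i = v) ->
  fits z I d.
Proof.
move=> hz h j; have := hz j.
have [i1 /andP[ri1 i1I] d1] := h j true; have [i0 /andP[ri0 i0I] d0] := h j false.
have g1 := binval_ge i1I d1.
have g0 : (2 ^ i0 <= binval I (fun i => ~~ strand j d i))%N by apply: binval_ge => //; rewrite d0.
have := binval_compl I (strand j d).
have l1 : (2 ^ r <= 2 ^ i1)%N by rewrite leq_exp2l.
have l0 : (2 ^ r <= 2 ^ i0)%N by rewrite leq_exp2l.
lia.
Qed.

Definition mixed d : Prop := forall (j : 'I_q) (v : bool) (N : nat),
  exists2 i, (N <= i)%N & strand j d i = v.

Lemma mixed_fits z d : mixed d -> exists I0, forall I, (I0 <= I)%N -> fits z I d.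
Proof.
move=> md.
pose r := (\max_j `|z 0%R j|)%N.
have hz (j : 'I_q) : (`|z 0%R j| <= 2 ^ r)%N.
  by apply: leq_trans (ltnW (ltn_expl r (ltnSn 1))); exact: (leq_bigmax j).
have /choice[f hf] : forall u : 'I_q * bool, exists i, (r <= i)%N /\ strand u.1 d i = u.2.
  by move=> [j v]; have [i ri di] := md j v r; exists i.
exists (\max_u (f u).+1)%N => I hI; apply: (fits_digits hz) => j v.
exists (f (j, v)); last by case: (hf (j, v)).
case: (hf (j, v)) => -> _ /=; apply: leq_trans hI; exact: (leq_bigmax (j, v)).
Qed.

Lemma mixed_tail I d d' : (forall k, (I <= k)%N -> d k = d' k) -> mixed d -> mixed d'.
Proof.
move=> h md j v N; have [i] := md j v (maxn N I); rewrite geq_max => /andP[Ni Ii] di.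
exists i => //; rewrite -di; apply/esym; apply: strand_tail Ii => k qk; apply: h.
by apply: leq_trans qk; rewrite leq_pmull.
Qed.

End Torsor.

(** * The cocycle between wreath products *)

(* [T] is a free action of Z^n whose orbits are the classes of [same], and
   [D x y] is the element moving [x] to [y]. *)
Definition orbit_coords (X : Type) (same : X -> X -> Prop) (n : nat)
    (T : X -> 'rV[int]_n -> X) (D : X -> X -> 'rV[int]_n) : Prop :=
  [/\ forall x z, same x (T x z), forall x z, D x (T x z) = z,
      forall x y, same x y -> T x (D x y) = y &
      forall x y w, same x y -> same y w -> D x w = D x y + D y w].

Section OrbitCoords.
Variables (X : Type) (same : X -> X -> Prop).
Hypothesis same_sym : forall x y, same x y -> same y x.
Hypothesis same_trans : forall x y w, same x y -> same y w -> same x w.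
Variables (n : nat) (T : X -> 'rV[int]_n -> X) (D : X -> X -> 'rV[int]_n).
Hypothesis C : orbit_coords same T D.

Lemma coord_same x z : same x (T x z). Proof. by case: C => h _ _ _; exact: h. Qed.
Lemma coordK x z : D x (T x z) = z. Proof. by case: C => _ h _ _; exact: h. Qed.
Lemma coordVK x y : same x y -> T x (D x y) = y. Proof. by case: C => _ _ h _; exact: h. Qed.
Lemma coordD x y w : same x y -> same y w -> D x w = D x y + D y w.
Proof. by case: C => _ _ _ h; exact: h. Qed.
Lemma coord_refl x : same x x.
Proof. exact: same_trans (coord_same x 0) (same_sym (coord_same x 0)). Qed.
Lemma coord_id x : D x x = 0.
Proof.
by apply: (addrI (D x x)); rewrite -coordD ?addr0 //; exact: coord_refl.
Qed.
Lemma coordN x y : same x y -> D y x = - D x y.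
Proof.
move=> h; apply: (addrI (D x y)); rewrite -coordD ?subrr ?coord_id //.
exact: same_sym.
Qed.
Lemma coord_actD x z z' : T (T x z) z' = T x (z + z').
Proof.
have h : same x (T (T x z) z') by apply: same_trans (coord_same _ _); exact: coord_same.
rewrite -[LHS](coordVK h); congr (T x _).
by rewrite (coordD (coord_same x z) (coord_same _ _)) !coordK.
Qed.
Lemma coord_act0 x : T x 0 = x.
Proof. by rewrite -{1}(coord_id x) coordVK //; exact: coord_refl. Qed.

End OrbitCoords.

Section LampTransport.
Variables (F : finGroupType) (X : Type) (same : X -> X -> Prop).
Hypothesis same_sym : forall x y, same x y -> same y x.
Hypothesis same_trans : forall x y w, same x y -> same y w -> same x w.
Variables (n1 n2 : nat).
Variables (T1 : X -> 'rV[int]_n1 -> X) (D1 : X -> X -> 'rV[int]_n1).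
Variables (T2 : X -> 'rV[int]_n2 -> X) (D2 : X -> X -> 'rV[int]_n2).
Hypothesis C1 : orbit_coords same T1 D1.
Hypothesis C2 : orbit_coords same T2 D2.

(** Both [u] and the [Z^n2]-position computed from it designate the point [T1 y (- u)]. *)
Lemma transport_cancel y (u : 'rV[int]_n1) : D1 (T2 y (- D2 (T1 y (- u)) y)) y = u.
Proof.
have s1 := coord_same C1 y (- u).
rewrite (coordN same_sym same_trans C2 s1) opprK (coordVK C2 s1).
by rewrite (coordN same_sym same_trans C1 s1) (coordK C1) opprK.
Qed.

Lemma transport_fin (f : lamp F n1) y :
  finite_set [set w | lamp_fun f (D1 (T2 y (- w)) y) != 1%g].
Proof.
apply: (@sub_finite_set _ _ [set D2 (T1 y (- u)) y | u in [set u | lamp_fun f u != 1%g]]).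
  move=> w /= h; exists (D1 (T2 y (- w)) y) => //.
  have s2 := coord_same C2 y (- w).
  rewrite (coordN same_sym same_trans C1 s2) opprK (coordVK C1 s2).
  by rewrite (coordN same_sym same_trans C2 s2) (coordK C2) opprK.
by apply: finite_image; exact: (proj2_sig f).
Qed.

(* The lamp at position [u] of Z^n1 seen from [y] belongs to the point
   [T1 y (- u)]; it is moved to the Z^n2-position of that same point. *)
Definition transport (f : lamp F n1) (y : X) : lamp F n2 :=
  exist _ (fun w => lamp_fun f (D1 (T2 y (- w)) y)) (transport_fin f y).

Definition wreath_cocycle (g : wreath F n1) (x : X) : wreath F n2 :=
  (transport g.1 (T1 x g.2), D2 x (T1 x g.2)).

(** Lamps are attached to points of the orbit, which do not depend on the base point; changing the
    base point only shifts the positions by which they are named. *)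
Lemma wreath_cocycleM (g h : wreath F n1) x :
  wreath_cocycle (gmul g h) x =
  gmul (wreath_cocycle g (T1 x h.2)) (wreath_cocycle h x).
Proof.
set x1 := T1 x h.2; set y := T1 x1 g.2.
have yE : T1 x (gmul g h).2 = y.
  by rewrite /y /x1 (coord_actD same_trans C1) addrC.
have s01 : same x x1 by exact: coord_same C1 _ _.
have s1y : same x1 y by exact: coord_same C1 _ _.
rewrite /wreath_cocycle yE.
apply: wreath_eq => [w|] /=; last by rewrite (coordD C2 s01 s1y) addrC.
rewrite /lamp_fun /=; congr (_ * lamp_fun h.1 _)%g.
have -> : T2 x1 (- (w - D2 x1 y)) = T2 y (- w).
  by rewrite -[in RHS](coordVK C2 s1y) (coord_actD same_trans C2) opprB.
have sw := coord_same C2 y (- w).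
rewrite (coordD C1 (same_sym sw) (same_sym s1y)) (coordN same_sym same_trans C1 s1y).
by rewrite (coordK C1).
Qed.

Lemma wreath_cocycle_inj x : injective (wreath_cocycle^~ x).
Proof.
move=> g g' e.
have e2 : g.2 = g'.2.
  have : T2 x (D2 x (T1 x g.2)) = T2 x (D2 x (T1 x g'.2)) by rewrite (congr1 snd e : D2 _ _ = D2 _ _).
  rewrite !(coordVK C2); try exact: coord_same C1 _ _.
  by move=> /(congr1 (D1 x)); rewrite !(coordK C1).
apply: wreath_eq => // u.
pose y := T1 x g.2.
have := congr1 (fun l : wreath F n2 => lamp_fun l.1 (D2 (T1 y (- u)) y)) e.
by rewrite /lamp_fun /= -e2 -/y transport_cancel.
Qed.

(** Positions of lamps are expressed by the cocycle of the [Z^n1]-action from the single base point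
    [x], at [z] and at [z - u]. A given group element thus involves finitely many vectors. *)
Lemma transport_position x (z u : 'rV[int]_n1) :
  D2 (T1 (T1 x z) (- u)) (T1 x z) = D2 x (T1 x z) - D2 x (T1 x (z - u)).
Proof.
have s1 := coord_same C1 x z; have s2 := coord_same C1 (T1 x z) (- u).
rewrite (coordN same_sym same_trans C2 s2) -(coord_actD same_trans C1).
by rewrite (coordD C2 s1 s2) opprD addrA subrr add0r.
Qed.

(* A lamp contributes to the cocycle through the position of its point only. *)
Lemma wreath_cocycle_lamp (g : wreath F n1) x w :
  lamp_fun (wreath_cocycle g x).1 w != 1%g ->
  exists u, lamp_fun g.1 u = lamp_fun (wreath_cocycle g x).1 w /\
    w = D2 x (T1 x g.2) - D2 x (T1 x (g.2 - u)).
Proof.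
set y := T1 x g.2; move=> hw; exists (D1 (T2 y (- w)) y); split=> //.
rewrite -transport_position -/y.
have s2 := coord_same C2 y (- w).
rewrite (coordN same_sym same_trans C1 s2) opprK (coordVK C1 s2).
by rewrite (coordN same_sym same_trans C2 s2) (coordK C2) opprK.
Qed.

Lemma wreath_cocycle_lampE (g : wreath F n1) x u :
  lamp_fun (wreath_cocycle g x).1 (D2 x (T1 x g.2) - D2 x (T1 x (g.2 - u))) = lamp_fun g.1 u.
Proof.
rewrite -transport_position.
by rewrite /wreath_cocycle /transport [LHS]/lamp_fun /= transport_cancel.
Qed.

Lemma wreath_cocycle_eq (g : wreath F n1) x x' :
  D2 x (T1 x g.2) = D2 x' (T1 x' g.2) ->
  (forall u, lamp_fun g.1 u != 1%g ->
     D2 x (T1 x (g.2 - u)) = D2 x' (T1 x' (g.2 - u))) ->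
  wreath_cocycle g x = wreath_cocycle g x'.
Proof.
have step t t' : D2 t (T1 t g.2) = D2 t' (T1 t' g.2) ->
   (forall u, lamp_fun g.1 u != 1%g -> D2 t (T1 t (g.2 - u)) = D2 t' (T1 t' (g.2 - u))) ->
   forall w, lamp_fun (wreath_cocycle g t).1 w != 1%g ->
   lamp_fun (wreath_cocycle g t').1 w = lamp_fun (wreath_cocycle g t).1 w.
  move=> e eu w hw; have [u [gu wE]] := wreath_cocycle_lamp hw.
  by rewrite -gu {1}wE e eu ?gu // wreath_cocycle_lampE.
move=> e eu; apply: wreath_eq => [w|//].
case: (eqVneq (lamp_fun (wreath_cocycle g x).1 w) 1%g) => [h|h]; last by rewrite (step x x').
case: (eqVneq (lamp_fun (wreath_cocycle g x').1 w) 1%g) => [h'|h']; first by rewrite h h'.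
by rewrite (step x' x) // => u hu; rewrite eu.
Qed.

End LampTransport.

Section CocycleBijective.
Variables (F : finGroupType) (X : Type) (same : X -> X -> Prop).
Hypothesis same_sym : forall x y, same x y -> same y x.
Hypothesis same_trans : forall x y w, same x y -> same y w -> same x w.
Variables (n1 n2 : nat).
Variables (T1 : X -> 'rV[int]_n1 -> X) (D1 : X -> X -> 'rV[int]_n1).
Variables (T2 : X -> 'rV[int]_n2 -> X) (D2 : X -> X -> 'rV[int]_n2).
Hypothesis C1 : orbit_coords same T1 D1.
Hypothesis C2 : orbit_coords same T2 D2.

(** The construction is symmetric in the two actions; the preimage is the cocycle with the roles
    exchanged. *)
Lemma wreath_cocycle_surj x (l : wreath F n2) :
  exists g, wreath_cocycle same_sym same_trans C1 C2 g x = l.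
Proof.
exists (wreath_cocycle same_sym same_trans C2 C1 l x).
set y := T2 x l.2.
have s : same x y by exact: coord_same C2 _ _.
rewrite /wreath_cocycle /= (coordVK C1 s).
apply: wreath_eq => [w|] /=; last by rewrite (coordK C2).
by rewrite /lamp_fun /= (transport_cancel same_sym same_trans C2 C1).
Qed.

End CocycleBijective.

(** * Generic points and their coordinates *)

Section Generic.
Variable R : realType.

Definition generic (x : R) : Prop :=
  unit_itv x /\ forall q, (0 < q)%N -> mixed q (digit^~ x).

Definition point_of : Type := {x : R | generic x}.
Implicit Types x y w : point_of.

Definition dig x : nat -> bool := digit^~ (sval x).
Definition same x y : Prop := exists n, forall k, (n <= k)%N -> dig x k = dig y k.

Lemma point_unit x : unit_itv (sval x). Proof. by case: (svalP x). Qed.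
Lemma dig_mixed x q : (0 < q)%N -> mixed q (dig x).
Proof. by move=> q0; case: (svalP x) => _; exact. Qed.

Lemma point_inj x y : sval x = sval y -> x = y.
Proof. by case: x y => [x hx] [y hy] /= e; subst y; congr exist; exact: Prop_irrelevance. Qed.

Lemma dig_inj x y : dig x =1 dig y -> x = y.
Proof. by move=> h; apply: point_inj; apply: digit_inj h; exact: point_unit. Qed.

Lemma same_sym x y : same x y -> same y x.
Proof. by move=> [n h]; exists n => k /h. Qed.

Lemma same_trans x y w : same x y -> same y w -> same x w.
Proof.
move=> [n h] [m h']; exists (maxn n m) => k; rewrite geq_max => /andP[nk mk].
by rewrite h // h'.
Qed.

Lemma point_realize x n (d : nat -> bool) : (forall k, (n <= k)%N -> dig x k = d k) ->
  exists y, dig y =1 d.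
Proof.
move=> h; have [] := @digits_realize R n (sval x) d (point_unit x).
  by move=> k /h.
set y := _ + _ => uy dy.
have my q : (0 < q)%N -> mixed q (digit^~ y).
  move=> q0; apply: (mixed_tail q0 (I := n) (d := dig x)); last exact: dig_mixed.
  by move=> k nk; rewrite dy h.
by exists (exist _ y (conj uy my)).
Qed.

Lemma point_diff x y n : (forall k, (n <= k)%N -> dig x k = dig y k) ->
  sval y = sval x + \sum_(k < n) ((dig y k)%:R - (dig x k)%:R) / 2 ^+ k.+1.
Proof.
move=> h; have [] := @digits_realize R n (sval x) (dig y) (point_unit x).
  by move=> k /h.
move=> uy dy; apply: digit_inj => [||k]; [exact: point_unit|exact: uy|].
by rewrite dy.
Qed.

Section Coords.
Variable q : nat.
Hypothesis q0 : (0 < q)%N.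
Implicit Types z : 'rV[int]_q.

Lemma coord_act_ex x z : exists y, exists I, offset z I (dig x) (dig y).
Proof.
have [I0 /(_ I0 (leqnn _))] := mixed_fits q0 z (dig_mixed x q0).
move=> /(fits_offset q0)[d' hd]; have [y ey] := point_realize hd.1.
by exists y, I0; rewrite (funext ey).
Qed.

Definition coord_act x z : point_of := sval (cid (coord_act_ex x z)).

Lemma coord_actP x z : exists I, offset z I (dig x) (dig (coord_act x z)).
Proof. exact: (svalP (cid (coord_act_ex x z))). Qed.

Lemma offset_act x y z I : offset z I (dig x) (dig y) -> coord_act x z = y.
Proof.
move=> h; have [J hJ] := coord_actP x z; apply: dig_inj.
apply: (offset_inj q0 (z := z) (I := maxn I J) (d := dig x)).
  by apply: offset_le hJ; rewrite ?leq_maxr.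
by apply: offset_le h; rewrite ?leq_maxl.
Qed.

Lemma coord_diff_ex x y : exists z, same x y -> exists I, offset z I (dig x) (dig y).
Proof.
have [[n h]|ns] := pselect (same x y); last by exists 0.
have [|z hz] := @offset_ex q n (dig x) (dig y).
  by move=> k qn; apply: h; apply: leq_trans qn; rewrite leq_pmull.
by exists z => _; exists n.
Qed.

Definition coord_diff x y : 'rV[int]_q := sval (cid (coord_diff_ex x y)).

Lemma offset_diff x y z I : offset z I (dig x) (dig y) -> coord_diff x y = z.
Proof.
move=> h; have s : same x y by exists (q * I)%N; exact: h.1.
have [J hJ] := svalP (cid (coord_diff_ex x y)) s.
apply: (@offset_uniq q _ _ (maxn I J) (dig x) (dig y)).
  by apply: offset_le hJ; rewrite ?leq_maxr.
by apply: offset_le h; rewrite ?leq_maxl.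
Qed.

Lemma coord_diffP x y : same x y -> exists I, offset (coord_diff x y) I (dig x) (dig y).
Proof. exact: (svalP (cid (coord_diff_ex x y))). Qed.

Lemma generic_coords : orbit_coords same coord_act coord_diff.
Proof.
split.
- by move=> x z; have [I [h _]] := coord_actP x z; exists (q * I)%N.
- by move=> x z; have [I h] := coord_actP x z; exact: offset_diff h.
- by move=> x y /coord_diffP[I h]; exact: offset_act h.
- move=> x y w /coord_diffP[I h] /coord_diffP[J h'].
  apply: (offset_diff (I := maxn I J)).
  exact: offsetD (offset_le (leq_maxl I J) h) (offset_le (leq_maxr I J) h').
Qed.

Lemma fits_act x z I : fits z I (dig x) -> offset z I (dig x) (dig (coord_act x z)).
Proof.
move=> /(fits_offset q0)[d' hd]; have [y ey] := point_realize hd.1.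
have h : offset z I (dig x) (dig y) by rewrite (funext ey).
by rewrite (offset_act h).
Qed.

(** The displacement is a sum over the digits that change, and these are determined by the common
    prefix: the action is a translation on each cylinder. *)
Lemma fits_act_shift x x' z I : fits z I (dig x) -> fits z I (dig x') ->
  prefix (q * I) (sval x) = prefix (q * I) (sval x') ->
  sval (coord_act x z) - sval x = sval (coord_act x' z) - sval x'.
Proof.
move=> /fits_act h /fits_act h' /(digit_prefix _ (point_unit x) (point_unit x')) e.
rewrite (point_diff h.1) (point_diff h'.1) ![_ + _ - sval _]addrC !addrA !addNr !add0r.
apply: eq_bigr => k _; congr ((_%:R - _%:R) / _).
  by congr nat_of_bool; exact: (offset_prefix q0 h h').
by congr nat_of_bool; exact: e.
Qed.

Lemma fits_prefix x x' z I : prefix (q * I) (sval x) = prefix (q * I) (sval x') ->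
  fits z I (dig x) -> fits z I (dig x').
Proof.
move=> /(digit_prefix _ (point_unit x) (point_unit x')) e h j.
rewrite -(@eq_binval I (strand q j (dig x))) // => i iI; apply: e.
apply: (@leq_trans (q * i + q)%N); first by rewrite ltn_add2l.
by rewrite -mulnSr leq_mul2l iI orbT.
Qed.

End Coords.

Section TwoCoords.
Variables (a b : nat).
Hypotheses (a0 : (0 < a)%N) (b0 : (0 < b)%N).

(** The first [a * t] places of [b] strands and the first [b * t] places of [a] strands are the same
    [a * b * t] digits. Depths are multiples of [a] for this reason. *)
Lemma fits_diff x t (v : 'rV[int]_b) : fits v (a * t) (dig x) ->
  offset (coord_diff a0 x (coord_act b0 x v)) (b * t) (dig x) (dig (coord_act b0 x v)).
Proof.
move=> /(fits_act b0) h.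
have [|z hz] := @offset_ex a (b * t) (dig x) (dig (coord_act b0 x v)).
  by move=> k; rewrite mulnCA => /h.1.
by rewrite (offset_diff a0 hz).
Qed.

Lemma fits_diff_eq x x' t (v : 'rV[int]_b) :
  fits v (a * t) (dig x) -> fits v (a * t) (dig x') ->
  prefix (b * (a * t)) (sval x) = prefix (b * (a * t)) (sval x') ->
  coord_diff a0 x (coord_act b0 x v) = coord_diff a0 x' (coord_act b0 x' v).
Proof.
move=> f f' /(digit_prefix _ (point_unit x) (point_unit x')) e.
have [_ h] := fits_diff f; have [_ h'] := fits_diff f'.
have ea := offset_prefix b0 (fits_act b0 f) (fits_act b0 f') e.
have lt (j : 'I_a) i : (i < b * t)%N -> (a * i + j < b * (a * t))%N.
  move=> it; rewrite mulnCA; apply: (@leq_trans (a * i + a)%N); first by rewrite ltn_add2l.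
  by rewrite -mulnSr leq_mul2l it orbT.
apply/rowP => j; rewrite -h -h'; congr (_%:Z - _%:Z); apply: eq_binval => i it.
  by apply: ea; exact: lt.
by apply: e; exact: lt.
Qed.

Lemma fits_diff_bound x t (v : 'rV[int]_b) (j : 'I_a) : fits v (a * t) (dig x) ->
  (`|coord_diff a0 x (coord_act b0 x v) 0%R j| < 2 ^ (b * t))%N.
Proof.
move=> f; have [_ <-] := fits_diff f.
by have := binval_lt (b * t) (strand a j (dig x)); have := binval_lt (b * t) (strand a j (dig (coord_act b0 x v))); lia.
Qed.

End TwoCoords.

(** Some strand is constant from place [r] up to place [I]. Off this set, every vector with entries
    at most [2 ^ r] can be added within the first [I] places. *)
Definition unmixed (q r I : nat) : set R :=
  \big[setU/set0]_(u : 'I_q * bool) cylinder [seq (q * i + u.1)%N | i <- iota r (I - r)] u.2.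

Lemma unmixed_measurable q r I : measurable (unmixed q r I).
Proof. by apply: bigsetU_measurable => u _; exact: measurable_cylinder. Qed.

Lemma unmixed_measure q r I : (0 < q)%N ->
  (lebesgue_measure (unmixed q r I) <= ((2 * q)%:R * (2 ^+ (I - r))^-1)%:E)%E.
Proof.
move=> q0; apply: le_trans (measure_seqU_le _ _ _) _.
  by move=> u; exact: measurable_cylinder.
rewrite (eq_bigr (fun=> ((2 ^+ (I - r))^-1)%:E)) => [|u _].
  rewrite sumEFin lee_fin sumr_const card_prod card_ord card_bool.
  by rewrite mulnC -[leLHS]mulr_natl.
have ul : uniq [seq (q * i + u.1)%N | i <- iota r (I - r)].
  by rewrite map_inj_uniq ?iota_uniq // => i j /eqP; rewrite eqn_add2r eqn_pmul2l // => /eqP.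
by have := @cylinder_measure R _ u.2 ul; rewrite size_map size_iota.
Qed.

Lemma not_unmixed_fits q r I x (z : 'rV[int]_q) : (0 < q)%N ->
  (forall j : 'I_q, (`|z 0%R j| <= 2 ^ r)%N) -> ~ unmixed q r I (sval x) -> fits z I (dig x).
Proof.
move=> q0 hz h; apply: (fits_digits q0 hz) => j v.
apply: contrapT => nv; apply: h.
rewrite /unmixed -bigcup_seq; exists (j, ~~ v); first by rewrite /= mem_index_enum.
split; first exact: point_unit.
move=> _ /mapP[i + ->]; rewrite mem_iota => /andP[ri iI].
have ne : digit (q * i + j) (sval x) <> v.
  by move=> e; apply: nv; exists i => //; rewrite ri /=; lia.
by move: ne; clear; case: (digit _ _); case: v.
Qed.

Lemma mixed_not_unmixed q r x : (0 < q)%N ->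
  exists I0, forall I, (I0 <= I)%N -> ~ unmixed q r I (sval x).
Proof.
move=> q0.
have /choice[f hf] : forall u : 'I_q * bool, exists i, (r <= i)%N /\ strand q u.1 (dig x) i = u.2.
  by move=> [j v]; have [i ri di] := dig_mixed x q0 j v r; exists i.
exists (\max_u (f u).+1)%N => I hI; rewrite /unmixed -bigcup_seq => -[[j v] _ [_ /= h]].
have [ri di] := hf (j, ~~ v).
have fI : (f (j, ~~ v) < I)%N by apply: leq_trans hI; exact: (leq_bigmax (j, ~~ v)).
have mem : (q * f (j, ~~ v) + j)%N \in [seq (q * i + j)%N | i <- iota r (I - r)].
  by apply: (map_f (fun i => (q * i + j)%N)); rewrite mem_iota; lia.
have e : strand q j (dig x) (f (j, ~~ v)) = v := h _ mem.
by move: e; rewrite di /=; clear; case: v.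
Qed.

End Generic.

(** * Piecewise translations *)

(* [T] with the Borel structure and the Lebesgue measure inherited from the
   Borel subset [range io] of the line. *)
Definition embedded (R : realType) (T : Type) (t0 : T) (io : T -> R)
  (io_inj : injective io) (io_meas : measurable (range io)) : Type := T.

Section Embedded.
Variables (R : realType) (T : Type) (t0 : T) (io : T -> R).
Hypothesis io_inj : injective io.
Hypothesis io_meas : measurable (range io).

Local Notation E := (embedded t0 io_inj io_meas).

HB.instance Definition _ := gen_eqMixin E.
HB.instance Definition _ := gen_choiceMixin E.
HB.instance Definition _ := isPointed.Build E (t0 : E).

Definition emb_meas : set (set E) := [set A : set E | measurable (io @` A)].

Lemma emb_meas0 : emb_meas set0.
Proof. by rewrite /emb_meas /= image_set0; exact: measurable0. Qed.

Lemma emb_measC (A : set E) : emb_meas A -> emb_meas (~` A).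
Proof.
rewrite /emb_meas /= => mA.
have -> : io @` (~` A) = range io `\` io @` A.
  apply/seteqP; split=> [_ [x nA <-]|_ [[x _ <-] nA]].
    by split; [exists x|move=> [y Ay /io_inj yx]; apply: nA; rewrite -yx].
  by exists x => // Ax; apply: nA; exists x.
exact: measurableD.
Qed.

Lemma emb_meas_bigcup (A : (set E)^nat) : (forall i, emb_meas (A i)) ->
  emb_meas (\bigcup_i A i).
Proof. by move=> mA; rewrite /emb_meas /= image_bigcup; apply: bigcup_measurable => i _; exact: mA. Qed.

HB.instance Definition _ := @isMeasurable.Build default_measure_display E
  emb_meas emb_meas0 emb_measC emb_meas_bigcup.

Lemma emb_measurableE (A : set E) : measurable A = measurable (io @` A).
Proof. by []. Qed.

Lemma emb_standard : standard_borel R E.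
Proof.
exists (io : E -> R); split => // _ B mB; rewrite setTI emb_measurableE.
have -> : io @` (io @^-1` B) = range io `&` B.
  by apply/seteqP; split=> [_ [x Bx <-]|_ [[x _ <-] Bx]]; [split => //; exists x|exists x].
exact: measurableI.
Qed.

Definition emb_measure (A : set E) : \bar R := lebesgue_measure (io @` A).

Lemma emb_measure0 : emb_measure set0 = 0%E.
Proof. by rewrite /emb_measure image_set0 measure0. Qed.

Lemma emb_measure_ge0 A : (0 <= emb_measure A)%E.
Proof. exact: measure_ge0. Qed.

Lemma emb_disjoint (I : Type) (D : set I) (A : I -> set E) : trivIset D A ->
  trivIset D (fun i => io @` A i).
Proof.
move=> tA i j Di Dj [_ [[x Ax <-] [y Ay /io_inj yx]]].
by apply: tA => //; exists x; split=> //; rewrite -yx.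
Qed.

Lemma emb_measure_sigma : semi_sigma_additive emb_measure.
Proof.
move=> A mA tA mUA; rewrite /emb_measure image_bigcup.
apply: measure_semi_sigma_additive => //.
  exact: emb_disjoint.
by rewrite -image_bigcup.
Qed.

HB.instance Definition _ := isMeasure.Build _ E R emb_measure
  emb_measure0 emb_measure_ge0 emb_measure_sigma.

(** The pieces are made disjoint by [seqDU]. Each part [P n] of the preimage is a translate of its
    image [Q n], and the images partition [B] because [f] is a bijection. *)
Lemma piecewise_translation (f f' : E -> E) (A : nat -> set E) (t : nat -> R) :
  cancel f f' -> cancel f' f -> (forall n, measurable (A n)) ->
  (forall x, exists n, A n x) -> (forall n x, A n x -> io (f x) = io x + t n) ->
  forall B : set E, measurable B ->
    measurable (f @^-1` B) /\ emb_measure (f @^-1` B) = emb_measure B.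
Proof.
move=> fK fK' mA cA hA B mB.
pose D := seqDU A.
have mD n : measurable (D n).
  apply: measurableD; first exact: mA.
  by apply: bigsetU_measurable => i _; exact: mA.
have DA n x : D n x -> A n x by case.
have cD x : exists n, D n x.
  have : (\bigcup_n D n) x by rewrite -seqDU_bigcup_eq; have [n] := cA x; exists n.
  by move=> [n _]; exists n.
have tD : trivIset setT D by exact: trivIset_seqDU.
pose P n := D n `&` f @^-1` B.
have PE n : io @` P n = (io @` D n) `&` [set r | (io @` B) (r + t n)].
  apply/seteqP; split=> [_ [x [Dx Bx] <-]|_ [[x Dx <-] [y By]]].
    split; first by exists x.
    by exists (f x) => //; rewrite (hA n) //; exact: DA.
  rewrite -(hA n x (DA _ _ Dx)) => /io_inj yx; exists x => //.
  by split=> //=; rewrite -yx.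
have mP n : measurable (P n).
  by rewrite emb_measurableE PE; apply: measurableI; [exact: mD|exact: shift_meas].
have fBE : f @^-1` B = \bigcup_n P n.
  apply/seteqP; split=> [x Bx|x [n _ [_ Bx]]] //.
  by have [n Dx] := cD x; exists n.
split; first by rewrite fBE; exact: bigcup_measurable.
pose Q n := f @` P n.
have QE n : io @` P n = [set r | (io @` Q n) (r + t n)].
  apply/seteqP; split=> [_ [x [Dx Bx] <-]|r [_ [x [Dx Bx] <-]]].
    by exists (f x); [exists x|rewrite (hA n) //; exact: DA].
  by rewrite (hA n x (DA _ _ Dx)) => /addIr <-; exists x.
have QE' n : io @` Q n = [set r | (io @` P n) (r + - t n)].
  by rewrite QE; apply/seteqP; split=> r /=; rewrite subrK.
have mQ n : measurable (Q n).
  rewrite emb_measurableE QE'; apply: shift_meas; exact: mP.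
have BE : B = \bigcup_n Q n.
  apply/seteqP; split=> [y By|_ [n _ [x [_ Bx] <-]] //].
  have [n Dx] := cD (f' y); exists n => //; exists (f' y) => //.
  by split=> //=; rewrite fK'.
rewrite fBE [in RHS]BE.
have tP : trivIset setT P.
  by move=> i j _ _ [x [[xi _] [xj _]]]; apply: tD => //; exists x.
have tQ : trivIset setT Q.
  move=> i j _ _ [_ [[x [xi _] <-] [y [yj _] e]]].
  by apply: tD => //; exists x; split=> //; rewrite (can_inj fK (esym e)).
have sP := measure_semi_bigcup (emb_measure : {measure set E -> \bar R}) mP tP (bigcup_measurable (fun n _ => mP n)).
have sQ := measure_semi_bigcup (emb_measure : {measure set E -> \bar R}) mQ tQ (bigcup_measurable (fun n _ => mQ n)).
have muPQ n : emb_measure (P n) = emb_measure (Q n).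
  by rewrite /emb_measure QE; apply: lebesgue_measure_shift; exact: mQ.
apply: etrans sP _; apply: etrans (esym sQ); apply: eq_eseriesr => n _; exact: muPQ.
Qed.

Lemma piecewise_constant (V : Type) (h : E -> V) (A : nat -> set E) (S : set V) :
  (forall n, measurable (A n)) -> (forall x, exists n, A n x) ->
  (forall n x y, A n x -> A n y -> h x = h y) -> measurable (h @^-1` S).
Proof.
move=> mA cA hA.
have -> : h @^-1` S = \bigcup_(n in [set n | exists2 x, A n x & S (h x)]) A n.
  apply/seteqP; split=> [x Sx|x [n [y Ay Sy] Ax]]; last by rewrite /= (hA n x y).
  by have [n Ax] := cA x; exists n => //; exists x.
by apply: bigcup_measurable => n _; exact: mA.
Qed.

End Embedded.

(** * Integrability *)

Section WreathLength.
Variables (F : finGroupType) (a k : nat) (s : 'I_k -> wreath F a).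
Hypothesis gen : generates s.
Local Notation wl := (wordlen s).
Local Notation wlM := (wordlenM (wreath_laws F a) gen).
Implicit Types (x z : 'rV[int]_a).

Let mv := @move_by F a.

(** A common bound, with respect to [s], for the length of a unit move and of a single lamp at the
    origin. *)
Definition letter_cost : nat :=
  (\sum_i (wl (mv (unitv i)) + wl (mv (- unitv i))) + \sum_(h : F) wl (lamp_at a h))%N.

Lemma move_byD z z' : mv (z + z') = gmul (mv z) (mv z').
Proof. by apply: wreath_eq => // x; rewrite /lamp_fun /= mulg1. Qed.

Lemma wordlen_move1 i : (wl (mv (unitv i)) <= letter_cost)%N /\ (wl (mv (- unitv i)) <= letter_cost)%N.
Proof. by rewrite /letter_cost (bigD1 i) //=; split; lia. Qed.

Lemma wordlen_lamp h : (wl (lamp_at a h) <= letter_cost)%N.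
Proof. by rewrite /letter_cost [X in (_ + X)%N](bigD1 h) //=; lia. Qed.

Lemma wordlen_move0 : wl (mv 0) = 0%N.
Proof. exact: wordlen1. Qed.

Lemma wordlen_moveMn z n : (wl (mv (z *+ n)) <= n * wl (mv z))%N.
Proof.
elim: n => [|n IH]; first by rewrite mulr0n wordlen_move0.
by rewrite mulrS move_byD mulSn; apply: leq_trans (wlM _ _) _; rewrite leq_add2l.
Qed.

Lemma wordlen_moveZ (c : int) i : (wl (mv (c *: unitv i)) <= `|c| * letter_cost)%N.
Proof.
have [h1 h2] := wordlen_move1 i; case: c => n.
  rewrite -[Posz n]natz scaler_nat; apply: leq_trans (wordlen_moveMn _ _) _.
  by rewrite natz leq_mul2l h1 orbT.
rewrite NegzE -natz scaleNr scaler_nat -mulNrn; apply: leq_trans (wordlen_moveMn _ _) _.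
by rewrite natz abszN leq_mul2l h2 orbT.
Qed.

Lemma wordlen_move z : (wl (mv z) <= (\sum_j `|z 0%R j|) * letter_cost)%N.
Proof.
rewrite {1}(row_sum_delta z) big_distrl /=.
elim/big_rec2: _ => [|i w n _ h]; first by rewrite wordlen_move0.
rewrite move_byD; apply: leq_trans (wlM _ _) _; apply: leq_add => //.
exact: wordlen_moveZ.
Qed.

Lemma wordlen_move_bound z N : (forall j, (`|z 0%R j| <= N)%N) ->
  (wl (mv z) <= a * N * letter_cost)%N.
Proof.
move=> h; apply: leq_trans (wordlen_move z) _; rewrite leq_mul2r; apply/orP; right.
rewrite -[X in (X * N)%N]card_ord -sum_nat_const; apply: leq_sum => j _; exact: h.
Qed.

(** Go to [x], set the lamp, come back. *)
Lemma wordlen_single x h N : (forall j, (`|x 0%R j| <= N)%N) ->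
  (wl (lamp_single x h, 0%R) <= (2 * a * N + 1) * letter_cost)%N.
Proof.
move=> hx.
have -> : ((lamp_single x h, 0%R) : wreath F a) = gmul (mv x) (gmul (lamp_at a h) (mv (- x))).
  apply: wreath_eq => [y|] /=; last by rewrite add0r subrr.
  by rewrite /lamp_fun /= mul1g mulg1 subr_eq0.
apply: leq_trans (wlM _ _) _; apply: leq_trans (leq_add (leqnn _) (wlM _ _)) _.
have h1 := wordlen_move_bound hx.
have h2 : (wl (mv (- x)) <= a * N * letter_cost)%N.
  by apply: wordlen_move_bound => j; rewrite mxE abszN.
have := wordlen_lamp h; rewrite -/mv; lia.
Qed.

Lemma lamp_erase_fin (f : lamp F a) x :
  finite_set [set y | (if y == x then 1%g else lamp_fun f y) != 1%g].
Proof.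
by apply: sub_finite_set (proj2_sig f) => y /=; case: (y == x); rewrite ?eqxx.
Qed.

Definition lamp_erase (f : lamp F a) x : lamp F a :=
  exist _ (fun y => if y == x then 1%g else lamp_fun f y) (lamp_erase_fin f x).

Lemma wordlen_lamps (S : seq 'rV[int]_a) (f : lamp F a) N :
  (forall x, lamp_fun f x != 1%g -> x \in S) ->
  (forall x, x \in S -> forall j, (`|x 0%R j| <= N)%N) ->
  (wl (f, 0%R) <= size S * ((2 * a * N + 1) * letter_cost))%N.
Proof.
elim: S f => [|x S IH] f hf hS.
  have -> : ((f, 0%R) : wreath F a) = gone (wreath F a).
    apply: wreath_eq => // x; apply/eqP; rewrite [_ == _]/(lamp_fun f x == 1%g).
    by apply/negPn/negP => /hf.
  by rewrite wordlen1.
have -> : ((f, 0%R) : wreath F a) =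
    gmul ((lamp_single x (lamp_fun f x), 0%R) : wreath F a) ((lamp_erase f x, 0%R) : wreath F a).
  apply: wreath_eq => [y|] /=; last by rewrite addr0.
  rewrite /lamp_fun /= subr0; case: eqP => [->|_]; first by rewrite mulg1.
  by rewrite mul1g.
apply: leq_trans (wlM _ _) _; rewrite /= mulSn; apply: leq_add.
  by apply: wordlen_single; apply: hS; rewrite mem_head.
apply: IH => [y|y yS]; last by apply: hS; rewrite inE yS orbT.
rewrite /lamp_fun /=; case: (eqVneq y x) => [_|/eqP ne h]; first by move=> /eqP.
by have := hf y h; rewrite inE => /orP[/eqP|].
Qed.

(** What matters is that [N] enters linearly, each lamp being lit by a separate round trip: the
    number of lamps will be bounded in terms of the group element alone. *)
Lemma wordlen_bound (S : seq 'rV[int]_a) (u : wreath F a) N :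
  (forall x, lamp_fun u.1 x != 1%g -> x \in S) ->
  (forall x, x \in u.2 :: S -> forall j, (`|x 0%R j| <= N)%N) ->
  (wl u <= (size S).+1 * ((2 * a * N + 1) * letter_cost))%N.
Proof.
move=> hf hS.
have -> : u = gmul ((u.1, 0%R) : wreath F a) (mv u.2).
  apply: wreath_eq => [x|] /=; last by rewrite add0r.
  by rewrite /lamp_fun /= mulg1.
apply: leq_trans (wlM _ _) _; rewrite mulSn addnC; apply: leq_add.
  apply: leq_trans (wordlen_move_bound (hS _ (mem_head _ _))) _.
  by rewrite leq_mul2r; apply/orP; right; lia.
by apply: wordlen_lamps => // x xS; apply: hS; rewrite inE xS orbT.
Qed.

End WreathLength.

Section LpTail.
Context (R : realType) (d : measure_display) (T : measurableType d).
Variables (mu : {measure set T -> \bar R}) (D : set T) (h : T -> nat) (U : nat -> set T).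
Variables (a b : nat) (p C K : R).
Hypothesis mD : measurable D.
Hypothesis Dfin : (mu D < +oo)%E.
Hypothesis mU : forall t, measurable (U t).
Hypothesis mh : measurable_fun D (fun x => (h x)%:R : R).
Hypothesis C0 : 0 <= C.
Hypothesis p0 : 0 < p.
Hypothesis pba : p * b%:R < a%:R.
Hypothesis U_escape : forall x, D x -> exists t, ~ U t x.
Hypothesis h_bound : forall x t, D x -> ~ U t x -> (h x)%:R <= C * 2 ^+ (b * t).
Hypothesis U_measure : forall t, (mu (U t `&` D) <= (K / 2 ^+ (a * t))%:E)%E.

(** From one level to the next, the [p]-th powers grow by the factor [w] and the measures shrink by
    [2 ^ a]; [p * b < a] says that the ratio [r] is below 1. *)
Let w : R := 2 `^ (p * b%:R).
Let r : R := w / 2 ^+ a.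

Lemma tail_ratio : 0 <= r < 1.
Proof.
rewrite divr_ge0 ?powR_ge0 ?exprn_ge0 //= ltr_pdivrMr ?exprn_gt0 // mul1r.
rewrite -powR_mulrn //; rewrite /w /powR !gt_eqF // ltr_expR ltr_pM2r // ln_gt0 //; lra.
Qed.

Lemma powR_level t : (C * 2 ^+ (b * t)) `^ p = C `^ p * w ^+ t.
Proof.
rewrite powRM ?exprn_ge0 //; congr (_ * _).
rewrite /w -[RHS]powR_mulrn ?powR_ge0 // -powRrM -powR_mulrn // -powRrM natrM; congr (_ `^ _); ring.
Qed.

Lemma geometric_partial_le (c : R) n : 0 <= c ->
  \sum_(i < n) c * r ^+ i <= c / (1 - r).
Proof.
have /andP[r0 r1] := tail_ratio; move=> c0.
have r1' : 0 < 1 - r by lra.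
rewrite ler_pdivlMr // -mulr_sumr -mulrA ler_piMr //.
have -> : (\sum_(i < n) r ^+ i) * (1 - r) = 1 - r ^+ n.
  by rewrite mulrC -opprB mulNr -subrX1 opprB.
by rewrite gerBl exprn_ge0.
Qed.

Lemma Lp_of_tail : (\int[mu]_(x in D) ((h x)%:R `^ p)%:E < +oo)%E.
Proof.
(* The extra factor [w] shifts the index: a point for which [t.+1] is the first level outside the
   sets [U] lies in [U t], and is charged to that term of the series. *)
pose c := C `^ p * w.
have c0 : 0 <= c by rewrite mulr_ge0 ?powR_ge0.
have w0 : 0 <= w by exact: powR_ge0.
pose f t x : \bar R := ((c * w ^+ t) * \1_(U t) x)%:E.
have f0 t x : (0 <= f t x)%E by rewrite lee_fin mulr_ge0 // mulr_ge0 // exprn_ge0.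
have mf t : measurable_fun D (f t).
  apply/measurable_EFinP; apply: measurable_funM; first exact: measurable_cst.
  exact: measurable_indic.
have bound x : D x -> (((h x)%:R `^ p)%:E <= (C `^ p)%:E + \sum_(t <oo) f t x)%E.
  move=> Dx; have [t0 ht0] := U_escape Dx.
  have ex : exists t, `[< ~ U t x >] by exists t0; apply/asboolP.
  case: (ex_minnP ex) => t /asboolP ht tmin.
  have hp : (h x)%:R `^ p <= C `^ p * w ^+ t.
    rewrite -powR_level; apply: ge0_ler_powR; rewrite ?nnegrE //; first exact: ltW.
      by rewrite mulr_ge0 ?exprn_ge0.
    exact: h_bound.
  case: t ht tmin hp => [|t] ht tmin hp.
    rewrite expr0 mulr1 in hp; apply: le_trans (_ : (C `^ p)%:E <= _)%E; first by rewrite lee_fin.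
    by rewrite leeDl // nneseries_ge0.
  have Ut : U t x by apply: contrapT => /asboolP/tmin; rewrite ltnn.
  apply: (@le_trans _ _ (f t x)).
    rewrite lee_fin indicE mem_set // mulr1; apply: le_trans hp _.
    by rewrite exprS mulrA.
  apply: (@le_trans _ _ (\sum_(i <oo) f i x)%E); last by rewrite leeDr // lee_fin powR_ge0.
  rewrite (nneseriesD1 (n := t)) //.
  by rewrite leeDl // nneseries_ge0.
have ms : measurable_fun D (fun x => \sum_(t <oo) f t x)%E.
  by apply: ge0_emeasurable_sum.
apply: le_lt_trans (_ : (\int[mu]_(x in D) ((C `^ p)%:E + \sum_(t <oo) f t x) < +oo)%E).
  apply: ge0_le_integral => //.
  - by apply/measurable_EFinP; exact: (measurableT_comp (measurable_powR p) mh).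
  - by apply: emeasurable_funD => //; exact: measurable_cst.
rewrite ge0_integralD //; last 2 first.
- by move=> x _; rewrite lee_fin powR_ge0.
- by move=> x _; exact: nneseries_ge0.
rewrite integral_cst // integral_nneseries //.
apply: lte_add_pinfty; first by rewrite lte_mul_pinfty ?lee_fin ?powR_ge0.
apply: (@le_lt_trans _ _ ((c * `|K|) / (1 - r))%:E); last by rewrite ltry.
apply: lime_le; first by apply: is_cvg_nneseries => n _ _; apply: integral_ge0 => x _.
apply: nearW => n; rewrite big_mkord.
apply: le_trans (_ : (\sum_(i < n) (c * `|K| * r ^+ i)%:E <= _)%E); last first.
  by rewrite sumEFin lee_fin geometric_partial_le // mulr_ge0.
apply: lee_sum => t _.
rewrite /f; under eq_integral do rewrite EFinM.
rewrite ge0_integralZl_EFin //; last 2 first.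
- by apply/measurable_EFinP; exact: measurable_indic.
- by rewrite mulr_ge0 // exprn_ge0.
rewrite integral_indic //.
apply: (@le_trans _ _ ((c * w ^+ t)%:E * (K / 2 ^+ (a * t))%:E)%E).
  by apply: lee_wpmul2l => //; rewrite lee_fin mulr_ge0 // exprn_ge0.
rewrite -EFinM lee_fin /r expr_div_n -exprM.
have -> : c * w ^+ t * (K / 2 ^+ (a * t)) = c * (w ^+ t / 2 ^+ (a * t)) * K by ring.
have -> : c * `|K| * (w ^+ t / 2 ^+ (a * t)) = c * (w ^+ t / 2 ^+ (a * t)) * `|K| by ring.
by apply: ler_wpM2l; rewrite ?ler_norm // mulr_ge0 // divr_ge0 // exprn_ge0.
Qed.

End LpTail.

(** * Almost every point of the unit interval is generic *)

Section GenericMeasure.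
Variable R : realType.

(** The strand [j] is constant from place [N] on. Being contained in cylinders with [n] prescribed
    digits for every [n], this set is null, and countably many such sets exhaust the points of the
    interval that are not generic. *)
Definition stuck (u : nat * nat * bool * nat) : set R :=
  let: (q, j, v, N) := u in
  if (0 < q)%N && (j < q)%N then
    \bigcap_n cylinder [seq (q * i + j)%N | i <- iota N n] v
  else set0.

Definition nongeneric : set R :=
  \bigcup_n (if unpickle n is Some u then stuck u else set0).

Lemma stuck_measurable u : measurable (stuck u).
Proof.
case: u => [[[q j] v] N] /=; case: ifP => // _.
by apply: bigcap_measurable => // n _; exact: measurable_cylinder.
Qed.

Lemma stuck_null u : lebesgue_measure (stuck u) = 0%E.
Proof.
have mS := stuck_measurable u.
case: u mS => [[[q j] v] N]; set S := stuck _ => mS.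
have h n : (lebesgue_measure S <= ((2 ^+ n)^-1)%:E)%E.
  move: mS; rewrite /S /stuck; case: ifP => [/andP[q0 jq] mS|_ _]; last first.
    by rewrite measure0 lee_fin invr_ge0 exprn_ge0.
  have ul : uniq [seq (q * i + j)%N | i <- iota N n].
    by rewrite map_inj_uniq ?iota_uniq // => x y /eqP; rewrite eqn_add2r eqn_pmul2l // => /eqP.
  have := @cylinder_measure R _ v ul; rewrite size_map size_iota => <-.
  apply: le_measure; rewrite ?inE //; first exact: measurable_cylinder.
  by move=> x; apply.
apply/eqP; rewrite eq_le measure_ge0 andbT leNgt; apply/negP => pos.
have fS : lebesgue_measure S \is a fin_num.
  by rewrite ge0_fin_numE //; apply: le_lt_trans (h 0%N) _; rewrite ltry.
have x0 : 0 < fine (lebesgue_measure S) by apply: fine_gt0; rewrite pos ltey_eq fS.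
set x := fine _ in x0.
have := h (Num.truncn x^-1).+1; rewrite -(fineK fS) lee_fin -/x.
apply/negP; rewrite -ltNge invf_plt ?posrE ?exprn_gt0 //.
by apply: lt_le_trans (truncnS_gt _) _; rewrite -natrX ler_nat ltnW // ltn_expl.
Qed.

Lemma nongeneric_measurable : measurable nongeneric.
Proof.
by apply: bigcup_measurable => n _; case: unpickle => // u; exact: stuck_measurable.
Qed.

Lemma nongeneric_null : lebesgue_measure nongeneric = 0%E.
Proof.
pose S n := if unpickle n is Some u then stuck u else set0.
have mS n : measurable (S n) by rewrite /S; case: unpickle => // u; exact: stuck_measurable.
apply/eqP; rewrite eq_le measure_ge0 andbT.
apply: le_trans (measure_sigma_subadditive lebesgue_measure mS nongeneric_measurable (@subset_refl _ _)) _.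
by rewrite eseries0 // => n _ _; rewrite /S; case: unpickle => [u|]; [exact: stuck_null|exact: measure0].
Qed.

Lemma genericE : [set x : R | generic x] = [set` `[0, 1[] `\` nongeneric.
Proof.
apply/seteqP; split=> x.
  move=> [ux hx]; split; first by rewrite /= in_itv.
  move=> [n _]; case: unpickle => // -[[[q j] v] N] /=; case: ifP => // /andP[q0 jq] h.
  have [i Ni] := hx q q0 (Ordinal jq) (~~ v) N.
  have [_ /(_ (q * i + j)%N)] := h (i - N).+1 I.
  rewrite /strand => -> //; first by case: (v).
  by apply: (map_f (fun i => (q * i + j)%N)); rewrite mem_iota; lia.
move=> [] /=; rewrite in_itv /= => ux nx; split=> // q q0 j v N.
apply: contrapT => h; apply: nx; exists (pickle (q, nat_of_ord j, ~~ v, N)) => //.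
rewrite pickleK /= q0 ltn_ord /= => n _; split=> // _ /mapP[i + ->].
rewrite mem_iota => /andP[Ni _].
have ne : digit (q * i + j) x <> v by move=> e; apply: h; exists i.
by move: ne; clear; case: (digit _ _); case: v.
Qed.

Lemma generic_measurable : measurable [set x : R | generic x].
Proof. by rewrite genericE; apply: measurableD; [exact: measurable_itv|exact: nongeneric_measurable]. Qed.

Lemma generic_pos : (0 < lebesgue_measure [set x : R | generic x])%E.
Proof.
rewrite lt0e measure_ge0 andbT; apply/negP => /eqP h.
have : (lebesgue_measure ([set` `[0, 1[%R] : set R) <= 0%:E)%E.
  apply: (@le_trans _ _ (lebesgue_measure ([set x : R | generic x] `|` nongeneric))).
    apply: le_measure; rewrite ?inE; first exact: measurable_itv.
      by apply: measurableU; [exact: generic_measurable|exact: nongeneric_measurable].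
    move=> x ux; rewrite genericE; have [nx|nx] := pselect (nongeneric x); first by right.
    by left; split.
  apply: le_trans (measureU2 _ _ _) _.
  - exact: generic_measurable.
  - exact: nongeneric_measurable.
  - by rewrite [X in (X + _)%E]h [X in (_ + X)%E]nongeneric_null adde0.
by rewrite lebesgue_measure_itv /= lte_fin ltr01 oppr0 adde0 lee_fin ler10.
Qed.

End GenericMeasure.

(** * The coupling *)

Section Coupling.
Variables (R : realType) (F : finGroupType) (a b : nat).
Hypothesis a0 : (0 < a)%N.
Hypothesis b0 : (0 < b)%N.
Variables (cd : wreath F a -> nat) (ci : nat -> wreath F a).
Hypothesis cdK : cancel cd ci.
Hypothesis ciK : cancel ci cd.
Variable x0 : point_of R.

Local Notation X := (point_of R).
Local Notation T := (X * wreath F a)%type.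
Let GLa := wreath_laws F a.
Let GLb := wreath_laws F b.

(* The point [(x, m)] of [X * wreath F a] sits at [x] in the [m]-th unit interval. *)
Definition line_pos (w : T) : R := sval w.1 + (cd w.2)%:R.

Lemma line_pos_inj : injective line_pos.
Proof.
move=> [x m] [y l]; rewrite /line_pos /= => e.
have tr (z : X) n : Num.truncn (sval z + n%:R) = n.
  have /andP[z0 z1] := point_unit z; apply: truncn_def.
  by rewrite lerDr z0 -natr1 addrC ltrD2l.
have ml : m = l by apply: (can_inj cdK); rewrite -(tr x (cd m)) e tr.
by move: e; rewrite ml => /addIr/point_inj ->.
Qed.

Definition slice (S : set R) (n : nat) : set T := [set w | S (sval w.1) /\ cd w.2 = n].

Lemma slice_image S n : line_pos @` slice S n =
  [set r | ([set x | generic x] `&` S) (r + - n%:R)].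
Proof.
apply/seteqP; split=> [_ [[x m] [Sx /= mn] <-]|r [gx Sx]].
  by rewrite /line_pos /= mn addrK; split=> //; exact: svalP.
exists (exist _ _ gx, ci n); first by split=> //=; rewrite ciK.
by rewrite /line_pos /= ciK subrK.
Qed.

Lemma slice_image_meas S n : measurable S -> measurable (line_pos @` slice S n).
Proof.
move=> mS; rewrite slice_image; apply: shift_meas.
by apply: measurableI => //; exact: generic_measurable.
Qed.

Lemma line_pos_meas : measurable (range line_pos).
Proof.
have -> : range line_pos = \bigcup_n (line_pos @` slice setT n).
  apply/seteqP; split=> [_ [w _ <-]|_ [n _ [w _ <-]]]; last by exists w.
  by exists (cd w.2) => //; exists w.
by apply: bigcup_measurable => n _; exact: slice_image_meas.
Qed.

Local Notation Om := (embedded (x0, gone (wreath F a)) line_pos_inj line_pos_meas).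
Local Notation mu := (@emb_measure R T (x0, gone (wreath F a)) line_pos line_pos_inj line_pos_meas).

Lemma slice_meas S n : measurable S -> measurable (slice S n : set Om).
Proof. by move=> mS; rewrite emb_measurableE; exact: slice_image_meas. Qed.

Lemma slice_mu_le S n : measurable S -> (mu (slice S n) <= lebesgue_measure S)%E.
Proof.
move=> mS; rewrite /emb_measure slice_image lebesgue_measure_shift; last first.
  by apply: measurableI => //; exact: generic_measurable.
apply: le_measure; rewrite ?inE; [|exact: mS|by move=> x []].
by apply: measurableI => //; exact: generic_measurable.
Qed.

Lemma base_meas S : measurable S -> measurable ([set w | S (sval w.1)] : set Om).
Proof.
move=> mS; rewrite (_ : [set w : Om | S (sval w.1)] = \bigcup_n slice S n).
  by apply: bigcup_measurable => n _; exact: slice_meas.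
by apply/seteqP; split=> [w Sw|w [n _ []]] //; exists (cd w.2).
Qed.

Let Ca := generic_coords R a0.
Let Cb := generic_coords R b0.
Local Notation Ta := (coord_act a0).
Local Notation Tb := (coord_act b0).
Local Notation Da := (coord_diff a0).
Local Notation wc := (wreath_cocycle (@same_sym R) (@same_trans R) Cb Ca).

(** The skew product of the [Z^b]-action by the cocycle; the target group acts on the other side of
    the second factor. As [wc] is bijective at every point, each orbit of either group meets the
    slice of the identity exactly once. *)
Definition actG (g : wreath F b) (w : Om) : Om := (Tb w.1 g.2, gmul (wc g w.1) w.2).
Definition actL (l : wreath F a) (w : Om) : Om := (w.1, gmul w.2 (ginv l)).

Lemma wc1 x : wc (gone (wreath F b)) x = gone (wreath F a).
Proof.
have := wreath_cocycleM (@same_sym R) (@same_trans R) Cb Ca (gone (wreath F b)) (gone (wreath F b)) x.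
rewrite (gmul1g GLb) (coord_act0 (@same_sym R) (@same_trans R) Cb) => e.
by apply: (@gmulIg _ GLa (wc (gone (wreath F b)) x)); rewrite (gmul1g GLa).
Qed.

Lemma om_eq (w w' : Om) : w.1 = w'.1 -> w.2 = w'.2 -> w = w'.
Proof. by case: w w' => x m [y l] /= -> ->. Qed.

Lemma actG1 w : actG (gone (wreath F b)) w = w.
Proof.
apply: om_eq.
  exact: (coord_act0 (@same_sym R) (@same_trans R) Cb).
transitivity (gmul (wc (gone (wreath F b)) w.1) w.2) => //.
by rewrite wc1 (gmul1g GLa).
Qed.

Lemma actGM g h w : actG (gmul g h) w = actG g (actG h w).
Proof.
apply: om_eq.
  transitivity (Tb w.1 (h.2 + g.2)); first by rewrite addrC.
  by rewrite -(coord_actD (@same_trans R) Cb).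
transitivity (gmul (wc (gmul g h) w.1) w.2) => //.
by rewrite wreath_cocycleM -(gmulA GLa).
Qed.

Lemma actL1 w : actL (gone (wreath F a)) w = w.
Proof.
apply: om_eq => //; transitivity (gmul w.2 (ginv (gone (wreath F a)))) => //.
by rewrite -[RHS](gmulgK GLa (gone (wreath F a))) (gmulg1 GLa).
Qed.

Lemma actLM g h w : actL (gmul g h) w = actL g (actL h w).
Proof.
apply: om_eq => //; transitivity (gmul w.2 (ginv (gmul g h))) => //.
by rewrite (ginvM GLa) (gmulA GLa).
Qed.

Lemma act_comm g l w : actG g (actL l w) = actL l (actG g w).
Proof.
apply: om_eq => //; transitivity (gmul (wc g w.1) (gmul w.2 (ginv l))) => //.
by rewrite (gmulA GLa).
Qed.

Section Pieces.
Variable g : wreath F b.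

(** The vectors whose displacements determine the cocycle of [g]: one for the cursor, one for each
    listed lamp. *)
Definition steps : seq 'rV[int]_b := g.2 :: [seq g.2 - u | u <- lamp_supp g.1].

Definition fits_all t (x : X) : Prop := forall v, v \in steps -> fits v (a * t) (dig x).

(** A code [(t, P, m)] stands for a depth, the first [a * b * t] digits and a slice. On a piece both
    the cocycle and the displacement of [g] on the line are constant. Pieces of different depths may
    overlap. *)
Definition piece (n : nat) : set Om :=
  if unpickle n is Some (t, P, m) then
    [set w | fits_all t w.1 /\ slice [set x | unit_itv x /\ prefix (b * (a * t)) x = P] m w]
  else set0.

Lemma wc_const t x x' : fits_all t x -> fits_all t x' ->
  prefix (b * (a * t)) (sval x) = prefix (b * (a * t)) (sval x') -> wc g x = wc g x'.
Proof.
move=> f f' e; apply: wreath_cocycle_eq => [|u hu].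
  by apply: (fits_diff_eq a0 b0 (f _ _) (f' _ _) e); rewrite mem_head.
by apply: (fits_diff_eq a0 b0 (f _ _) (f' _ _) e);
  rewrite inE; apply/orP; right; apply: (map_f (fun u => g.2 - u)); exact: lamp_suppP.
Qed.

Lemma piece_meas n : measurable (piece n).
Proof.
rewrite /piece; case: unpickle => // -[[t P] m].
set A := [set w | _].
(* Whether the vectors of [steps g] fit depends on the prefix only, so a nonempty piece is a whole
   slice. *)
have [[w0 [f0 [[_ P0] _]]]|h] := pselect (exists w, A w); last first.
  rewrite (_ : A = set0) //; apply/seteqP; split=> // w Aw; apply: h; by exists w.
rewrite (_ : A = slice [set x | unit_itv x /\ prefix (b * (a * t)) x = P] m).
  by apply: slice_meas; exact: (@measurable_prefix R _ (fun k => k = P)).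
apply/seteqP; split=> [w []//|w hw]; split=> // v vs.
by apply: fits_prefix (f0 v vs); rewrite P0; case: hw => -[_ ->].
Qed.

Lemma piece_cover w : exists n, piece n w.
Proof.
have [t ft] : exists t, fits_all t w.1.
  have [I0 hI] : exists I0, forall I, (I0 <= I)%N -> forall v, v \in steps -> fits v I (dig w.1).
    elim: steps => [|v l [I0 IH]]; first by exists 0%N.
    have [I1 h1] := mixed_fits b0 v (dig_mixed w.1 b0).
    exists (maxn I0 I1) => I; rewrite geq_max => /andP[i0 i1] v'; rewrite inE => /orP[/eqP ->|].
      exact: h1.
    exact: IH.
  by exists I0; apply: hI; rewrite leq_pmull.
exists (pickle (t, prefix (b * (a * t)) (sval w.1), cd w.2)); rewrite /piece pickleK.
by split=> //; split=> //; split=> //; exact: point_unit.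
Qed.

Lemma piece_wc n w w' : piece n w -> piece n w' -> wc g w.1 = wc g w'.1.
Proof.
rewrite /piece; case: unpickle => // -[[t P] m] [f [[_ e] _]] [f' [[_ e'] _]].
by apply: (wc_const f f'); rewrite e e'.
Qed.

Lemma piece_shift n w w' : piece n w -> piece n w' ->
  line_pos (actG g w) - line_pos w = line_pos (actG g w') - line_pos w'.
Proof.
move=> pw pw'; have ewc := piece_wc pw pw'; move: pw pw'.
rewrite /piece; case: unpickle => // -[[t P] m] [f [[_ e] em]] [f' [[_ e'] em']].
have e2 : w.2 = w'.2 by apply: (can_inj cdK); rewrite em em'.
have := fits_act_shift b0 (f _ (mem_head _ _)) (f' _ (mem_head _ _)) _.
rewrite e e' => /(_ erefl) es.
rewrite /line_pos /actG /= ewc e2; move: es.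
set A := sval _; set B := sval _; set C := sval _; set D := sval _; lra.
Qed.

End Pieces.

Lemma actGK g : cancel (actG g) (actG (ginv g)).
Proof. by move=> w; rewrite -actGM (gmulVg GLb) actG1. Qed.

Lemma actGVK g : cancel (actG (ginv g)) (actG g).
Proof. by move=> w; rewrite -actGM (gmulgV GLb) actG1. Qed.

Lemma actLK g : cancel (actL g) (actL (ginv g)).
Proof. by move=> w; rewrite -actLM (gmulVg GLa) actL1. Qed.

Lemma actLVK g : cancel (actL (ginv g)) (actL g).
Proof. by move=> w; rewrite -actLM (gmulgV GLa) actL1. Qed.

Lemma actG_mp g (B : set Om) : measurable B ->
  measurable (actG g @^-1` B) /\ mu (actG g @^-1` B) = mu B.
Proof.
have /choice[t ht] : forall n, exists t, forall w, piece g n w ->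
    line_pos (actG g w) = line_pos w + t.
  move=> n; have [[w0 pw0]|h] := pselect (exists w, piece g n w); last first.
    by exists 0 => w pw; case: h; exists w.
  exists (line_pos (actG g w0) - line_pos w0) => w pw.
  by rewrite (piece_shift pw0 pw) addrC subrK.
apply: (piecewise_translation (actGK g) (actGVK g) (piece_meas g) (piece_cover g) ht).
Qed.

Lemma actL_mp l (B : set Om) : measurable B ->
  measurable (actL l @^-1` B) /\ mu (actL l @^-1` B) = mu B.
Proof.
pose A n : set Om := slice setT n.
pose t n : R := (cd (gmul (ci n) (ginv l)))%:R - n%:R.
apply: (@piecewise_translation _ _ _ _ _ _ (actL l) (actL (ginv l)) A t).
- exact: actLK.
- exact: actLVK.
- by move=> n; exact: slice_meas.
- by move=> w; exists (cd w.2).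
- move=> n w [_ e]; rewrite /t -e cdK /line_pos /actL /=; lra.
Qed.

Definition base : set Om := [set w : Om | w.2 = gone (wreath F a)].

Lemma baseE : base = slice setT (cd (gone (wreath F a))).
Proof.
apply/seteqP; split=> [w h|w [_ /(can_inj cdK)]] //.
by split=> //; rewrite (h : w.2 = _).
Qed.

Lemma base_measurable : measurable base.
Proof. by rewrite baseE; exact: slice_meas. Qed.

Lemma baseI S : base `&` [set w | S (sval w.1)] = slice S (cd (gone (wreath F a))).
Proof.
apply/seteqP; split=> w; rewrite /base /slice /=; first by move=> [-> ?].
by move=> [? /(can_inj cdK)].
Qed.

Lemma base_fin : (mu base < +oo)%E.
Proof.
pose U : set R := [set x | unit_itv x].
have UE : U = cylinder [::] true by apply/seteqP; split=> x; [split|case].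
have -> : base = base `&` [set w : Om | U (sval w.1)].
  by apply/seteqP; split=> [w bw|w []//]; split=> //; exact: point_unit.
rewrite baseI; apply: le_lt_trans (slice_mu_le _ _) _; rewrite UE; first exact: measurable_cylinder.
by have := @cylinder_measure R [::] true isT; rewrite expr0 invr1 => ->; rewrite ltry.
Qed.

Lemma base_pos : (0 < mu base)%E.
Proof.
rewrite baseE /emb_measure slice_image setIT lebesgue_measure_shift; first exact: generic_pos.
exact: generic_measurable.
Qed.

Lemma actG_free_action : mp_free_action (mu : {measure set Om -> \bar R}) actG.
Proof.
split.
- exact: actG1.
- exact: actGM.
- by move=> g _ B mB; rewrite setTI; exact: (actG_mp g mB).1.
- by move=> g B mB; exact: (actG_mp g mB).2.
(* A fixed point forces [wc g w.1] to be the identity, which injectivity of the cocycle at [w.1]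
   allows for the identity only. *)
- move=> g w /(congr1 snd) e; apply: (@wreath_cocycle_inj F _ _ (@same_sym R) (@same_trans R) _ _ _ _ _ _ Cb Ca w.1).
  change (wc g w.1 = wc (gone (wreath F b)) w.1); rewrite wc1.
  apply: (@gmulIg _ GLa w.2); apply: etrans e _.
  by rewrite (gmul1g GLa).
Qed.

Lemma actL_free_action : mp_free_action (mu : {measure set Om -> \bar R}) actL.
Proof.
split.
- exact: actL1.
- exact: actLM.
- by move=> l _ B mB; rewrite setTI; exact: (actL_mp l mB).1.
- by move=> l B mB; exact: (actL_mp l mB).2.
- move=> l w /(congr1 snd) e; apply: (can_inj (ginvK GLa)).
  apply: (@gmulgI _ GLa w.2); apply: etrans e _.
  by rewrite -[LHS](gmulgK GLa (gone (wreath F a))) (gmulg1 GLa).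
Qed.

Lemma base_actG_domain : fund_domain (mu : {measure set Om -> \bar R}) actG base.
Proof.
split; [exact: base_measurable| |exact: base_fin].
move=> w; have [g hg] := wreath_cocycle_surj (@same_sym R) (@same_trans R) Cb Ca w.1 (ginv w.2).
exists g; split.
  by rewrite /base /=; transitivity (gmul (wc g w.1) w.2) => //; rewrite hg (gmulVg GLa).
move=> g' /(ginv_unique GLa) hg'.
by apply: (@wreath_cocycle_inj F _ _ (@same_sym R) (@same_trans R) _ _ _ _ _ _ Cb Ca w.1); rewrite hg hg'.
Qed.

Lemma base_actL_domain : fund_domain (mu : {measure set Om -> \bar R}) actL base.
Proof.
split; [exact: base_measurable| |exact: base_fin].
move=> w; exists w.2; split.
  by rewrite /base /=; transitivity (gmul w.2 (ginv w.2)) => //; rewrite (gmulgV GLa).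
by move=> l /(ginv_unique GLa); rewrite (ginvK GLa).
Qed.

Section Integrability.
Variables (k : nat) (s : 'I_k -> wreath F a) (p : R).
Hypothesis gen : generates s.
Hypothesis p0 : 0 < p.
Hypothesis pba : p * b%:R < a%:R.
Variable g : wreath F b.

Lemma wc_length : exists C, forall t x, fits_all g t x ->
  (wordlen s (wc g x) <= C * 2 ^ (b * t))%N.
Proof.
(* Lamp positions are differences of two vectors with entries below [P = 2 ^ (b * t)], so
   [wordlen_bound] is applied with [2 * P]; and [2 * a * (2 * P) + 1 <= (4 * a + 1) * P]. *)
exists ((size (lamp_supp g.1)).+1 * ((4 * a + 1) * letter_cost s))%N => t x ft.
pose pos v := Da x (Tb x v).
have posB v : v \in steps g -> forall j, (`|pos v 0%R j| < 2 ^ (b * t))%N.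
  by move=> vs j; exact: (fits_diff_bound a0 b0 j (ft v vs)).
pose S := [seq pos g.2 - pos (g.2 - u) | u <- lamp_supp g.1].
have h0 := posB _ (mem_head _ _).
have := @wordlen_bound F a k s gen S (wc g x) (2 * 2 ^ (b * t))%N.
move=> /(_ _ _)/leq_trans; apply.
- move=> w hw; have [u [gu ->]] := wreath_cocycle_lamp hw.
  by apply: (map_f (fun u => pos g.2 - pos (g.2 - u))); apply: lamp_suppP; rewrite gu.
- move=> y; rewrite inE => /orP[/eqP -> j|/mapP[u us ->] j].
    change (`|pos g.2 0%R j| <= 2 * 2 ^ (b * t))%N; have := h0 j; lia.
  have h1 : (`|pos (g.2 - u)%R 0%R j| < 2 ^ (b * t))%N.
    by apply: posB; rewrite inE; apply/orP; right; apply: (map_f (fun u => g.2 - u)).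
  suff aux (c c' : int) (P : nat) :
      (`|c| < P -> `|c'| < P -> `|(c - c')%R| <= 2 * P)%N by rewrite !mxE; apply: aux.
  by clear; lia.
rewrite size_map -[leqRHS]mulnA leq_mul2l; apply/orP; right.
rewrite [leqRHS]mulnAC leq_mul2r; apply/orP; right.
have : (0 < 2 ^ (b * t))%N by rewrite expn_gt0.
by move: (2 ^ _)%N => P P0; nia.
Qed.

Lemma wc_length_meas : measurable_fun base (fun w => (wordlen s (wc g w.1))%:R : R).
Proof.
move=> mB Y mY; apply: measurableI => //.
apply: (piecewise_constant _ (piece_meas g) (piece_cover g)) => n w w' pw pw'.
by rewrite (piece_wc pw pw').
Qed.

Lemma wc_length_Lp : (\int[(mu : {measure set Om -> \bar R})]_(w in base) ((wordlen s (wc g w.1))%:R `^ p)%:E < +oo)%E.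
Proof.
have [C hC] := wc_length.
have [r hr] : exists r, forall v, v \in steps g -> forall j : 'I_b, (`|v 0%R j| <= 2 ^ r)%N.
  elim: (steps g) => [|v l [r IH]]; first by exists 0%N.
  exists (r + \max_j `|v 0%R j|)%N => v'; rewrite inE => /orP[/eqP ->|/IH h] j.
    apply: leq_trans (ltnW (ltn_expl _ (ltnSn 1))).
    by apply: leq_trans (leq_addl _ _); exact: (leq_bigmax j).
  by apply: leq_trans (h j) _; rewrite leq_exp2l // leq_addr.
(* Off the exceptional set of level [t], all of [steps g] fits at depth [a * t]. In the last
   constant, [2 * b] counts the strands with a choice of digit, and [2 ^ r] makes up for the blocks
   starting at place [r]. *)
apply: (@Lp_of_tail _ _ _ (mu : {measure set Om -> \bar R}) base (fun w => wordlen s (wc g w.1))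
   (fun t => [set w : Om | unmixed b r (a * t) (sval w.1)]) a b p C%:R ((2 * b)%:R * 2 ^+ r)) => //.
- exact: base_measurable.
- exact: base_fin.
- by move=> t; apply: base_meas; exact: unmixed_measurable.
- exact: wc_length_meas.
- move=> w _; have [I0 hI] := mixed_not_unmixed r w.1 b0.
  by exists I0; apply: hI; rewrite leq_pmull.
- move=> w t _ /= nU; rewrite -natrX -natrM ler_nat; apply: hC => v vs.
  by apply: not_unmixed_fits nU => //; exact: hr.
- move=> t; rewrite setIC baseI; apply: le_trans (slice_mu_le _ _) _; first exact: unmixed_measurable.
  apply: le_trans (unmixed_measure _ _ _ b0) _; rewrite lee_fin -mulrA ler_wpM2l //.
  (* Truncated subtraction is harmless: [a * t <= r + (a * t - r)] holds also when [a * t < r]. *)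
  rewrite ler_pdivlMr ?exprn_gt0 // mulrC ler_pdivrMr ?exprn_gt0 // -exprD.
  by rewrite ler_eXn2l ?ltr1n //; lia.
Qed.

End Integrability.

End Coupling.

Lemma coupling_exists (R : realType) (F : finGroupType) (a b k : nat) (p : R)
    (s : 'I_k -> wreath F a) :
  (0 < a)%N -> (0 < b)%N -> 0 < p -> generates s -> p < a%:R / b%:R ->
  LpL0_ME_coupling (wreath F b) (wreath F a) s p.
Proof.
move=> a0 b0 p0 gen; rewrite ltr_pdivlMr ?ltr0n // => pba.
have [ci [ciI ciS]] := wreath_enum F a0.
have /choice[cd cdK] := ciS.
have ciK : cancel ci cd by move=> n; apply: ciI; rewrite cdK.
have [x gx] : exists x : R, generic x.
  apply: contrapT => h; have := generic_pos R.
  rewrite (_ : [set x : R | generic x] = set0) ?measure0 ?ltxx //.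
  by apply/seteqP; split=> // x gx; apply: h; exists x.
pose x0 : point_of R := exist _ x gx.
pose E := embedded (x0, gone (wreath F a)) (@line_pos_inj R F a cd ci cdK) (@line_pos_meas R F a cd ci ciK).
exists default_measure_display, E, (@emb_measure R _ _ _ _ _ : {measure set E -> \bar R}),
  (@actG R F a b a0 b0 cd ci cdK ciK x0), (@actL R F a cd ci cdK ciK x0),
  (@base R F a cd ci cdK ciK x0), (@base R F a cd ci cdK ciK x0).
split.
- exact: emb_standard.
- apply: lt_le_trans (base_pos cdK ciK x0) _.
  by apply: le_measure; rewrite ?inE //; exact: base_measurable.
- by split; [exact: actG_free_action|exact: actL_free_action].
- exact: act_comm.
split; [exact: base_actG_domain|exact: base_actL_domain|move=> g].
exists (fun w => wreath_cocycle (@same_sym R) (@same_trans R) (generic_coords R b0)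
  (generic_coords R a0) g w.1); split.
- move=> w w1; rewrite /base /=; set c := wreath_cocycle _ _ _ _ g w.1.
  transitivity (gmul (gmul c w.2) (ginv c)) => //.
  by rewrite (w1 : w.2 = _) (gmulg1 (wreath_laws F a)) (gmulgV (wreath_laws F a)).
- exact: wc_length_meas.
- exact: wc_length_Lp.
Qed.

Unset Implicit Arguments.

Theorem theorem4p6 (R : realType) (F : finGroupType) (a b : nat) (p : R)
    (k : nat) (s : 'I_k -> wreath F a) :
  (1 < #|F|)%N -> (0 < a)%N -> (a < b)%N -> 0 < p -> generates s ->
  LpL0_ME_coupling (wreath F b) (wreath F a) s p <-> p < a%:R / b%:R.
Proof.
move=> F1 a0 ab p0 gen; split; first exact: coupling_exponent_lt.
exact: coupling_exists a0 (leq_ltn_trans (leq0n a) ab) p0 gen.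
Qed.
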